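(* Let $f\colon\widehat{\mathbb{C}}\to\widehat{\mathbb{C}}$ be a hyperbolic, postcritically finite rational map of degree at least $2$ with $\#\operatorname{post}(f)=3$ that is not a polynomial. Then $f$ does not arise as a mating.
   Context: $f$ is hyperbolic if every critical point lies in the Fatou set. ''Not a polynomial'' means there is no point $\infty$ with $f^{-1}(\infty)=\{\infty\}$ (no totally invariant point). Topological mating: Let $P$ be a monic polynomial of degree $d$ with connected, locally connected filled Julia set $\mathcal{K}$; the Riemann map $\phi\colon\widehat{\mathbb{C}}\setminus\overline{\mathbb{D}}\to\widehat{\mathbb{C}}\setminus\mathcal{K}$ with $\phi(\infty)=\infty$, $\phi'(\infty)>0$ extends continuously to $\sigma\colon\mathbb{R}/\mathbb{Z}\to\partial\mathcal{K}$ (using $t\mapsto e^{2\pi it}$). For two such monic polynomials $P_{\tt w},P_{\tt b}$ of the same degree, $\mathcal{K}_{\tt w}\perp\!\!\!\perp\mathcal{K}_{\tt b}$ is the quotient of $\mathcal{K}_{\tt w}\sqcup\mathcal{K}_{\tt b}$ by the equivalence relation generated by $\sigma_{\tt w}(t)\sim\sigma_{\tt b}(-t)$, and the topological mating is the induced map, equal to $P_{\tt w}$ on $\mathcal{K}_{\tt w}$ and $P_{\tt b}$ on $\mathcal{K}_{\tt b}$. $f$ arises as a mating if it is topologically conjugate to such a topological mating of two postcritically finite monic polynomials. *)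

(* Defs.v *)
From Stdlib Require Import Reals Relations.Relation_Operators List.
Open Scope R_scope.

Definition C : Type := (R * R)%type.
Definition C0 : C := (0, 0).
Definition C1 : C := (1, 0).
Definition RtoC (x : R) : C := (x, 0).
Definition Cadd (z w : C) : C := (fst z + fst w, snd z + snd w).
Definition Copp (z : C) : C := (- fst z, - snd z).
Definition Csub (z w : C) : C := Cadd z (Copp w).
Definition Cmul (z w : C) : C :=
  (fst z * fst w - snd z * snd w, fst z * snd w + snd z * fst w).
Definition Cinv (z : C) : C :=
  (fst z / (fst z ^ 2 + snd z ^ 2), - snd z / (fst z ^ 2 + snd z ^ 2)).
Definition Cdiv (z w : C) : C := Cmul z (Cinv w).
Definition Cnorm (z : C) : R := sqrt (fst z ^ 2 + snd z ^ 2).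
Fixpoint Cpow (z : C) (n : nat) : C :=
  match n with O => C1 | S k => Cmul z (Cpow z k) end.
Definition Cexp2pi (t : R) : C := (cos (2 * PI * t), sin (2 * PI * t)).

Definition Ceq_dec (z w : C) : {z = w} + {z <> w}.
Proof.
  destruct z as [a b], w as [c d].
  destruct (Req_dec_T a c) as [H1|H1]; [destruct (Req_dec_T b d) as [H2|H2]|].
  - left; subst; reflexivity.
  - right; intro H; inversion H; auto.
  - right; intro H; inversion H; auto.
Defined.

Definition has_cderiv (g : C -> C) (p L : C) : Prop :=
  forall eps, 0 < eps -> exists delta, 0 < delta /\
    forall w, 0 < Cnorm (Csub w p) < delta ->
      Cnorm (Csub (Csub (g w) (g p)) (Cmul L (Csub w p))) <= eps * Cnorm (Csub w p).

Fixpoint peval (a : nat -> C) (m : nat) (z : C) : C :=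
  match m with
  | O => a O
  | S k => Cadd (peval a k z) (Cmul (a (S k)) (Cpow z (S k)))
  end.

(* ---------- Riemann sphere: None = infinity ---------- *)
Definition Csph : Type := option C.

Definition chord (x y : Csph) : R :=
  match x, y with
  | Some z, Some w =>
      2 * Cnorm (Csub z w) / (sqrt (1 + Cnorm z ^ 2) * sqrt (1 + Cnorm w ^ 2))
  | Some z, None | None, Some z => 2 / sqrt (1 + Cnorm z ^ 2)
  | None, None => 0
  end.

Definition is_rational_map (f : Csph -> Csph) (d : nat) : Prop :=
  exists (a b : nat -> C) (m n : nat),
    a m <> C0 /\ b n <> C0 /\ d = Nat.max m n /\
    (forall z, ~ (peval a m z = C0 /\ peval b n z = C0)) /\
    (forall z, peval b n z <> C0 -> f (Some z) = Some (Cdiv (peval a m z) (peval b n z))) /\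
    (forall z, peval b n z = C0 -> f (Some z) = None) /\
    f None = (if Nat.ltb n m then None
              else if Nat.eqb m n then Some (Cdiv (a m) (b n)) else Some C0).

Definition chart (c : Csph) (x : Csph) : C :=
  match c with
  | Some _ => match x with Some w => w | None => C0 end
  | None => match x with Some w => Cinv w | None => C0 end
  end.
Definition chart_inv (c : Csph) (w : C) : Csph :=
  match c with
  | Some _ => Some w
  | None => if Ceq_dec w C0 then None else Some (Cinv w)
  end.
Definition local_expr (f : Csph -> Csph) (c : Csph) (w : C) : C :=
  chart (f c) (f (chart_inv c w)).

Definition is_critical (f : Csph -> Csph) (c : Csph) : Prop :=
  has_cderiv (local_expr f c) (chart c c) C0.

Fixpoint iter {A : Type} (n : nat) (g : A -> A) (x : A) : A :=
  match n with O => x | S k => g (iter k g x) end.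

(* Fatou set: {f^n} equicontinuous (= normal, Arzela-Ascoli) on a neighbourhood *)
Definition in_Fatou (f : Csph -> Csph) (z : Csph) : Prop :=
  exists r, 0 < r /\
    forall w, chord w z < r ->
      forall eps, 0 < eps -> exists delta, 0 < delta /\
        forall (n : nat) w', chord w' z < r -> chord w' w < delta ->
          chord (iter n f w') (iter n f w) < eps.

Definition postcritical (f : Csph -> Csph) (w : Csph) : Prop :=
  exists c n, is_critical f c /\ w = iter (S n) f c.

Definition hyperbolic (f : Csph -> Csph) : Prop :=
  forall c, is_critical f c -> in_Fatou f c.

Definition postcritically_finite (f : Csph -> Csph) : Prop :=
  exists L : list Csph, forall w, postcritical f w -> In w L.

Definition post_card3 (f : Csph -> Csph) : Prop :=
  exists p1 p2 p3, p1 <> p2 /\ p1 <> p3 /\ p2 <> p3 /\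
    forall w, postcritical f w <-> (w = p1 \/ w = p2 \/ w = p3).

(* "not a polynomial": no totally invariant point *)
Definition is_polynomial_like (f : Csph -> Csph) : Prop :=
  exists w, forall z, f z = w <-> z = w.

Definition monic_deg (a : nat -> C) (d : nat) : Prop := a d = C1.

Definition poly_pcf (a : nat -> C) (d : nat) : Prop :=
  exists L : list C, forall c n,
    has_cderiv (peval a d) c C0 -> In (iter (S n) (peval a d) c) L.

Definition filled_julia (a : nat -> C) (d : nat) (z : C) : Prop :=
  exists M, forall n, Cnorm (iter n (peval a d) z) <= M.

Definition Copen (U : C -> Prop) : Prop :=
  forall z, U z -> exists r, 0 < r /\ forall w, Cnorm (Csub w z) < r -> U w.

Definition Cconnected (S : C -> Prop) : Prop :=
  forall U V, Copen U -> Copen V ->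
    (forall z, S z -> U z \/ V z) ->
    (forall z, ~ (S z /\ U z /\ V z)) ->
    (forall z, ~ (S z /\ U z)) \/ (forall z, ~ (S z /\ V z)).

Definition Clocally_connected (S : C -> Prop) : Prop :=
  forall z U, S z -> Copen U -> U z ->
    exists V, Copen V /\ V z /\ (forall w, S w -> V w -> U w) /\
      Cconnected (fun w => S w /\ V w).

Definition in_boundary (S : C -> Prop) (z : C) : Prop :=
  S z /\ forall r, 0 < r -> exists w, ~ S w /\ Cnorm (Csub w z) < r.

(* phi : exterior of closed unit disk -> complement of K, conformal
   (holomorphic bijection), phi(oo) = oo, phi'(oo) = lim phi(z)/z > 0,
   extending continuously to sigma : R/Z -> boundary K via t |-> e^{2 pi i t}. *)
Definition riemann_map_ext (K : C -> Prop) (phi : C -> C) (sigma : R -> C) : Prop :=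
  (forall z, 1 < Cnorm z -> ~ K (phi z)) /\
  (forall w, ~ K w -> exists z, 1 < Cnorm z /\ phi z = w) /\
  (forall z1 z2, 1 < Cnorm z1 -> 1 < Cnorm z2 -> phi z1 = phi z2 -> z1 = z2) /\
  (forall z, 1 < Cnorm z -> exists L, has_cderiv phi z L) /\
  (exists c, 0 < c /\ forall eps, 0 < eps -> exists M, forall z,
      M < Cnorm z -> Cnorm (Csub (Cdiv (phi z) z) (RtoC c)) < eps) /\
  (forall t, sigma (t + 1) = sigma t) /\
  (forall t, in_boundary K (sigma t)) /\
  (forall t eps, 0 < eps -> exists delta, 0 < delta /\
     forall z, 1 < Cnorm z -> Cnorm (Csub z (Cexp2pi t)) < delta ->
       Cnorm (Csub (phi z) (sigma t)) < eps).

Definition mate_dom (Kw Kb : C -> Prop) (x : C + C) : Prop :=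
  match x with inl z => Kw z | inr z => Kb z end.

Definition mate_base_rel (sw sb : R -> C) (x y : C + C) : Prop :=
  exists t, x = inl (sw t) /\ y = inr (sb (- t)).

Definition mate_map (Pw Pb : C -> C) (x : C + C) : C + C :=
  match x with inl z => inl (Pw z) | inr z => inr (Pb z) end.

Definition sum_dist (x y : C + C) : R :=
  match x, y with
  | inl z, inl w | inr z, inr w => Cnorm (Csub z w)
  | _, _ => 1
  end.

(* f is topologically conjugate to the topological mating: there is a
   continuous surjection h : K_w ⊔ K_b -> sphere whose fibres are exactly
   the equivalence classes of ~ and with h o (P_w ⊔ P_b) = f o h
   (equivalently, h descends to a conjugating homeomorphism from the
   quotient, since K_w ⊔ K_b is compact and the sphere is Hausdorff). *)
Definition conj_to_mating (f : Csph -> Csph) (Kw Kb : C -> Prop)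
    (Pw Pb : C -> C) (sw sb : R -> C) : Prop :=
  exists h : C + C -> Csph,
    (forall x eps, mate_dom Kw Kb x -> 0 < eps -> exists delta, 0 < delta /\
       forall y, mate_dom Kw Kb y -> sum_dist y x < delta -> chord (h y) (h x) < eps) /\
    (forall w, exists x, mate_dom Kw Kb x /\ h x = w) /\
    (forall x y, mate_dom Kw Kb x -> mate_dom Kw Kb y ->
       (h x = h y <-> clos_refl_sym_trans (C + C) (mate_base_rel sw sb) x y)) /\
    (forall x, mate_dom Kw Kb x -> h (mate_map Pw Pb x) = f (h x)).

Definition arises_as_mating (f : Csph -> Csph) : Prop :=
  exists (d : nat) (aw ab : nat -> C),
    (2 <= d)%nat /\
    monic_deg aw d /\ monic_deg ab d /\
    poly_pcf aw d /\ poly_pcf ab d /\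
    Cconnected (filled_julia aw d) /\ Cconnected (filled_julia ab d) /\
    Clocally_connected (filled_julia aw d) /\ Clocally_connected (filled_julia ab d) /\
    exists (phiw phib : C -> C) (sw sb : R -> C),
      riemann_map_ext (filled_julia aw d) phiw sw /\
      riemann_map_ext (filled_julia ab d) phib sb /\
      conj_to_mating f (filled_julia aw d) (filled_julia ab d)
        (peval aw d) (peval ab d) sw sb.

(* Main.v *)
(** Each polynomial [P] of the mating is conjugate to [z ^ d] outside its filled Julia set [K]
    (Boettcher), so [P (sigma t) = sigma (d t)]: the boundary of [K] is the continuous image
    of the circle, and [P] acts on it by angle multiplication.  Let [E] be the image in the
    sphere of the glued boundaries.  If [f] were equicontinuous near a point of [E], then, a
    small arc being spread by an iterate over the whole circle, [E] would be a single point;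
    that point would be totally invariant, which is excluded.  Hence [E] misses the Fatou set,
    and since [f] is hyperbolic its critical points, and with them the three postcritical
    points, come from the interiors of the two filled Julia sets.  There [f^-1] is computed by
    the polynomials.  One interior contains at most one postcritical point.  By Riemann-Hurwitz
    [f] has at most [d + 2] points over its postcritical set, whereas a polynomial of degree
    [d] has at least [(k - 1) d + 1] points over [k] values.  So that interior contains exactly
    one postcritical point [p], and a single point lies over [p].  As [f] maps [p] to a
    postcritical point of the same interior, [f p = p], so [p] is totally invariant, a
    contradiction.

    Boettcher's conjugacy is obtained by estimates in the exterior of discs, where Cauchy's
    formula comes from Goursat's lemma in logarithmic coordinates.  With [phi] the Riemann map,
    the maximum principle for [P^n (phi z) / z ^ (d ^ n)] and its inverse shows that
    [phi y = P (phi z)] implies [|y| = |z| ^ d].  These quotients then tend to [1], uniformly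
    on [|z| >= rho > 1], which makes [y / z ^ d] a root of unity of bounded order; it is
    continuous in [z] and tends to [1] at infinity, so it is [1]. *)

From Stdlib Require Import Reals Ranalysis5 ZArith Lra Lia List FinFun.
From Stdlib Require Import ClassicalEpsilon Classical Relations.Relation_Operators.
From mathcomp Require all_boot all_order all_algebra ring zify Rstruct complex.
Require Import Defs.
From Coquelicot Require Import Coquelicot.
Open Scope R_scope.
Open Scope C_scope.

(** * Complex differentiability *)

(** Boettcher's coordinate is usually built near infinity by extracting roots and then extended by
    the dynamics. Here the candidate is given on the whole exterior, as the inverse of [phi], so
    nothing has to be extended: it is enough that [phi y = P (phi z)] forces [y = z ^ d]. Moduli are
    compared first because a maximum principle controls them without any branch of a logarithm; this
    comparison stands in for Green's function. The functions involved are holomorphic outside a disc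
    and have a limit at infinity, so their mean over a circle is that limit; Cauchy's formula and
    the maximum principle are drawn from this fact. The degree [d] of the polynomials is not assumed
    to equal the degree [D] of [f]. Only [D <= d] is derived, by comparing fibres over a noncritical
    value taken in an interior, and the count asks for no more: two postcritical points in one
    interior have at least [d + 1] preimages there, which leaves at most one of the [D + 2] points
    for the third. *)

Definition ccont (g : C -> C) (p : C) : Prop :=
  forall eps, (0 < eps)%R -> exists delta, (0 < delta)%R /\
    forall w, (Cmod (w - p) < delta)%R -> (Cmod (g w - g p) < eps)%R.

Lemma Cmod_sub_sym (z w : C) : Cmod (z - w) = Cmod (w - z).
Proof. rewrite <- Cmod_opp. f_equal. ring. Qed.

Lemma Cmod_sub_triangle (z w v : C) : (Cmod (z - v) <= Cmod (z - w) + Cmod (w - v))%R.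
Proof. replace (z - v) with ((z - w) + (w - v)) by ring. apply Cmod_triangle. Qed.

Lemma Cmod_sub_ge (z w : C) : (Cmod z - Cmod w <= Cmod (z - w))%R.
Proof.
  generalize (Cmod_triangle (z - w) w). replace (z - w + w) with z by ring. lra.
Qed.

Lemma Cmod_sub_refl (z : C) : Cmod (z - z) = 0.
Proof. replace (z - z) with (RtoC 0) by ring. apply Cmod_0. Qed.

Lemma Csub_neq0 (z w : C) : z <> w -> z - w <> 0.
Proof. intros H E. apply H. replace z with (z - w + w) by ring. rewrite E. ring. Qed.

Lemma Cmod_sub_pos (z w : C) : z <> w -> (0 < Cmod (z - w))%R.
Proof. intros H. apply Cmod_gt_0, Csub_neq0, H. Qed.

Lemma ccont_const c p : ccont (fun _ => c) p.
Proof.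
  intros e He. exists 1. split; [lra|]. intros w _. rewrite Cmod_sub_refl. exact He.
Qed.

Lemma ccont_id p : ccont (fun z => z) p.
Proof. intros e He. exists e. split; auto. Qed.

Lemma ccont_plus f g p : ccont f p -> ccont g p -> ccont (fun z => f z + g z) p.
Proof.
  intros Hf Hg e He.
  destruct (Hf (e/2)%R) as [a [Ha Ha']]; [lra|].
  destruct (Hg (e/2)%R) as [b [Hb Hb']]; [lra|].
  exists (Rmin a b). split; [apply Rmin_pos; auto|].
  intros w Hw.
  specialize (Ha' w (Rlt_le_trans _ _ _ Hw (Rmin_l _ _))).
  specialize (Hb' w (Rlt_le_trans _ _ _ Hw (Rmin_r _ _))).
  replace (f w + g w - (f p + g p)) with ((f w - f p) + (g w - g p)) by ring.
  generalize (Cmod_triangle (f w - f p) (g w - g p)). lra.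
Qed.

Lemma Cmult_close (a b : C) (e : R) : (0 < e)%R -> exists m, (0 < m)%R /\
  forall x y, (Cmod (x - a) < m)%R -> (Cmod (y - b) < m)%R -> (Cmod (x * y - a * b) < e)%R.
Proof.
  intros He.
  pose (A := (1 + Cmod a + Cmod b)%R).
  assert (Ha := Cmod_ge_0 a). assert (Hb := Cmod_ge_0 b).
  assert (HA : (1 <= A)%R) by (unfold A; lra).
  set (m := Rmin 1 (e / (2 * A))).
  assert (Hm : (0 < m)%R) by (apply Rmin_pos; [lra|apply Rdiv_lt_0_compat; lra]).
  assert (Hm1 : (m <= 1)%R) by apply Rmin_l.
  assert (Hm2 : (m * (2 * A) <= e)%R).
  { apply Rle_trans with ((e / (2 * A)) * (2 * A))%R; [|right; field; lra].
    apply Rmult_le_compat_r; [lra|apply Rmin_r]. }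
  exists m. split; auto. intros x y Hx Hy.
  replace (x * y - a * b) with ((x - a) * (y - b) + (a * (y - b) + (x - a) * b)) by ring.
  eapply Rle_lt_trans; [apply Cmod_triangle|].
  eapply Rle_lt_trans; [apply Rplus_le_compat_l, Cmod_triangle|].
  rewrite !Cmod_mult.
  set (u := Cmod (x - a)) in *. set (v := Cmod (y - b)) in *.
  assert (0 <= u)%R by apply Cmod_ge_0. assert (0 <= v)%R by apply Cmod_ge_0.
  assert (u * v <= m * 1)%R by (apply Rmult_le_compat; lra).
  assert (Cmod a * v <= Cmod a * m)%R by (apply Rmult_le_compat_l; lra).
  assert (u * Cmod b <= m * Cmod b)%R by (apply Rmult_le_compat_r; lra).
  unfold A in *. nra.
Qed.

Lemma ccont_mult f g p : ccont f p -> ccont g p -> ccont (fun z => f z * g z) p.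
Proof.
  intros Hf Hg e He.
  destruct (Cmult_close (f p) (g p) e He) as [m [Hm H]].
  destruct (Hf m Hm) as [a [Ha Ha']]. destruct (Hg m Hm) as [b [Hb Hb']].
  exists (Rmin a b). split; [apply Rmin_pos; auto|]. intros w Hw. apply H.
  - apply Ha'. eapply Rlt_le_trans; [apply Hw|apply Rmin_l].
  - apply Hb'. eapply Rlt_le_trans; [apply Hw|apply Rmin_r].
Qed.

Lemma ccont_opp f p : ccont f p -> ccont (fun z => - f z) p.
Proof.
  intros Hf e He. destruct (Hf e He) as [a [Ha Ha']].
  exists a. split; auto. intros w Hw.
  replace (- f w - - f p) with (- (f w - f p)) by ring. rewrite Cmod_opp. auto.
Qed.

Lemma ccont_minus f g p : ccont f p -> ccont g p -> ccont (fun z => f z - g z) p.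
Proof. intros Hf Hg. apply ccont_plus; [exact Hf|apply ccont_opp, Hg]. Qed.

Lemma ccont_comp f g p : ccont f p -> ccont g (f p) -> ccont (fun z => g (f z)) p.
Proof.
  intros Hf Hg e He. destruct (Hg e He) as [a [Ha Ha']].
  destruct (Hf a Ha) as [b [Hb Hb']]. exists b. split; auto.
Qed.

Lemma ccont_inv_at (p : C) : p <> 0 -> ccont Cinv p.
Proof.
  intros Hp e He. assert (Hp' : (0 < Cmod p)%R) by (apply Cmod_gt_0, Hp).
  set (m := Cmod p) in *.
  exists (Rmin (m / 2) (e * (m * m) / 2)). split.
  { apply Rmin_pos; [lra|]. assert (0 < m * m)%R by nra. nra. }
  intros w Hw.
  assert (H1 := Rlt_le_trans _ _ _ Hw (Rmin_l _ _)).
  assert (H2 := Rlt_le_trans _ _ _ Hw (Rmin_r _ _)).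
  assert (Hw0 : (m / 2 < Cmod w)%R).
  { generalize (Cmod_sub_ge p w). rewrite Cmod_sub_sym. fold m. lra. }
  assert (w <> 0) by (apply Cmod_gt_0; lra).
  replace (/ w - / p) with ((p - w) * (/ w * / p)) by (field; split; auto).
  rewrite !Cmod_mult, !Cmod_inv by auto. rewrite Cmod_sub_sym. fold m.
  apply Rmult_lt_reg_r with (Cmod w * m)%R; [nra|].
  replace (Cmod (w - p) * (/ Cmod w * / m) * (Cmod w * m))%R with (Cmod (w - p)) by (field; lra).
  assert (0 < e * m)%R by nra.
  assert (e * m * (m / 2) < e * m * Cmod w)%R by (apply Rmult_lt_compat_l; lra).
  nra.
Qed.

Lemma ccont_inv f p : ccont f p -> f p <> 0 -> ccont (fun z => / f z) p.
Proof. intros Hf H. apply (ccont_comp f Cinv); auto. apply ccont_inv_at, H. Qed.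

Lemma ccont_div f g p : ccont f p -> ccont g p -> g p <> 0 -> ccont (fun z => f z / g z) p.
Proof. intros Hf Hg H. apply ccont_mult; auto. apply ccont_inv; auto. Qed.

Lemma ccont_pow f n p : ccont f p -> ccont (fun z => f z ^ n) p.
Proof.
  intros Hf. induction n; simpl; [apply ccont_const|apply ccont_mult; auto].
Qed.

Lemma ccont_ext_loc f g p r : (0 < r)%R ->
  (forall w, (Cmod (w - p) < r)%R -> f w = g w) -> ccont f p -> ccont g p.
Proof.
  intros Hr H Hf e He. destruct (Hf e He) as [a [Ha Ha']].
  exists (Rmin a r). split; [apply Rmin_pos; auto|]. intros w Hw.
  rewrite <- (H w), <- (H p).
  - apply Ha'. eapply Rlt_le_trans; [apply Hw|apply Rmin_l].
  - rewrite Cmod_sub_refl. exact Hr.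
  - eapply Rlt_le_trans; [apply Hw|apply Rmin_r].
Qed.

(* Caratheodory's form of differentiability, from which the calculus rules are algebra. *)
Lemma has_cderiv_factor g p L :
  has_cderiv g p L <->
  exists q, ccont q p /\ q p = L /\ forall w, g w - g p = q w * (w - p).
Proof.
  split.
  - intros H.
    exists (fun w => if Ceq_dec w p then L else (g w - g p) / (w - p)).
    split; [|split].
    + intros e He. destruct (H (e / 2)%R) as [a [Ha Ha']]; [lra|].
      exists a. split; auto. intros w Hw.
      destruct (Ceq_dec p p) as [_|n]; [|destruct n; reflexivity].
      destruct (Ceq_dec w p) as [->|n].
      * rewrite Cmod_sub_refl. exact He.
      * assert (Hp := Cmod_sub_pos _ _ n).
        specialize (Ha' w (conj Hp Hw)).
        change (Cmod (g w - g p - L * (w - p)) <= e / 2 * Cmod (w - p))%R in Ha'.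
        replace ((g w - g p) / (w - p) - L)
          with ((g w - g p - L * (w - p)) / (w - p)) by (field; apply Csub_neq0, n).
        rewrite Cmod_div by (apply Csub_neq0, n).
        apply Rlt_div_l; [exact Hp|]. nra.
    + destruct (Ceq_dec p p) as [_|n]; [|destruct n]; reflexivity.
    + intros w. destruct (Ceq_dec w p) as [->|n]; [ring|].
      field. apply Csub_neq0, n.
  - intros [q [Hq [HL H]]] e He. destruct (Hq e He) as [a [Ha Ha']].
    exists a. split; auto. intros w [_ Hw].
    change (Cmod (g w - g p - L * (w - p)) <= e * Cmod (w - p))%R.
    rewrite H, <- HL. replace (q w * (w - p) - q p * (w - p)) with ((q w - q p) * (w - p)) by ring.
    rewrite Cmod_mult. apply Rmult_le_compat_r; [apply Cmod_ge_0|].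
    apply Rlt_le, Ha'. exact Hw.
Qed.

Definition cdiff (g : C -> C) (p : C) : Prop := exists L, has_cderiv g p L.

Lemma cdiff_factor g p : cdiff g p <->
  exists q, ccont q p /\ forall w, g w - g p = q w * (w - p).
Proof.
  split.
  - intros [L H]. apply has_cderiv_factor in H. destruct H as [q [H1 [_ H2]]]. eauto.
  - intros [q [H1 H2]]. exists (q p). apply has_cderiv_factor. exists q. auto.
Qed.

Lemma cdiff_ccont g p : cdiff g p -> ccont g p.
Proof.
  intros H. apply cdiff_factor in H. destruct H as [q [Hq H]].
  apply (ccont_ext_loc (fun w => q w * (w - p) + g p) g p 1); [lra| |].
  - intros w _. rewrite <- H. ring.
  - apply ccont_plus; [|apply ccont_const]. apply ccont_mult; auto.
    apply ccont_minus; [apply ccont_id|apply ccont_const].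
Qed.

Lemma cdiff_const c p : cdiff (fun _ => c) p.
Proof. apply cdiff_factor. exists (fun _ => 0). split; [apply ccont_const|]. intros; ring. Qed.

Lemma cdiff_id p : cdiff (fun z => z) p.
Proof. apply cdiff_factor. exists (fun _ => 1). split; [apply ccont_const|]. intros; ring. Qed.

Lemma cdiff_plus f g p : cdiff f p -> cdiff g p -> cdiff (fun z => f z + g z) p.
Proof.
  rewrite !cdiff_factor. intros [q [Hq H]] [q' [Hq' H']].
  exists (fun w => q w + q' w). split; [apply ccont_plus; auto|].
  intros w. replace ((q w + q' w) * (w - p)) with (q w * (w - p) + q' w * (w - p)) by ring.
  rewrite <- H, <- H'. ring.
Qed.

Lemma cdiff_mult f g p : cdiff f p -> cdiff g p -> cdiff (fun z => f z * g z) p.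
Proof.
  intros Hf Hg. generalize (cdiff_ccont _ _ Hf). revert Hf Hg.
  rewrite !cdiff_factor. intros [q [Hq H]] [q' [Hq' H']] Hc.
  exists (fun w => f w * q' w + q w * g p). split.
  - apply ccont_plus; apply ccont_mult; auto. apply ccont_const.
  - intros w.
    replace ((f w * q' w + q w * g p) * (w - p))
      with (f w * (q' w * (w - p)) + q w * (w - p) * g p) by ring.
    rewrite <- H, <- H'. ring.
Qed.

Lemma cdiff_minus f g p : cdiff f p -> cdiff g p -> cdiff (fun z => f z - g z) p.
Proof.
  rewrite !cdiff_factor. intros [q [Hq H]] [q' [Hq' H']].
  exists (fun w => q w - q' w). split; [apply ccont_minus; auto|].
  intros w. replace ((q w - q' w) * (w - p)) with (q w * (w - p) - q' w * (w - p)) by ring.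
  rewrite <- H, <- H'. ring.
Qed.

Lemma cdiff_comp f g p : cdiff f p -> cdiff g (f p) -> cdiff (fun z => g (f z)) p.
Proof.
  intros Hf Hg. generalize (cdiff_ccont _ _ Hf). revert Hf Hg.
  rewrite !cdiff_factor. intros [q [Hq H]] [q' [Hq' H']] Hc.
  exists (fun w => q' (f w) * q w). split.
  - apply ccont_mult; auto. apply (ccont_comp f q'); auto.
  - intros w. rewrite H', H. ring.
Qed.

Lemma has_cderiv_ext_loc (f g : C -> C) p L r : (0 < r)%R ->
  (forall w, (Cmod (w - p) < r)%R -> f w = g w) -> has_cderiv f p L -> has_cderiv g p L.
Proof.
  intros Hr H HL e He. destruct (HL e He) as [a [Ha Ha']].
  exists (Rmin a r). split; [apply Rmin_pos; auto|]. intros w [Hw Hw'].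
  rewrite <- (H w), <- (H p).
  - apply Ha'. split; auto. eapply Rlt_le_trans; [apply Hw'|apply Rmin_l].
  - rewrite Cmod_sub_refl. exact Hr.
  - eapply Rlt_le_trans; [apply Hw'|apply Rmin_r].
Qed.

Lemma cdiff_ext_loc f g p r : (0 < r)%R ->
  (forall w, (Cmod (w - p) < r)%R -> f w = g w) -> cdiff f p -> cdiff g p.
Proof. intros Hr H [L HL]. exists L. apply (has_cderiv_ext_loc f g p L r); auto. Qed.

(** The factorisation 1/w - 1/p = -(1/(w p)) (w - p) breaks down at w = 0, where [/ w] is a
    conventional value. The estimate is therefore made directly, on a disc of radius at most |p|. *)
Lemma cdiff_inv_at (p : C) : p <> 0 -> cdiff Cinv p.
Proof.
  intros Hp.
  assert (Hp' : (0 < Cmod p)%R) by (apply Cmod_gt_0, Hp).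
  exists (- / (p * p)). intros e He.
  assert (Hc : ccont (fun w => - / (w * p)) p).
  { apply ccont_opp, ccont_inv.
    - apply ccont_mult; [apply ccont_id|apply ccont_const].
    - apply Cmult_neq_0; auto. }
  destruct (Hc e He) as [a [Ha Ha']].
  exists (Rmin a (Cmod p)). split; [apply Rmin_pos; auto|]. intros w [_ Hw].
  change (Cmod (/ w - / p - - / (p * p) * (w - p)) <= e * Cmod (w - p))%R.
  change (Cmod (w - p) < Rmin a (Cmod p))%R in Hw.
  assert (w <> RtoC 0).
  { intros E. rewrite E, Cmod_sub_sym in Hw.
    replace (p - 0) with p in Hw by ring. generalize (Rmin_r a (Cmod p)). lra. }
  replace (/ w - / p - - / (p * p) * (w - p))
    with ((- / (w * p) - - / (p * p)) * (w - p)) by (field; auto).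
  rewrite Cmod_mult. apply Rmult_le_compat_r; [apply Cmod_ge_0|].
  apply Rlt_le, Ha'. eapply Rlt_le_trans; [apply Hw|apply Rmin_l].
Qed.

Lemma cdiff_inv f p : cdiff f p -> f p <> 0 -> cdiff (fun z => / f z) p.
Proof. intros Hf H. apply (cdiff_comp f Cinv); auto. apply cdiff_inv_at, H. Qed.

Lemma cdiff_div f g p : cdiff f p -> cdiff g p -> g p <> 0 -> cdiff (fun z => f z / g z) p.
Proof. intros Hf Hg H. apply cdiff_mult; auto. apply cdiff_inv; auto. Qed.

Lemma cdiff_pow f n p : cdiff f p -> cdiff (fun z => f z ^ n) p.
Proof.
  intros Hf. induction n; simpl; [apply cdiff_const|apply cdiff_mult; auto].
Qed.

Lemma ccont_neq0 (f : C -> C) (p : C) : ccont f p -> f p <> 0 ->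
  exists r, (0 < r)%R /\ forall w, (Cmod (w - p) < r)%R -> f w <> 0.
Proof.
  intros Hf H. assert (Hp := proj1 (Cmod_gt_0 _) H).
  destruct (Hf _ Hp) as [r [Hr Hr']]. exists r. split; auto.
  intros w Hw E. specialize (Hr' w Hw). rewrite E, Cmod_sub_sym in Hr'.
  replace (f p - 0) with (f p) in Hr' by ring. lra.
Qed.

(** The point with homogeneous coordinates x : y. Poles are treated like other points, so that one
    criterion finds critical points at poles, at infinity and elsewhere. *)
Definition sphere_quot (x y : C) : Csph := if Ceq_dec y 0 then None else Some (x / y).

Lemma square_deriv0 (c : C) (s k : C -> C) (p : C) : ccont s p -> ccont k p -> k p <> 0 ->
  has_cderiv (fun w => c + s w * ((w - p) * (w - p)) / k w) p (RtoC 0).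
Proof.
  intros Hs Hk H. apply has_cderiv_factor.
  exists (fun w => s w * (w - p) / k w). split; [|split].
  - apply ccont_div; auto. apply ccont_mult; auto.
    apply ccont_minus; [apply ccont_id|apply ccont_const].
  - field. exact H.
  - intros w. unfold Cdiv. ring.
Qed.

(* In homogeneous coordinates [N : M] a double zero of [N M(p) - N(p) M] at [p]
   means that the quotient is critical at [p], whether or not its value is infinite. *)
Lemma critical_quotient (N M s : C -> C) (g : C -> Csph) (p : C) :
  ccont N p -> ccont M p -> ccont s p ->
  (forall w, g w = sphere_quot (N w) (M w)) -> ~ (N p = 0 /\ M p = 0) ->
  (forall w, N w * M p - N p * M w = s w * ((w - p) * (w - p))) ->
  has_cderiv (fun w => chart (g p) (g w)) p (RtoC 0).
Proof.
  intros HN HM Hs Hg Hnz H.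
  destruct (Ceq_dec (M p) 0) as [E|E].
  - assert (HNp : N p <> 0) by tauto.
    destruct (ccont_neq0 N p HN HNp) as [r [Hr Hr']].
    (* At a pole the chart is the reciprocal, and [M p = 0] turns the hypothesis into M w / N w = s
       w (w - p)^2 / (- N p N w). *)
    apply (has_cderiv_ext_loc (fun w => 0 + s w * ((w - p) * (w - p)) / (- N p * N w)) _ p _ r Hr).
    + intros w Hw. rewrite !Hg. unfold sphere_quot.
      destruct (Ceq_dec (M p) 0) as [_|n]; [|contradiction].
      specialize (Hr' w Hw). rewrite <- H, E.
      transitivity (M w / N w); [field; auto|].
      destruct (Ceq_dec (M w) 0) as [E'|E']; simpl.
      * rewrite E'. change C0 with (RtoC 0). field. auto.
      * change (M w / N w = / (N w / M w)). field. auto.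
    + apply square_deriv0; auto.
      * apply ccont_mult; [apply ccont_const|auto].
      * apply Cmult_neq_0; auto. intros E2. apply HNp.
        replace (N p) with (- - N p) by ring. rewrite E2. ring.
  - destruct (ccont_neq0 M p HM E) as [r [Hr Hr']].
    apply (has_cderiv_ext_loc (fun w => N p / M p + s w * ((w - p) * (w - p)) / (M p * M w)) _ p _ r Hr).
    + intros w Hw. rewrite !Hg. unfold sphere_quot.
      destruct (Ceq_dec (M p) 0) as [n|_]; [contradiction|].
      specialize (Hr' w Hw). destruct (Ceq_dec (M w) 0) as [n|_]; [contradiction|].
      simpl. rewrite <- H. change (Cdiv (N w) (M w)) with (N w / M w). field. auto.
    + apply square_deriv0; auto.
      * apply ccont_mult; [apply ccont_const|auto].
      * apply Cmult_neq_0; auto.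
Qed.

(** * Counting preimages of polynomials and rational maps *)

Module Counting.
Import all_boot all_order all_algebra Rstruct.
Import mathcomp.algebra_tactics.ring mathcomp.zify.zify mathcomp.real_closed.complex.
Set Implicit Arguments. Unset Strict Implicit. Unset Printing Implicit Defensive.
Import GRing.Theory Num.Theory.
Local Open Scope ring_scope.

(** * Multiplicities of roots and ramification *)

Section ClosedField.
Variable F : numClosedFieldType.
Implicit Types (p q : {poly F}) (z : F).

Lemma sum_count_mem (T : eqType) (r s : seq T) : uniq r ->
  (\sum_(z <- r) count_mem z s = count [in r] s)%N.
Proof.
move=> Ur; elim: s => [|x s IHs] /=; first by rewrite big1.
rewrite big_split /= IHs; congr addn.
transitivity (count_mem x r); last by rewrite count_uniq_mem.
by rewrite -sum1_count [RHS]big_mkcond; apply: eq_bigr => y _ /=; rewrite eq_sym; case: eqP.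
Qed.

Lemma roots_seq p : p != 0 -> exists rs : seq F,
  [/\ size rs = (size p).-1, (forall z, (z \in rs) = root p z)
    & forall z, mup z p = count_mem z rs].
Proof.
move=> p0; have [rs Ep] := closed_field_poly_normal p; exists rs.
have lc0 : lead_coef p != 0 by rewrite lead_coef_eq0.
have c0 z : ~~ root (lead_coef p)%:P z by rewrite rootC.
split=> [|z|z].
- by rewrite [in RHS]Ep size_scale // size_prod_XsubC.
- by rewrite [in RHS]Ep rootZ // root_prod_XsubC.
- by rewrite Ep -mul_polyC mupMr ?mu_prod_XsubC // lead_coefZ lead_coef_prod_XsubC mulr1.
Qed.

Lemma sum_mup_le p (r : seq F) : p != 0 -> uniq r ->
  (\sum_(z <- r) mup z p <= (size p).-1)%N.
Proof.
move=> p0 Ur; have [rs [<- _ Em]] := roots_seq p0.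
by under eq_bigr do rewrite Em; rewrite sum_count_mem // count_size.
Qed.

Lemma sum_mup_eq p (r : seq F) : p != 0 -> uniq r -> (forall z, root p z -> z \in r) ->
  (\sum_(z <- r) mup z p = (size p).-1)%N.
Proof.
move=> p0 Ur Hr; have [rs [<- Er Em]] := roots_seq p0.
under eq_bigr do rewrite Em; rewrite sum_count_mem //; apply/eqP; rewrite -all_count.
by apply/allP => z; rewrite Er; apply: Hr.
Qed.

Lemma distinct_roots p : p != 0 -> exists2 r : seq F, uniq r & forall z, (z \in r) = root p z.
Proof.
move=> p0; have [rs [_ Er _]] := roots_seq p0.
by exists (undup rs); rewrite ?undup_uniq // => z; rewrite mem_undup.
Qed.

Section Ramification.
Variables (Q W : {poly F}) (r : seq F).
Hypotheses (Q0 : Q != 0) (W0 : W != 0) (Ur : uniq r) (Er : forall z, (z \in r) = root Q z)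
  (Hram : forall z, root Q z -> mup z Q = (mup z W).+1).

(** Each distinct root of [Q] counts once in [size r] and otherwise with its multiplicity in [W].
    The degree of a polynomial appears as [(size _).-1] throughout. *)
Let sum_ram : ((size Q).-1 = \sum_(z <- r) mup z W + size r)%N.
Proof.
rewrite -(@sum_mup_eq Q r) //; last by move=> z; rewrite Er.
rewrite -sum1_size -big_split /= big_seq [RHS]big_seq.
by apply: eq_bigr => z; rewrite Er => /Hram ->; rewrite addn1.
Qed.

Lemma ramification_le : ((size Q).-1 <= (size W).-1 + size r)%N.
Proof. by rewrite sum_ram leq_add2r sum_mup_le. Qed.

Lemma ramification_eq : (forall z, root W z -> root Q z) ->
  ((size Q).-1 = (size W).-1 + size r)%N.
Proof. by move=> H; rewrite sum_ram sum_mup_eq // => z /H; rewrite Er. Qed.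
End Ramification.

(** The numerator of the derivative of p / q. For coprime [p] and [q] its roots are the finite
    critical points of the quotient, poles included, each with its ramification as multiplicity. *)
Definition wronskian p q := p^`() * q - p * q^`().

(** Writing p = s (X - z)^(k+1) gives the Wronskian the factor (X - z)^k with cofactor [t], and t(z)
    = (k+1) s(z) q(z) is nonzero in characteristic 0. *)
Lemma wronskian_mup p q z : p != 0 -> root p z -> ~~ root q z ->
  wronskian p q != 0 /\ mup z p = (mup z (wronskian p q)).+1.
Proof.
move=> p0 rpz nqz; have [[|k] [s]] := multiplicity_XsubC p z; rewrite p0 /= => nsz Ep.
  by rewrite Ep mulr1 (negPf nsz) in rpz.
pose t := (s * q) *+ k.+1 + ('X - z%:P) * (s^`() * q - s * q^`()).
have Ew : wronskian p q = t * ('X - z%:P) ^+ k.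
  rewrite /wronskian /t Ep derivM deriv_exp derivXsubC mul1r exprS /=.
  rewrite -(mulr_natr _ k.+1) -(mulr_natr (s * q)); ring.
have ntz : ~~ root t z.
  rewrite /root /t hornerD hornerMn !hornerM hornerXsubC subrr mul0r addr0.
  by rewrite mulrn_eq0 /= mulf_neq0.
have t0 : t != 0 by apply: contraNneq ntz => ->; rewrite root0.
have X0 n : ('X - z%:P) ^+ n != 0 by rewrite expf_neq0 // polyXsubC_eq0.
split; first by rewrite Ew mulf_neq0.
by rewrite Ew Ep !mupMr // !mup_XsubCX eqxx.
Qed.

Lemma coefM_top p q m n : (size p <= m.+1)%N -> (size q <= n.+1)%N ->
  (p * q)`_(m + n) = p`_m * q`_n.
Proof.
move=> sp sq; rewrite coefM (bigD1 (inord m)) //= inordK ?ltnS ?leq_addr // addKn.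
rewrite big1 ?addr0 // => i; rewrite -val_eqE /= inordK ?ltnS ?leq_addr // neq_ltn.
case/orP=> lt_im; last by rewrite nth_default ?mul0r // (leq_trans sp).
rewrite [q`_ _]nth_default ?mulr0 // (leq_trans sq) // ltn_subRL ltn_add2r //.
Qed.

(** The coefficient of degree m + n - 1 is (m - n) p_m q_n, so unequal degrees exclude cancellation
    at the top. *)
Lemma wronskian_size p q m n : size p = m.+1 -> size q = n.+1 -> (m < n)%N ->
  (m + n <= size (wronskian p q))%N.
Proof.
case: n => // n sp sq lt_mn; rewrite addnS.
suff : (wronskian p q)`_(m + n) != 0.
  by apply: contraNT; rewrite -leqNgt => /(nth_default 0) ->.
have Elc (u : {poly F}) k : size u = k.+1 -> u`_k != 0.
  by move=> su; rewrite -[k]/(k.+1.-1) -su lead_coef_eq0 -size_poly_gt0 su.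
have sd (u : {poly F}) k : size u = k.+1 -> (size u^`() <= k)%N.
  by move=> su; rewrite -ltnS -su lt_size_deriv // -size_poly_gt0 su.
rewrite coefB (coefM_top _ (sd _ _ sq)) ?sp // coef_deriv.
have -> : (p^`() * q)`_(m + n) = p`_m *+ m * q`_n.+1.
  case: m sp {lt_mn} => [|m] sp.
    have -> : p^`() = 0 by apply/eqP; rewrite -size_poly_leq0 (sd _ _ sp).
    by rewrite mul0r coef0 mulr0n mul0r.
  by rewrite addSnnS coefM_top ?sq ?(sd _ _ sp) // coef_deriv.
rewrite mulrnAl mulrnAr -[X in X - _]mulr_natr -[X in _ - X]mulr_natr -mulrBr.
rewrite mulf_neq0 ?mulf_neq0 ?Elc //.
by rewrite subr_eq0 eqr_nat neq_ltn lt_mn.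
Qed.

Lemma mupN z p : mup z (- p) = mup z p.
Proof. by rewrite -mulN1r -polyCN mupMr // rootC oppr_eq0 oner_eq0. Qed.

Lemma wronskianC p q : wronskian q p = - wronskian p q.
Proof. rewrite /wronskian; ring. Qed.

Lemma wronskian_sub p q c : wronskian (p - c *: q) q = wronskian p q.
Proof. rewrite /wronskian derivB derivZ -!mul_polyC; ring. Qed.

(** * Riemann-Hurwitz for a quotient of two polynomials *)

Section RationalMap.
Variables (a b : {poly F}) (D : nat).
Hypotheses (a0 : a != 0) (b0 : b != 0) (D0 : (0 < D)%N)
  (ED : D.+1 = maxn (size a) (size b)) (nocommon : forall z, ~~ (root a z && root b z)).

(** Its roots are the finite points over [v], with [None] for infinity. What its degree lacks to [D]
    is the multiplicity of infinity as a point over [v], so that infinity can be counted without a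
    second chart. *)
Definition fiber (v : option F) : {poly F} := if v is Some c then a - c *: b else b.
Definition rat_at z : option F := if root b z then None else Some (a.[z] / b.[z]).
Definition rat_inf : option F := if b`_D == 0 then None else Some (a`_D / b`_D).

Lemma fiber_root v z : root (fiber v) z = (rat_at z == v).
Proof.
rewrite /rat_at; case: v => [c|] /=; last by case: ifP.
have := nocommon z; rewrite /root hornerD hornerN hornerZ subr_eq0 negb_and.
case: ifPn => [/eqP ->|nbz _]; first by rewrite mulr0 orbF => /negPf ->.
by apply/eqP/eqP => [->|[<-]]; rewrite ?mulfK ?mulfVK.
Qed.

Lemma sizes_le : (size a <= D.+1)%N /\ (size b <= D.+1)%N.
Proof. by rewrite ED leq_maxl leq_maxr. Qed.

Lemma fiber_size_le v : (size (fiber v) <= D.+1)%N.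
Proof.
have [sa sb] := sizes_le; case: v => [c|] //=.
apply: leq_trans (size_polyD _ _) _; rewrite geq_max sa size_polyN.
exact: leq_trans (size_scale_leq _ _) sb.
Qed.

Lemma size_top (p : {poly F}) : (size p <= D.+1)%N -> (size p <= D)%N = (p`_D == 0).
Proof.
move=> sp; apply/idP/eqP => [/(nth_default 0)//|pD].
by apply/leq_sizeP => j; rewrite leq_eqVlt => /orP[/eqP<-//|]; move/leq_sizeP: sp; apply.
Qed.

Lemma fiber_inf v : (size (fiber v) <= D)%N = (rat_inf == v).
Proof.
have [sa sb] := sizes_le.
rewrite size_top ?fiber_size_le // /rat_inf; case: v => [c|] /=; last by case: ifP.
rewrite coefB coefZ subr_eq0; have [bD|nbD] := eqVneq b`_D 0.
  rewrite bD mulr0; apply/negP => aD.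
  have : (D.+1 <= D)%N by rewrite ED geq_max !size_top // aD bD eqxx.
  by rewrite ltnn.
by apply/eqP/eqP => [->|[<-]]; rewrite ?mulfK ?mulfVK.
Qed.

Lemma fiber_size v : rat_inf != v -> size (fiber v) = D.+1.
Proof.
by move=> nv; apply/eqP; rewrite eqn_leq fiber_size_le ltnNge fiber_inf.
Qed.

(** A zero fibre would make the map constant. A constant finite value c would give a = c b with b of
    positive degree, and a root of b is sent to infinity. *)
Lemma fiber_neq0 v : fiber v != 0.
Proof.
apply/eqP => E; have sE : size (fiber v) = 0%N by rewrite E size_poly0.
have H z : rat_at z == v by rewrite -fiber_root E root0.
case: v E sE H => [c /= E _ H|/= E]; last by move: b0; rewrite E eqxx.
have sb : (1 < size b)%N.
  move/eqP: E; rewrite subr_eq0 => /eqP E; have c0 : c != 0.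
    by apply: contraNneq a0 => c0; rewrite E c0 scale0r.
  by move: ED; rewrite E size_scale // maxnn => <-; rewrite ltnS.
have /closed_rootP[z rz] : size b != 1%N by rewrite neq_ltn sb orbT.
by have := H z; rewrite /rat_at rz.
Qed.

Let W := wronskian a b.

Lemma fiber_mup v z : root (fiber v) z -> W != 0 /\ mup z (fiber v) = (mup z W).+1.
Proof.
move=> rz; have := rz; rewrite fiber_root /rat_at.
case: v rz => [c|] rz; case: ifPn => // rb _.
  by have := wronskian_mup (fiber_neq0 _) rz rb; rewrite /= wronskian_sub.
have na : ~~ root a z by have := nocommon z; rewrite rb andbT.
by have := wronskian_mup (fiber_neq0 None) rz na; rewrite wronskianC oppr_eq0 mupN.
Qed.

Lemma wronskian_neq0 : W != 0.
Proof.
have [v nv] : exists v, rat_inf != v by exists (if rat_inf is None then Some 0 else None); case: rat_inf.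
have sv := fiber_size nv.
have /closed_rootP[z rz] : size (fiber v) != 1%N by rewrite sv eqSS -lt0n.
by have [] := fiber_mup rz.
Qed.

(** If e is the local degree at infinity, the fibre of [rat_inf] has degree D - e, and the bound
    reads deg W >= 2 D - 2 - (e - 1): of the total ramification 2 D - 2, only the part at infinity
    can be missing from [W]. The polynomials given to [wronskian_size] have degrees D - e and D. *)
Lemma wronskian_degree : ((size (fiber rat_inf)).-1 + D <= size W)%N.
Proof.
have := fiber_neq0 rat_inf; rewrite -size_poly_gt0 => s0.
have lt_s : ((size (fiber rat_inf)).-1 < D)%N by rewrite prednK // fiber_inf.
have E := esym (prednK s0); rewrite /W.
case Er: rat_inf E lt_s {s0} => [c|] E lt_s.
  have sb : size b = D.+1 by rewrite -[b]/(fiber None) fiber_size // Er.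
  by have := wronskian_size E sb lt_s; rewrite wronskian_sub.
have sa : size a = D.+1.
  by have := @fiber_size (Some 0); rewrite Er /= scale0r subr0 => ->.
by have := wronskian_size E sa lt_s; rewrite wronskianC size_polyN.
Qed.

Lemma fibers_neq0 (B : seq (option F)) : \prod_(v <- B) fiber v != 0.
Proof. by rewrite prodf_seq_neq0; apply/allP => v _; apply/implyP => _; apply: fiber_neq0. Qed.

Lemma fibers_root (B : seq (option F)) z : root (\prod_(v <- B) fiber v) z = (rat_at z \in B).
Proof.
elim: B => [|v s IHs]; first by rewrite big_nil (negPf (root1 z)).
by rewrite big_cons rootM IHs fiber_root in_cons.
Qed.

Lemma finite_preimages (B : seq (option F)) :
  exists2 r : seq F, uniq r & forall z, (z \in r) = (rat_at z \in B).
Proof.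
have [r Ur Er] := distinct_roots (fibers_neq0 B).
by exists r => // z; rewrite Er fibers_root.
Qed.

Section Preimages.
Variables (B : seq (option F)) (r : seq F).
Hypotheses (UB : uniq B) (Ur : uniq r) (Er : forall z, (z \in r) = (rat_at z \in B)).
Let Q := \prod_(v <- B) fiber v.
Let Q0 : Q != 0 := fibers_neq0 B.
Let rootQ z : root Q z = (rat_at z \in B) := fibers_root B z.

Let ramQ z : root Q z -> mup z Q = (mup z W).+1.
Proof.
rewrite rootQ => Bz; rewrite /Q (bigD1_seq (rat_at z)) //= mupMl.
  by have [_ ->] : W != 0 /\ mup z (fiber (rat_at z)) = (mup z W).+1
    by apply: fiber_mup; rewrite fiber_root.
elim/big_ind: _ => [|p q Hp Hq|v nv]; rewrite ?root1 ?rootM ?negb_or ?Hp //.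
by rewrite fiber_root eq_sym.
Qed.

Let sizeQ : (size Q).-1 = (\sum_(v <- B) (size (fiber v)).-1)%N.
Proof.
rewrite /Q; elim: B => [|v s IHs]; first by rewrite !big_nil size_poly1.
rewrite !big_cons -IHs size_mul ?fiber_neq0 ?fibers_neq0 //.
have s1 : (0 < size (fiber v))%N by rewrite size_poly_gt0 fiber_neq0.
have s2 : (0 < size (\prod_(u <- s) fiber u)%R)%N by rewrite size_poly_gt0 fibers_neq0.
by rewrite -(prednK s1) -(prednK s2) addSn addnS.
Qed.

Lemma preimages_ge : rat_inf \notin B -> (size B * D <= (size W).-1 + size r)%N.
Proof.
move=> nB; have := ramification_le Q0 wronskian_neq0 Ur; rewrite sizeQ => H.
apply: leq_trans (H _ ramQ); last by move=> z; rewrite Er rootQ.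
rewrite big_seq (eq_bigr (fun=> D)) => [|v Bv]; last first.
  by rewrite fiber_size //; apply: contraNneq nB => ->.
by rewrite -big_seq big_const_seq count_predT iter_addn_0 mulnC.
Qed.

(** Riemann-Hurwitz in the form |f^-1(B)| <= |B| D - (2 D - 2), for a set B containing all critical
    values. The condition [size (fiber rat_inf) = D] means degree D - 1, that is, infinity is not
    critical. *)
Lemma preimages_le : (forall z, root W z -> rat_at z \in B) ->
  (rat_inf \notin B -> size (fiber rat_inf) = D) ->
  (size r + (rat_inf \in B) + 2 * D <= size B * D + 2)%N.
Proof.
move=> HW Hinf.
have ErQ z : (z \in r) = root Q z by rewrite Er rootQ.
have HWQ z : root W z -> root Q z by rewrite rootQ; apply: HW.
have := ramification_eq Q0 wronskian_neq0 Ur ErQ ramQ HWQ; rewrite sizeQ => E.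
have := wronskian_degree; have W0 : (0 < size W)%N by rewrite size_poly_gt0 wronskian_neq0.
have sum_const (s : seq (option F)) : rat_inf \notin s ->
    (\sum_(v <- s) (size (fiber v)).-1 = size s * D)%N.
  move=> ns; rewrite big_seq (eq_bigr (fun=> D)) => [|v Bv]; last first.
    by rewrite fiber_size //; apply: contraNneq ns => ->.
  by rewrite -big_seq big_const_seq count_predT iter_addn_0 mulnC.
have [inB|ninB] := boolP (rat_inf \in B).
  move: E; rewrite (bigD1_seq rat_inf) //= -big_filter sum_const; last first.
    by rewrite mem_filter eqxx.
  have : (size [seq v <- B | v != rat_inf]).+1 = size B.
    rewrite size_filter -(count_predC (pred1 rat_inf) B) count_uniq_mem // inB add1n.
    by congr _.+1; apply: eq_count.
  move=> <-; move: (size (fiber _)).-1 (size W) W0 (size [seq _ <- _ | _]) => m w; nia.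
by move: E; rewrite sum_const // (Hinf ninB); move: (size W) W0 => w; nia.
Qed.
End Preimages.

(** Without roots of [W] the fibre has simple roots only, and infinity, if it belongs to the fibre,
    accounts for the one missing degree. *)
Lemma regular_fiber v (r : seq F) : uniq r -> (forall z, (z \in r) = root (fiber v) z) ->
  (forall z, root (fiber v) z -> ~~ root W z) ->
  (rat_inf == v -> size (fiber v) = D) -> (D <= size r + (rat_inf == v))%N.
Proof.
move=> Ur Er HW Hinf.
have E : size r = (size (fiber v)).-1.
  rewrite -(@sum_mup_eq (fiber v) r) ?fiber_neq0 //; last by move=> z; rewrite Er.
  rewrite -sum1_size big_seq [RHS]big_seq; apply: eq_bigr => z; rewrite Er => rz.
  by have [_ ->] := fiber_mup rz; rewrite mupNroot // HW.
rewrite E; have [/Hinf -> | nv] := boolP (rat_inf == v); first by rewrite addn1 prednK.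
by rewrite addn0 fiber_size.
Qed.
End RationalMap.
End ClosedField.

(** * Transfer to the complex numbers and to the sphere *)

Definition CF : numClosedFieldType := complex Rdefinitions.R.
Definition toF (z : Defs.C) : CF := (fst z +i* snd z)%C.
Definition ofF (x : CF) : Defs.C := (complex.Re x, complex.Im x).

Lemma toFK : cancel toF ofF. Proof. by case. Qed.
Lemma ofFK : cancel ofF toF. Proof. by case. Qed.
Lemma toF_inj : injective toF. Proof. exact: can_inj toFK. Qed.
Lemma ofF_inj : injective ofF. Proof. exact: can_inj ofFK. Qed.
Lemma toFD z w : toF (Cadd z w) = toF z + toF w. Proof. by []. Qed.
Lemma toFM z w : toF (Cmul z w) = toF z * toF w. Proof. by []. Qed.
Lemma toFN z : toF (Copp z) = - toF z. Proof. by []. Qed.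
Lemma toF0 : toF C0 = 0. Proof. by []. Qed.
Lemma toF1 : toF C1 = 1. Proof. by []. Qed.

Lemma toFV z : z <> C0 -> toF (Cinv z) = (toF z)^-1.
Proof.
move=> z0; have tz0 : toF z != 0 by apply/eqP => E; apply: z0; apply: toF_inj.
apply: (mulfI tz0); rewrite mulfV // -toFM -toF1; congr toF.
exact: (Complex.Cinv_r z).
Qed.
Lemma toFX z n : toF (Cpow z n) = toF z ^+ n.
Proof. by elim: n => // n IHn; rewrite exprS -IHn. Qed.

Lemma ofF_neq0 x : (ofF x = C0) <-> (x = 0).
Proof. by split=> [E|->//]; rewrite -[x]ofFK E. Qed.

Definition pev (p : {poly CF}) (z : Defs.C) : Defs.C := ofF p.[toF z].

Lemma ccont_pev p z : ccont (pev p) z.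
Proof.
elim/poly_ind: p => [|p c IHp].
  apply: (ccont_ext_loc (fun=> C0) _ z (IZR 1)); [exact: Rlt_0_1|by move=> w _; rewrite /pev horner0|].
  exact: ccont_const.
apply: (ccont_ext_loc (fun w => Complex.Cplus (Complex.Cmult (pev p w) w) (ofF c)) _ z (IZR 1));
  first exact: Rlt_0_1.
- move=> w _; rewrite /pev hornerMXaddC.
  have -> : p.[toF w] * toF w + c = toF (Cadd (Cmul (ofF p.[toF w]) w) (ofF c)).
    by rewrite toFD toFM !ofFK.
  by rewrite toFK.
- by apply: ccont_plus; [apply: ccont_mult => //; apply: ccont_id|apply: ccont_const].
Qed.

Definition mkpoly (a : nat -> Defs.C) (m : nat) : {poly CF} := \poly_(i < m.+1) toF (a i).

Lemma pev_mkpoly a m z : pev (mkpoly a m) z = peval a m z.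
Proof.
apply: toF_inj; rewrite ofFK horner_poly; elim: m => [|m IHm].
  by rewrite big_ord1 expr0 mulr1.
by rewrite big_ord_recr /= toFD -IHm toFM -[Cmul _ _]/(Cpow z m.+1) toFX.
Qed.

Lemma toF_neq0 z : z <> C0 -> toF z != 0.
Proof. by move=> z0; apply/eqP => E; apply: z0; apply: toF_inj. Qed.

Lemma size_mkpoly a m : a m <> C0 -> size (mkpoly a m) = m.+1.
Proof. by move=> am; rewrite size_poly_eq //= toF_neq0. Qed.

Lemma inP (T : eqType) (x : T) (s : seq T) : reflect (List.In x s) (x \in s).
Proof.
elim: s => [|y s IHs] /=; first by constructor.
rewrite in_cons eq_sym; apply: (iffP orP) => -[/eqP|/IHs]; tauto || auto.
Qed.

Lemma NoDup_map (T : eqType) (U : Type) (h : T -> U) (s : seq T) :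
  injective h -> uniq s -> NoDup (map h s).
Proof.
move=> h_inj; elim: s => [|x s IHs] /=; first by constructor.
case/andP=> nx us; constructor; last exact: IHs.
move=> H; apply/negP: nx; apply/negPn/inP.
elim: s H {IHs us} => [|y s IHs] //= [/h_inj|/IHs]; tauto.
Qed.

Lemma uniq_map_NoDup (U : Type) (T : eqType) (h : U -> T) (s : list U) :
  injective h -> NoDup s -> uniq (map h s).
Proof.
move=> h_inj; elim: s => [|x s IHs] //= H; inversion H as [|? ? nx us]; rewrite IHs // andbT.
by apply/inP => /List.in_map_iff[y [/h_inj E Hy]]; apply: nx; rewrite -E.
Qed.

Lemma In_map (T : eqType) (U : Type) (h : T -> U) (s : seq T) x : injective h ->
  List.In (h x) (map h s) <-> x \in s.
Proof.
move=> h_inj; elim: s => [|y s IHs] //=; rewrite in_cons; split.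
  by case=> [/h_inj ->|/IHs ->]; rewrite ?eqxx ?orbT.
by case/orP=> [/eqP ->|/IHs]; auto.
Qed.

Lemma poly_factor (a : nat -> Defs.C) (d : nat) (x : Defs.C) : (0 < d)%coq_nat -> monic_deg a d ->
  exists rs : list Defs.C, length rs = d /\
    forall z, Csub (peval a d z) x = fold_right (fun r acc => Cmul (Csub z r) acc) C1 rs.
Proof.
move=> /ltP d0 ad; pose p := mkpoly a d - (toF x)%:P.
have ad0 : a d <> C0 by rewrite ad => -[]; apply: R1_neq_R0.
have sp : size p = d.+1.
  rewrite size_polyDl ?size_mkpoly // size_polyN ltnS.
  by rewrite (leq_trans (size_polyC_leq1 _)).
have lp : lead_coef p = 1.
  rewrite /lead_coef sp /= coefB coefC coef_poly ltnSn.
  by rewrite (gtn_eqF d0) subr0 ad.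
have [rs Ep] := closed_field_poly_normal p; rewrite lp scale1r in Ep.
exists (map ofF rs); split.
  have := sp; rewrite Ep size_prod_XsubC => -[<-].
  by rewrite -[length _]/(size _) size_map.
move=> z; rewrite -pev_mkpoly; apply: toF_inj.
transitivity p.[toF z].
  by rewrite /p hornerD hornerN hornerC toFD toFN ofFK.
rewrite Ep horner_prod; elim: rs {Ep} => [|r s IHs]; first by rewrite big_nil.
by rewrite big_cons IHs /= toFM toFD toFN ofFK hornerXsubC.
Qed.

(** This is [preimages_ge] for P / 1, which sends infinity to infinity and hence outside A. The
    Wronskian is P', of degree d - 1. The bound |L| >= (|A| - 1) d + 1 is written without
    subtraction. *)
Lemma poly_preimages_ge (a : nat -> Defs.C) (d : nat) (A : list Defs.C) :
  (0 < d)%coq_nat -> monic_deg a d -> NoDup A ->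
  exists L : list Defs.C, NoDup L /\ (forall z, List.In z L -> List.In (peval a d z) A) /\
    (length A * d + 1 <= length L + d)%coq_nat.
Proof.
move=> /ltP d0 ad UA; set P := mkpoly a d.
have ad0 : a d <> C0 by rewrite ad => -[]; apply: R1_neq_R0.
have sP : size P = d.+1 by apply: size_mkpoly.
have P0 : P != 0 by rewrite -size_poly_gt0 sP.
have ED : d.+1 = maxn (size P) (size (1 : {poly CF})) by rewrite sP size_poly1; lia.
have nocommon z : ~~ (root P z && root 1 z) by rewrite (negPf (root1 z)) andbF.
have R0 := @oner_neq0 {poly CF}.
pose B := map (Some \o toF) A.
have inj : injective (Some \o toF) by move=> u v /Some_inj /toF_inj.
have UB : uniq B := uniq_map_NoDup inj UA.
have [r Ur ErB] := finite_preimages P0 R0 d0 ED nocommon B.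
have ninf : rat_inf P 1 d \notin B.
  rewrite /rat_inf coef1 (gtn_eqF d0) eqxx.
  by apply/inP; rewrite /B List.in_map_iff => -[x []].
have := preimages_ge P0 R0 d0 ED nocommon UB Ur ErB ninf => H.
exists (map ofF r); split; [|split].
- exact: NoDup_map ofF_inj Ur.
- move=> z; rewrite -[z]toFK (In_map _ _ ofF_inj) ErB /rat_at (negPf (root1 _)) hornerC divr1.
  move/inP; rewrite /B List.in_map_iff => -[y [[Ey] Ay]].
  by rewrite -pev_mkpoly /pev ofFK -/P -Ey toFK.
- have sW : (size (wronskian P 1) <= d)%N.
    rewrite /wronskian derivC mulr0 subr0 mulr1 -ltnS -sP lt_size_deriv //.
  have sB : size B = length A by rewrite size_map.
  have sr : length (map ofF r) = size r by rewrite -[length _]/(size _) size_map.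
  apply/leP; move: H sW d0; rewrite sB sr; move: (size (wronskian P 1)) (length A * d)%N => w k; lia.
Qed.

Definition sphF (v : option CF) : Csph := omap ofF v.

Definition toS (v : Csph) : option CF := omap toF v.

Lemma toSK : cancel toS sphF. Proof. by move=> [z|] //=; rewrite /sphF /= toFK. Qed.
Lemma sphFK : cancel sphF toS. Proof. by move=> [z|] //=; rewrite /toS /= ofFK. Qed.

(** The polynomial w^D p(1/w). For [a] and [b] together it gives the homogeneous coordinates of the
    map in the chart w = 1/z, which is why both are reversed with the same [D]. *)
Definition rev_poly (D : nat) (p : {poly CF}) : {poly CF} := \poly_(i < D.+1) p`_(D - i).

Lemma rev_poly0 D (p : {poly CF}) : (rev_poly D p).[0] = p`_D.
Proof. by rewrite horner_coef0 coef_poly ltnS leq0n subn0. Qed.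

Lemma rev_polyE D (p : {poly CF}) (w : CF) : (size p <= D.+1)%N -> w != 0 ->
  (rev_poly D p).[w] = w ^+ D * p.[w^-1].
Proof.
move=> sp w0; rewrite horner_poly (horner_coef_wide _ sp) mulr_sumr.
rewrite (reindex_inj rev_ord_inj) /=; apply: eq_bigr => i _.
have le_iD : (i <= D)%N by rewrite -ltnS.
rewrite subSS subKn // mulrCA; congr (_ * _).
by rewrite exprVn; apply: (mulIf (expf_neq0 i w0)); rewrite -exprD subnK // mulfVK // expf_neq0.
Qed.

Lemma rev_poly_lin D (p q : {poly CF}) (c e : CF) : rev_poly D (c *: p - e *: q) = c *: rev_poly D p - e *: rev_poly D q.
Proof.
apply/polyP => i; rewrite !(coefB, coefZ, coef_poly).
by case: ifP => _; rewrite ?coefB ?coefZ // !mulr0 subr0.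
Qed.

Lemma toF_sphere_quot (x y : CF) :
  sphere_quot (ofF x) (ofF y) = sphF (if y == 0 then None else Some (x / y)).
Proof.
rewrite /sphere_quot; case: Complex.Ceq_dec => [E|n].
  by have /ofF_neq0-> : ofF y = C0 by []; rewrite eqxx.
have y0 : y != 0 by apply/eqP => E; case: n; rewrite E.
rewrite (negPf y0) /=; congr Some; apply: toF_inj.
by rewrite ofFK -[Complex.Cdiv _ _]/(Cmul _ (Cinv _)) toFM toFV ?ofFK.
Qed.

Section RationalSphere.
Variables (f : Csph -> Csph) (D m n : nat) (ca cb : nat -> Defs.C).
Hypotheses (cam : ca m <> C0) (cbn : cb n <> C0) (EDmn : D = maxn m n) (D0 : (0 < D)%N)
  (Hnc : forall z, ~ (peval ca m z = C0 /\ peval cb n z = C0))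
  (Hf1 : forall z, peval cb n z <> C0 -> f (Some z) = Some (Cdiv (peval ca m z) (peval cb n z)))
  (Hf2 : forall z, peval cb n z = C0 -> f (Some z) = None)
  (Hf3 : f None = (if Nat.ltb n m then None
              else if Nat.eqb m n then Some (Cdiv (ca m) (cb n)) else Some C0)).
Let a := mkpoly ca m.
Let b := mkpoly cb n.

Let sa : size a = m.+1. Proof. exact: size_mkpoly. Qed.
Let sb : size b = n.+1. Proof. exact: size_mkpoly. Qed.
Let a0 : a != 0. Proof. by rewrite -size_poly_gt0 sa. Qed.
Let b0 : b != 0. Proof. by rewrite -size_poly_gt0 sb. Qed.
Let ED : D.+1 = maxn (size a) (size b). Proof. by rewrite sa sb EDmn maxnSS. Qed.

Let nocommon z : ~~ (root a z && root b z).
Proof.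
apply/negP => /andP[/rootP ra /rootP rb]; apply: (Hnc (z := ofF z)).
by rewrite -!pev_mkpoly /pev ofFK -/a -/b ra rb.
Qed.

Lemma rat_finite z : f (Some z) = sphere_quot (pev a z) (pev b z).
Proof.
rewrite /sphere_quot !pev_mkpoly; case: Complex.Ceq_dec => [E|nE].
  by rewrite Hf2.
by rewrite Hf1.
Qed.

Lemma rat_finiteF z : f (Some (ofF z)) = sphF (rat_at a b z).
Proof. by rewrite rat_finite /pev !ofFK toF_sphere_quot. Qed.

Lemma rat_infiniteF : f None = sphF (rat_inf a b D).
Proof.
have Ea : a`_D = if (D == m)%N then toF (ca m) else 0.
  rewrite coef_poly ltnS; case: eqP => [->|nD]; first by rewrite leqnn.
  by case: ifP => // le_Dm; case: nD; apply/eqP; rewrite eqn_leq le_Dm EDmn leq_maxl.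
have Eb : b`_D = if (D == n)%N then toF (cb n) else 0.
  rewrite coef_poly ltnS; case: eqP => [->|nD]; first by rewrite leqnn.
  by case: ifP => // le_Dn; case: nD; apply/eqP; rewrite eqn_leq le_Dn EDmn leq_maxr.
have nb := toF_neq0 cbn.
rewrite Hf3 /rat_inf Ea Eb.
case: (PeanoNat.Nat.ltb_spec n m) => [/ltP lt_nm|/leP le_mn].
  have nDn : D <> n by rewrite EDmn; lia.
  by rewrite (introF eqP nDn) eqxx.
have EDn : D = n by rewrite EDmn; lia.
rewrite EDn eqxx (negPf nb) /=.
case: (PeanoNat.Nat.eqb_spec m n) => [Emn|nmn].
  by rewrite (introT eqP (esym Emn)); congr Some; apply: toF_inj; rewrite ofFK toFM toFV.
by rewrite (introF eqP (not_eq_sym nmn)) mul0r.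
Qed.

Let W := wronskian a b.

Let sub_pev (p : {poly CF}) (z w : Defs.C) (s : {poly CF}) :
  p = s * ('X - (toF z)%:P) ^+ 2 ->
  pev p w = Cmul (pev s w) (Cmul (Csub w z) (Csub w z)).
Proof.
by move=> ->; apply: toF_inj; rewrite !(toFM, toFD, toFN) !ofFK hornerM horner_exp hornerXsubC expr2.
Qed.

(** A root of [W] is a multiple root of its fibre, and a b(z) - a(z) b is a scalar multiple of that
    fibre whether z is a pole or not. This is the double zero that [critical_quotient] asks for. *)
Lemma rat_critical_finite z : root W z -> is_critical f (Some (ofF z)).
Proof.
move=> rW; set v := rat_at a b z.
have rv : root (fiber a b v) z by rewrite (fiber_root nocommon).
have F0 : fiber a b v != 0 := fiber_neq0 a0 b0 D0 ED nocommon v.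
have [W0 Em] := fiber_mup a0 b0 D0 ED nocommon rv.
have Em2 : (1 < mup z (fiber a b v))%N.
  by rewrite Em ltnS -XsubC_dvd // dvdp_XsubCl.
rewrite mup_geq // in Em2; have [s Es] := dvdpP _ _ Em2.
have [c Ec] : exists c, a * (b.[z])%:P - (a.[z])%:P * b = c *: fiber a b v.
  rewrite /v /rat_at; case: ifPn => [/rootP bz|bz] /=.
    by exists (- a.[z]); rewrite bz -mul_polyC polyCN; ring.
  exists b.[z]; rewrite scalerBr scalerA [b.[z] * _]mulrC mulfVK // -!mul_polyC; ring.
have H := @critical_quotient (pev a) (pev b) (pev (c *: s)) (fun w => f (Some w)) (ofF z).
apply: H; try exact: ccont_pev.
- exact: rat_finite.
- rewrite !pev_mkpoly; exact: Hnc.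
- move=> w; transitivity (pev (a * (b.[z])%:P - (a.[z])%:P * b) w).
    apply: toF_inj; rewrite /pev hornerD hornerN !hornerM !hornerC ofFK.
    by rewrite -[Complex.Cminus _ _]/(Cadd _ (Copp _)) toFD toFN !toFM !ofFK.
  by apply: sub_pev; rewrite ofFK Ec Es scalerAl.
Qed.

(** A fibre of size below [D] has degree at most D - 2, so its reversal to formal degree D is
    divisible by the square of the coordinate at infinity. *)
Lemma rat_critical_inf : (size (fiber a b (rat_inf a b D)) < D)%N -> is_critical f None.
Proof.
move=> lt_sD.
have [sa' sb'] := sizes_le ED.
pose A := rev_poly D a; pose B := rev_poly D b.
pose U := b`_D *: a - a`_D *: b.
have EU : exists c, U = c *: fiber a b (rat_inf a b D).
  rewrite /U /rat_inf; case: eqP => [bD|/eqP bD] /=.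
    by exists (- a`_D); rewrite bD scale0r sub0r scaleNr.
  by exists b`_D; rewrite scalerBr scalerA mulrC mulfVK.
have sU : (size U < D)%N by have [c ->] := EU; apply: leq_ltn_trans (size_scale_leq _ _) lt_sD.
have UD i : (D.-1 <= i)%N -> U`_i = 0.
  by move=> le_Di; rewrite nth_default // (leq_trans _ le_Di) // -ltnS prednK.
pose s := drop_poly 2 (rev_poly D U).
have Es : rev_poly D U = s * ('X - (toF C0)%:P) ^+ 2.
  rewrite toF0 subr0 -[LHS](poly_take_drop 2) -/s -[RHS]add0r; congr (_ + _).
  apply/polyP => i; rewrite coef_take_poly coef0 coef_poly.
  by case: ifP => // lt_i2; case: ifP => // _; apply: UD; lia.
pose g w := f (chart_inv None w).
have g0 : g C0 = f None by rewrite /g /chart_inv; destruct (Defs.Ceq_dec C0 C0) as [E|nE]; [|destruct nE].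
have gq w : g w = sphere_quot (pev A w) (pev B w).
  rewrite /g /chart_inv; case: (Defs.Ceq_dec w C0) => [->|nw].
    by rewrite /pev toF0 !rev_poly0 toF_sphere_quot rat_infiniteF.
  have w0 := toF_neq0 nw.
  rewrite rat_finite /pev !rev_polyE // !toF_sphere_quot toFV // mulf_eq0.
  rewrite expf_eq0 (negPf w0) andbF /=; case: ifP => // _.
  by rewrite -mulf_div divff ?mul1r // expf_neq0.
have H := @critical_quotient (pev A) (pev B) (pev s) g C0.
rewrite /is_critical /local_expr /= -g0; apply: H; try exact: ccont_pev.
- exact: gq.
- move=> [E1 E2].
  have aD : a`_D = 0 by rewrite -rev_poly0 -toF0; apply/ofF_neq0.
  have bD : b`_D = 0 by rewrite -rev_poly0 -toF0; apply/ofF_neq0.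
  have : (D.+1 <= D)%N by rewrite ED geq_max (size_top sa') (size_top sb') aD bD eqxx.
  by rewrite ltnn.
- move=> w; transitivity (pev (rev_poly D U) w); last exact: sub_pev.
  rewrite /U rev_poly_lin -/A -/B; apply: toF_inj.
  rewrite -[Complex.Cminus _ _]/(Cadd _ (Copp _)) toFD toFN !toFM !ofFK toF0 !rev_poly0.
  by rewrite hornerD hornerN !hornerZ mulrC.
Qed.

Definition sphere_list (r : seq CF) (i : bool) : list Csph :=
  (if i then cons None else id) (map (Some \o ofF) r).

Lemma sphere_list_spec (r : seq CF) (i : bool) : uniq r ->
  [/\ NoDup (sphere_list r i), length (sphere_list r i) = (size r + i)%N,
      forall z, List.In (Some (ofF z)) (sphere_list r i) <-> z \in r
    & List.In None (sphere_list r i) <-> i].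
Proof.
move=> Ur; have inj : injective (Some \o ofF) by move=> x y /Some_inj /ofF_inj.
have nN : ~ List.In None (map (Some \o ofF) r) by case/List.in_map_iff => x [].
have H1 := NoDup_map inj Ur.
have Hs : length (map (Some \o ofF) r) = size r by rewrite -[length _]/(size _) size_map.
have H2 z := In_map r z inj.
rewrite /sphere_list; case: i => /=; split=> //.
- by constructor.
- by rewrite Hs addn1.
- by move=> z; split=> [[]//|]; rewrite -?H2; auto.
- by split=> // _; left.
- by rewrite Hs addn0.
Qed.

Lemma sphere_regular_fiber v : (forall c, is_critical f c -> f c <> v) ->
  exists L : list Csph, [/\ NoDup L, forall z, List.In z L -> f z = v & (D <= length L)%N].
Proof.
move=> Hv; pose u := toS v.
have F0 : fiber a b u != 0 := fiber_neq0 a0 b0 D0 ED nocommon u.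
have [r Ur Er] := distinct_roots F0.
have H : (D <= size r + (rat_inf a b D == u))%N.
  apply: (regular_fiber a0 b0 D0 ED nocommon) => // [z|/eqP Eu].
    rewrite (fiber_root nocommon) => /eqP Ez; apply/negP => /rat_critical_finite /Hv.
    by rewrite rat_finiteF Ez toSK.
  apply/eqP; rewrite eqn_leq (fiber_inf ED) Eu eqxx leqNgt; apply/negP => lt_s.
  by rewrite -Eu in lt_s; have /Hv := rat_critical_inf lt_s; rewrite rat_infiniteF Eu toSK.
have [L1 L2 L3 L4] := sphere_list_spec (rat_inf a b D == u) Ur.
exists (sphere_list r (rat_inf a b D == u)); split=> //; last by rewrite L2.
case=> [z|]; last by move/L4/eqP; rewrite rat_infiniteF => ->; rewrite toSK.
rewrite -[z]toFK => /L3; rewrite Er (fiber_root nocommon) rat_finiteF => /eqP ->.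
by rewrite toSK.
Qed.

Lemma sphere_preimages_le (B : list Csph) : NoDup B ->
  (forall c, is_critical f c -> List.In (f c) B) ->
  exists L : list Csph, [/\ NoDup L, forall z, List.In z L <-> List.In (f z) B
    & (length L + 2 * D <= length B * D + 2)%N].
Proof.
move=> UB Hc; pose S := map toS B.
have US : uniq S := uniq_map_NoDup (can_inj toSK) UB.
have inS v : List.In (sphF v) B <-> v \in S.
  split=> [H|/inP /List.in_map_iff[x [<-]]]; last by rewrite toSK.
  by apply/inP/List.in_map_iff; exists (sphF v); rewrite sphFK.
have [r Ur ErS] := finite_preimages a0 b0 D0 ED nocommon S.
have H : (size r + (rat_inf a b D \in S) + 2 * D <= size S * D + 2)%N.
  apply: (preimages_le a0 b0 D0 ED nocommon US Ur ErS) => [z rW|ninf].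
    by apply/inS; rewrite -rat_finiteF; apply/Hc/rat_critical_finite.
  apply/eqP; rewrite eqn_leq (fiber_inf ED) eqxx leqNgt; apply/negP => /rat_critical_inf /Hc.
  by rewrite rat_infiniteF => /inS; apply/negP.
have [L1 L2 L3 L4] := sphere_list_spec (rat_inf a b D \in S) Ur.
exists (sphere_list r (rat_inf a b D \in S)); split=> //.
- case=> [z|]; last by rewrite L4 rat_infiniteF inS.
  by rewrite -[z]toFK L3 rat_finiteF inS ErS.
- by rewrite L2; move: H; rewrite size_map.
Qed.
End RationalSphere.

Lemma rational_regular_fiber f D v : is_rational_map f D -> (0 < D)%coq_nat ->
  (forall c, is_critical f c -> f c <> v) ->
  exists L : list Csph, NoDup L /\ (forall z, List.In z L -> f z = v) /\ (D <= length L)%coq_nat.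
Proof.
move=> [ca [cb [m [n [cam [cbn [ED [Hnc [Hf1 [Hf2 Hf3]]]]]]]]]] /ltP D0 Hv.
have ED' : D = maxn m n by rewrite ED; lia.
have [L [L1 L2 L3]] := sphere_regular_fiber cam cbn ED' D0 Hnc Hf1 Hf2 Hf3 Hv.
by exists L; split=> //; split=> //; apply/leP.
Qed.

Lemma rational_preimages_le f D (B : list Csph) : is_rational_map f D -> (0 < D)%coq_nat ->
  NoDup B -> (forall c, is_critical f c -> List.In (f c) B) ->
  exists L : list Csph, NoDup L /\ (forall z, List.In z L <-> List.In (f z) B) /\
    (length L + 2 * D <= length B * D + 2)%coq_nat.
Proof.
move=> [ca [cb [m [n [cam [cbn [ED [Hnc [Hf1 [Hf2 Hf3]]]]]]]]]] /ltP D0 UB Hc.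
have ED' : D = maxn m n by rewrite ED; lia.
have [L [L1 L2 L3]] := sphere_preimages_le cam cbn ED' D0 Hnc Hf1 Hf2 Hf3 UB Hc.
by exists L; split=> //; split=> //; apply/leP.
Qed.

End Counting.
Import Counting.

(** * Cauchy's theorem and formula in the exterior of a disc *)

Lemma dependent_choice {A : Type} (P : A -> Prop) (T : A -> A -> Prop) :
  (forall x, P x -> exists y, P y /\ T x y) ->
  forall x0, P x0 -> exists u : nat -> A, u O = x0 /\ forall n, P (u n) /\ T (u n) (u (S n)).
Proof.
  intros H x0 Hx0.
  pose (B := {x | P x}).
  assert (Hs : forall b : B, exists b' : B, T (proj1_sig b) (proj1_sig b')).
  { intros [x Hx]. destruct (H x Hx) as [y [Hy Hxy]]. exists (exist _ y Hy). exact Hxy. }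
  pose (step := fun b => proj1_sig (constructive_indefinite_description _ (Hs b))).
  pose (v := fix v (n : nat) : B := match n with O => exist _ x0 Hx0 | S k => step (v k) end).
  exists (fun n => proj1_sig (v n)). split; [reflexivity|]. intros n. split.
  - apply (proj2_sig (v n)).
  - simpl. unfold step at 1.
    destruct (constructive_indefinite_description _ (Hs (v n))) as [b' Hb']. exact Hb'.
Qed.

(** * Integrals of complex functions of a real variable *)

Notation is_CI f a b l := (@is_RInt C_R_NormedModule f a b l).
Definition CI (f : R -> C) (a b : R) : C := @RInt C_R_CompleteNormedModule f a b.

Definition rcont (f : R -> C) (t : R) : Prop :=
  forall eps, (0 < eps)%R -> exists delta, (0 < delta)%R /\
    forall s, (Rabs (s - t) < delta)%R -> (Cmod (f s - f t) < eps)%R.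

Lemma is_CI_unique f a b l : is_CI f a b l -> CI f a b = l.
Proof. exact (@is_RInt_unique C_R_CompleteNormedModule f a b l). Qed.

Lemma rcont_continuous f t : rcont f t -> @continuous R_UniformSpace C_R_CompleteNormedModule f t.
Proof.
  intros H P [e He].
  destruct (H e (cond_pos e)) as [d [Hd H']].
  exists (mkposreal d Hd). intros s Hs. apply He.
  apply C_NormedModule_mixin_compat1. apply H'. exact Hs.
Qed.

Lemma is_CI_cont f a b : (a <= b)%R -> (forall t, (a <= t <= b)%R -> rcont f t) ->
  is_CI f a b (CI f a b).
Proof.
  intros Hab H. apply (@RInt_correct C_R_CompleteNormedModule).
  apply (@ex_RInt_continuous C_R_CompleteNormedModule).
  rewrite Rmin_left, Rmax_right by exact Hab.
  intros t Ht. apply rcont_continuous, H, Ht.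
Qed.

Lemma is_CI_plus (f g : R -> C) a b (k l : C) : is_CI f a b k -> is_CI g a b l ->
  is_CI (fun t => f t + g t) a b (k + l).
Proof. exact (@is_RInt_plus C_R_NormedModule f g a b k l). Qed.

Lemma is_CI_fst f a b l : is_CI f a b l -> is_RInt (fun t => fst (f t)) a b (fst l).
Proof. exact (is_RInt_fct_extend_fst (U:=R_NormedModule) (V:=R_NormedModule) f a b l). Qed.

Lemma is_CI_snd f a b l : is_CI f a b l -> is_RInt (fun t => snd (f t)) a b (snd l).
Proof. exact (is_RInt_fct_extend_snd (U:=R_NormedModule) (V:=R_NormedModule) f a b l). Qed.

Lemma is_CI_pair (f : R -> C) a b l :
  is_RInt (fun t => fst (f t)) a b (fst l) -> is_RInt (fun t => snd (f t)) a b (snd l) ->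
  is_CI f a b l.
Proof.
  intros H1 H2. rewrite (surjective_pairing l).
  exact (is_RInt_fct_extend_pair (U:=R_NormedModule) (V:=R_NormedModule) f a b _ _ H1 H2).
Qed.

(** Multiplication by a complex number is not a scalar operation of the real normed module in which
    the integral is taken, so the two components are integrated apart. *)
Lemma is_CI_mult (c : C) (f : R -> C) a b (l : C) : is_CI f a b l -> is_CI (fun t => c * f t) a b (c * l).
Proof.
  intros H. assert (H1 := is_CI_fst _ _ _ _ H). assert (H2 := is_CI_snd _ _ _ _ H).
  apply is_CI_pair; simpl.
  - apply (is_RInt_minus (V:=R_NormedModule) (fun t => fst c * fst (f t))%R (fun t => snd c * snd (f t))%R);
      apply (is_RInt_scal (V:=R_NormedModule)); assumption.
  - apply (is_RInt_plus (V:=R_NormedModule) (fun t => fst c * snd (f t))%R (fun t => snd c * fst (f t))%R);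
      apply (is_RInt_scal (V:=R_NormedModule)); assumption.
Qed.

Lemma is_CI_minus (f g : R -> C) a b (k l : C) : is_CI f a b k -> is_CI g a b l ->
  is_CI (fun t => f t - g t) a b (k - l).
Proof. exact (@is_RInt_minus C_R_NormedModule f g a b k l). Qed.

Lemma is_CI_const c a b : is_CI (fun _ => c) a b (RtoC (b - a) * c).
Proof.
  apply is_CI_pair; simpl.
  - replace ((b - a) * fst c - 0 * snd c)%R with ((b - a) * fst c)%R by ring.
    apply (is_RInt_const (V:=R_NormedModule)).
  - replace ((b - a) * snd c + 0 * fst c)%R with ((b - a) * snd c)%R by ring.
    apply (is_RInt_const (V:=R_NormedModule)).
Qed.

Lemma is_CI_ext (f g : R -> C) a b (l : C) : (a <= b)%R -> (forall t, (a <= t <= b)%R -> f t = g t) ->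
  is_CI f a b l -> is_CI g a b l.
Proof.
  intros Hab H. apply (@is_RInt_ext C_R_NormedModule).
  rewrite Rmin_left, Rmax_right by exact Hab. intros t Ht. apply H. lra.
Qed.

Lemma is_CI_Chasles f a b c k l : is_CI f a b k -> is_CI f b c l -> is_CI f a c (k + l).
Proof. exact (@is_RInt_Chasles C_R_NormedModule f a b c k l). Qed.

Lemma is_CI_bound (f : R -> C) (g : R -> R) a b l m : (a <= b)%R ->
  (forall t, (a <= t <= b)%R -> (Cmod (f t) <= g t)%R) ->
  is_CI f a b l -> is_RInt g a b m -> (Cmod l <= m)%R.
Proof.
  intros Hab H Hl Hm. rewrite Cmod_norm.
  apply (@norm_RInt_le C_R_NormedModule f g a b l m); auto.
  intros t Ht. specialize (H t Ht). rewrite Cmod_norm in H. exact H.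
Qed.

Lemma is_CI_bound_const (f : R -> C) a b (l : C) M : (a <= b)%R ->
  (forall t, (a <= t <= b)%R -> (Cmod (f t) <= M)%R) ->
  is_CI f a b l -> (Cmod l <= (b - a) * M)%R.
Proof.
  intros Hab H Hl. apply (is_CI_bound f (fun _ => M) a b l); auto.
  apply (is_RInt_const (V:=R_NormedModule)).
Qed.

(** * Goursat's lemma for rectangles *)

Lemma ccont_vert H x y : ccont H (x, y) -> rcont (fun t => H (x, t)) y.
Proof.
  intros Hc e He. destruct (Hc e He) as [d [Hd H']]. exists d. split; auto.
  intros s Hs. apply H'.
  replace ((x, s) - (x, y)) with (Ci * RtoC (s - y)).
  - rewrite Cmod_mult, Cmod_Ci, Cmod_R. lra.
  - apply injective_projections; simpl; ring.
Qed.

Lemma ccont_horiz H x y : ccont H (x, y) -> rcont (fun t => H (t, y)) x.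
Proof.
  intros Hc e He. destruct (Hc e He) as [d [Hd H']]. exists d. split; auto.
  intros s Hs. apply H'.
  replace ((s, y) - (x, y)) with (RtoC (s - x)).
  - rewrite Cmod_R. exact Hs.
  - apply injective_projections; simpl; ring.
Qed.

(** The contour integral of [H] along the boundary of the rectangle, counterclockwise, with dz = dx
    on the horizontal sides and dz = i dy on the vertical ones. *)
Definition rect_int (H : C -> C) (a b c d : R) : C :=
  CI (fun x => H (x, c)) a b - CI (fun x => H (x, d)) a b
  + Ci * (CI (fun y => H (b, y)) c d - CI (fun y => H (a, y)) c d).

Definition cont_rect (H : C -> C) (a b c d : R) : Prop :=
  forall x y, (a <= x <= b)%R -> (c <= y <= d)%R -> ccont H (x, y).

Section Rectangle.
Context (H : C -> C) (a b c d : R) (Hab : (a <= b)%R) (Hcd : (c <= d)%R)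
  (Hc : cont_rect H a b c d).

Lemma is_CI_horiz y p q : (c <= y <= d)%R -> (a <= p)%R -> (p <= q)%R -> (q <= b)%R ->
  is_CI (fun x => H (x, y)) p q (CI (fun x => H (x, y)) p q).
Proof.
  intros Hy Hp Hpq Hq. apply is_CI_cont; auto.
  intros t Ht. apply ccont_horiz, Hc; lra.
Qed.

Lemma is_CI_vert x p q : (a <= x <= b)%R -> (c <= p)%R -> (p <= q)%R -> (q <= d)%R ->
  is_CI (fun y => H (x, y)) p q (CI (fun y => H (x, y)) p q).
Proof.
  intros Hy Hp Hpq Hq. apply is_CI_cont; auto.
  intros t Ht. apply ccont_vert, Hc; lra.
Qed.

Lemma rect_int_split_x m : (a <= m <= b)%R ->
  rect_int H a b c d = rect_int H a m c d + rect_int H m b c d.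
Proof.
  intros Hm. unfold rect_int.
  assert (E : forall y, (c <= y <= d)%R -> CI (fun x => H (x, y)) a b =
     CI (fun x => H (x, y)) a m + CI (fun x => H (x, y)) m b).
  { intros y Hy. apply is_CI_unique. apply is_CI_Chasles with m; apply is_CI_horiz; lra. }
  rewrite !E by lra. ring.
Qed.

Lemma rect_int_split_y m : (c <= m <= d)%R ->
  rect_int H a b c d = rect_int H a b c m + rect_int H a b m d.
Proof.
  intros Hm. unfold rect_int.
  assert (E : forall x, (a <= x <= b)%R -> CI (fun y => H (x, y)) c d =
     CI (fun y => H (x, y)) c m + CI (fun y => H (x, y)) m d).
  { intros x Hx. apply is_CI_unique. apply is_CI_Chasles with m; apply is_CI_vert; lra. }
  rewrite !E by lra. ring.
Qed.

Lemma rect_int_bound M :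
  (forall x y, (a <= x <= b)%R -> (c <= y <= d)%R -> (Cmod (H (x, y)) <= M)%R) ->
  (Cmod (rect_int H a b c d) <= 2 * M * ((b - a) + (d - c)))%R.
Proof.
  intros HM. unfold rect_int.
  eapply Rle_trans; [apply Cmod_triangle|].
  rewrite Cmod_mult, Cmod_Ci, Rmult_1_l.
  assert (Hh : forall y, (c <= y <= d)%R -> (Cmod (CI (fun x => H (x, y)) a b) <= (b - a) * M)%R).
  { intros y Hy. eapply is_CI_bound_const; [| |apply is_CI_horiz]; auto; try lra.
    intros t Ht; apply HM; lra. }
  assert (Hv : forall x, (a <= x <= b)%R -> (Cmod (CI (fun y => H (x, y)) c d) <= (d - c) * M)%R).
  { intros x Hx. eapply is_CI_bound_const; [| |apply is_CI_vert]; auto; try lra.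
    intros t Ht; apply HM; lra. }
  assert (H1 := Hh c ltac:(lra)). assert (H2 := Hh d ltac:(lra)).
  assert (H3 := Hv a ltac:(lra)). assert (H4 := Hv b ltac:(lra)).
  assert (Ht : forall z w : C, (Cmod (z - w) <= Cmod z + Cmod w)%R).
  { intros z w. rewrite <- (Cmod_opp w). apply Cmod_triangle. }
  eapply Rle_trans; [apply Rplus_le_compat; apply Ht|]. lra.
Qed.
End Rectangle.

Lemma cont_rect_sub H a b c d a' b' c' d' : cont_rect H a b c d ->
  (a <= a')%R -> (b' <= b)%R -> (c <= c')%R -> (d' <= d)%R -> cont_rect H a' b' c' d'.
Proof. intros Hc ? ? ? ? x y Hx Hy. apply Hc; lra. Qed.

Lemma rect_int_minus H G a b c d : (a <= b)%R -> (c <= d)%R ->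
  cont_rect H a b c d -> cont_rect G a b c d ->
  rect_int (fun z => H z - G z) a b c d = rect_int H a b c d - rect_int G a b c d.
Proof.
  intros Hab Hcd HH HG. unfold rect_int.
  assert (Eh : forall y, (c <= y <= d)%R -> CI (fun x => H (x, y) - G (x, y)) a b =
     CI (fun x => H (x, y)) a b - CI (fun x => G (x, y)) a b).
  { intros y Hy. apply is_CI_unique, is_CI_minus;
      [apply (is_CI_horiz H a b c d)|apply (is_CI_horiz G a b c d)]; auto; lra. }
  assert (Ev : forall x, (a <= x <= b)%R -> CI (fun y => H (x, y) - G (x, y)) c d =
     CI (fun y => H (x, y)) c d - CI (fun y => G (x, y)) c d).
  { intros x Hx. apply is_CI_unique, is_CI_minus;
      [apply (is_CI_vert H a b c d)|apply (is_CI_vert G a b c d)]; auto; lra. }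
  rewrite !Eh, !Ev by lra. ring.
Qed.

Lemma is_RInt_id a b : is_RInt (fun x : R => x) a b ((b * b - a * a) / 2)%R.
Proof.
  replace ((b * b - a * a) / 2)%R with (minus (b * b / 2) (a * a / 2))%R
    by (unfold minus, plus, opp; simpl; field).
  apply (is_RInt_derive (V:=R_CompleteNormedModule) (fun x => x * x / 2)%R (fun x => x)).
  - intros x _. auto_derive; auto. field.
  - intros x _. apply continuous_id.
Qed.

Lemma rect_int_affine al be a b c d :
  rect_int (fun z => al + be * z) a b c d = 0.
Proof.
  unfold rect_int.
  assert (Eh : forall y, CI (fun x => al + be * (x, y)) a b =
     RtoC (b - a) * al + be * ((b * b - a * a) / 2, y * (b - a))%R).
  { intros y. apply is_CI_unique, is_CI_plus; [apply is_CI_const|]. apply is_CI_mult, is_CI_pair; simpl.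
    - apply is_RInt_id.
    - replace (y * (b - a))%R with ((b - a) * y)%R by ring. apply (is_RInt_const (V:=R_NormedModule)). }
  assert (Ev : forall x, CI (fun y => al + be * (x, y)) c d =
     RtoC (d - c) * al + be * (x * (d - c), (d * d - c * c) / 2)%R).
  { intros x. apply is_CI_unique, is_CI_plus; [apply is_CI_const|]. apply is_CI_mult, is_CI_pair; simpl.
    - replace (x * (d - c))%R with ((d - c) * x)%R by ring. apply (is_RInt_const (V:=R_NormedModule)).
    - apply is_RInt_id. }
  rewrite !Eh, !Ev. apply injective_projections; simpl; field.
Qed.

Lemma Cmod_pair_le x y : (Cmod (x, y) <= Rabs x + Rabs y)%R.
Proof.
  replace (x, y) with (RtoC x + Ci * RtoC y) by (apply injective_projections; simpl; ring).
  eapply Rle_trans; [apply Cmod_triangle|]. rewrite Cmod_mult, Cmod_Ci, !Cmod_R. lra.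
Qed.

(** The affine part of [H] at [p] integrates to 0. The remainder is at most (eps/2) s on the
    rectangle, where s is half the perimeter, and the contour has length 2 s. *)
Lemma rect_int_local H p : cdiff H p -> forall eps, (0 < eps)%R ->
  exists delta, (0 < delta)%R /\ forall a b c d,
    (a <= fst p <= b)%R -> (c <= snd p <= d)%R -> ((b - a) + (d - c) < delta)%R ->
    cont_rect H a b c d ->
    (Cmod (rect_int H a b c d) <= eps * ((b - a) + (d - c)) ^ 2)%R.
Proof.
  intros [L HL] e He. destruct (HL (e / 2)%R) as [dl [Hd Hl]]; [lra|].
  exists dl. split; auto. intros a b c d Hab Hcd Hs Hc.
  set (G := fun z : C => (H p - L * p) + L * z).
  assert (HG : cont_rect G a b c d).
  { intros x y _ _. apply ccont_plus; [apply ccont_const|].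
    apply ccont_mult; [apply ccont_const|apply ccont_id]. }
  assert (HHG : cont_rect (fun z => H z - G z) a b c d).
  { intros x y Hx Hy. apply ccont_minus; [apply Hc|apply HG]; auto. }
  replace (rect_int H a b c d) with (rect_int (fun z => H z - G z) a b c d).
  2:{ rewrite rect_int_minus; try lra; auto. unfold G at 1. rewrite rect_int_affine. ring. }
  set (s := ((b - a) + (d - c))%R) in *.
  assert (Hs0 : (0 <= s)%R) by (unfold s; lra).
  apply Rle_trans with (2 * (e / 2 * s) * s)%R; [|right; field].
  apply rect_int_bound; auto; try lra.
  intros x y Hx Hy.
  assert (Hz : (Cmod ((x, y) - p) <= s)%R).
  { replace ((x, y) - p) with (x - fst p, y - snd p)%R by (apply injective_projections; simpl; ring).
    eapply Rle_trans; [apply Cmod_pair_le|]. unfold s.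
    apply Rplus_le_compat; apply Rabs_le; lra. }
  replace (H (x, y) - G (x, y)) with (H (x, y) - H p - L * ((x, y) - p)) by (unfold G; ring).
  destruct (Ceq_dec (x, y) p) as [E|E].
  - rewrite E. replace (H p - H p - L * (p - p)) with (RtoC 0) by ring. rewrite Cmod_0.
    apply Rmult_le_pos; lra.
  - apply Rle_trans with (e / 2 * Cmod ((x, y) - p))%R.
    + apply Hl. split; [apply (Cmod_sub_pos _ _ E)|]. change (Cmod ((x, y) - p) < dl)%R. lra.
    + apply Rmult_le_compat_l; lra.
Qed.

Lemma half_pow_small (K e : R) : (0 < e)%R -> exists n, (K * (/ 2) ^ n < e)%R.
Proof.
  intros He.
  destruct (pow_lt_1_zero (/ 2) ltac:(rewrite Rabs_pos_eq; lra) (e / (1 + Rabs K))%R) as [n Hn].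
  { apply Rdiv_lt_0_compat; auto. generalize (Rabs_pos K); lra. }
  exists n. specialize (Hn n (le_n _)).
  assert (Hp : (0 < (/ 2) ^ n)%R) by (apply pow_lt; lra).
  rewrite Rabs_pos_eq in Hn by lra.
  generalize (Rabs_pos K), (Rle_abs K). intros.
  apply Rle_lt_trans with ((1 + Rabs K) * (/ 2) ^ n)%R; [nra|].
  apply Rmult_lt_compat_l with (r := (1 + Rabs K)%R) in Hn; [|lra].
  replace ((1 + Rabs K) * (e / (1 + Rabs K)))%R with e in Hn by (field; lra). exact Hn.
Qed.

Lemma inv_INR_pos (k : nat) : (0 < / (INR k + 1) <= 1)%R.
Proof.
  assert (H := pos_INR k). split; [apply Rinv_0_lt_compat; lra|].
  rewrite <- Rinv_1. apply Rinv_le_contravar; lra.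
Qed.

Lemma inv_INR_small e : (0 < e)%R -> exists N, forall k, (N <= k)%nat -> (/ (INR k + 1) < e)%R.
Proof.
  intros He. destruct (archimed_cor1 e He) as [N [HN HN0]]. exists N. intros k Hk.
  assert (0 < INR N)%R by (apply lt_0_INR; auto). apply le_INR in Hk.
  eapply Rle_lt_trans; [|apply HN]. apply Rinv_le_contravar; lra.
Qed.

Lemma nested_intervals (a b : nat -> R) (w : R) :
  (forall n, a n <= a (S n))%R -> (forall n, b (S n) <= b n)%R ->
  (forall n, b n - a n = w * (/ 2) ^ n)%R -> (0 <= w)%R ->
  exists p, forall n, (a n <= p <= b n)%R.
Proof.
  intros Ha Hb Hw Hw0.
  assert (Hab : forall n, (a n <= b n)%R).
  { intros n. assert (0 <= (/ 2) ^ n)%R by (apply pow_le; lra).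
    assert (0 <= w * (/ 2) ^ n)%R by (apply Rmult_le_pos; auto). rewrite <- Hw in *. lra. }
  assert (Hma : forall n k, (a n <= a (n + k)%nat)%R).
  { intros n k. induction k; [rewrite Nat.add_0_r; lra|]. rewrite Nat.add_succ_r.
    eapply Rle_trans; [apply IHk|apply Ha]. }
  assert (Hmb : forall n k, (b (n + k)%nat <= b n)%R).
  { intros n k. induction k; [rewrite Nat.add_0_r; lra|]. rewrite Nat.add_succ_r.
    eapply Rle_trans; [apply Hb|apply IHk]. }
  assert (Hall : forall n m, (a n <= b m)%R).
  { intros n m. apply Rle_trans with (a (n + m)%nat); [apply Hma|].
    apply Rle_trans with (b (n + m)%nat); [apply Hab|]. rewrite Nat.add_comm. apply Hmb. }
  destruct (completeness (fun x => exists n, x = a n)) as [p [Hp1 Hp2]].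
  - exists (b O). intros x [n ->]. apply Hall.
  - exists (a O), O. reflexivity.
  - exists p. intros n. split.
    + apply Hp1. exists n. reflexivity.
    + apply Hp2. intros x [m ->]. apply Hall.
Qed.

Record rect := mkrect { ra : R; rb : R; rc : R; rd : R }.

(** Shared by Goursat's lemma and by Bolzano-Weierstrass: a property that every rectangle hands down
    to one of its quarters concentrates at a point. *)
Lemma rect_bisection (Bad : R -> R -> R -> R -> Prop) a b c d :
  (a <= b)%R -> (c <= d)%R -> Bad a b c d ->
  (forall p q r t, (a <= p)%R -> (p <= q)%R -> (q <= b)%R ->
     (c <= r)%R -> (r <= t)%R -> (t <= d)%R -> Bad p q r t ->
     let m := ((p + q) / 2)%R in let n := ((r + t) / 2)%R in
     Bad p m r n \/ Bad m q r n \/ Bad p m n t \/ Bad m q n t) ->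
  exists x y, (a <= x <= b)%R /\ (c <= y <= d)%R /\
    forall eps, (0 < eps)%R -> exists p q r t,
      (a <= p <= x)%R /\ (x <= q <= b)%R /\ (c <= r <= y)%R /\ (y <= t <= d)%R /\
      ((q - p) + (t - r) < eps)%R /\ Bad p q r t.
Proof.
  intros Hab Hcd HB Hstep.
  pose (good := fun q => (a <= ra q)%R /\ (ra q <= rb q)%R /\ (rb q <= b)%R /\
     (c <= rc q)%R /\ (rc q <= rd q)%R /\ (rd q <= d)%R /\ Bad (ra q) (rb q) (rc q) (rd q)).
  pose (sub := fun q q' => (ra q <= ra q')%R /\ (rb q' <= rb q)%R /\
     (rc q <= rc q')%R /\ (rd q' <= rd q)%R /\
     (rb q' - ra q' = (rb q - ra q) / 2)%R /\ (rd q' - rc q' = (rd q - rc q) / 2)%R).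
  destruct (dependent_choice good sub) with (x0 := mkrect a b c d) as [u [Hu0 Hu]].
  { intros [p q r t] [H1 [H2 [H3 [H4 [H5 [H6 H7]]]]]]. simpl in *.
    destruct (Hstep p q r t) as [Hq|[Hq|[Hq|Hq]]]; auto.
    - exists (mkrect p ((p + q) / 2) r ((r + t) / 2)). unfold good, sub; simpl. repeat split; auto; lra.
    - exists (mkrect ((p + q) / 2) q r ((r + t) / 2)). unfold good, sub; simpl. repeat split; auto; lra.
    - exists (mkrect p ((p + q) / 2) ((r + t) / 2) t). unfold good, sub; simpl. repeat split; auto; lra.
    - exists (mkrect ((p + q) / 2) q ((r + t) / 2) t). unfold good, sub; simpl. repeat split; auto; lra. }
  { unfold good; simpl. repeat split; auto; lra. }
  assert (Hw : forall n, (rb (u n) - ra (u n) = (b - a) * (/ 2) ^ n)%R /\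
                         (rd (u n) - rc (u n) = (d - c) * (/ 2) ^ n)%R).
  { induction n as [|n [IH1 IH2]]; [rewrite Hu0; simpl; lra|].
    destruct (Hu n) as [_ [_ [_ [_ [_ [E1 E2]]]]]]. rewrite E1, E2, IH1, IH2. simpl. lra. }
  destruct (nested_intervals (fun n => ra (u n)) (fun n => rb (u n)) (b - a)) as [px Hpx];
    try (intros n; apply (Hu n)); try (intros n; apply (Hw n)); try lra.
  destruct (nested_intervals (fun n => rc (u n)) (fun n => rd (u n)) (d - c)) as [py Hpy];
    try (intros n; apply (Hu n)); try (intros n; apply (Hw n)); try lra.
  exists px, py. split; [|split].
  - specialize (Hpx O). rewrite Hu0 in Hpx. exact Hpx.
  - specialize (Hpy O). rewrite Hu0 in Hpy. exact Hpy.
  - intros e He. destruct (half_pow_small ((b - a) + (d - c)) e He) as [n Hn].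
    destruct (Hu n) as [[G1 [G2 [G3 [G4 [G5 [G6 G7]]]]]] _]. destruct (Hw n) as [W1 W2].
    specialize (Hpx n). specialize (Hpy n). simpl in *.
    exists (ra (u n)), (rb (u n)), (rc (u n)), (rd (u n)). repeat split; auto; lra.
Qed.

(** If the integral is nonzero, bisection can preserve |integral| >= k s^2, for s half the
    perimeter: quartering divides s^2 by 4 and one quarter keeps at least a fourth of the integral.
    Differentiability at the limit point then bounds small integrals by k s^2 / 2. *)
Theorem goursat H a b c d : (a <= b)%R -> (c <= d)%R ->
  (forall x y, (a <= x <= b)%R -> (c <= y <= d)%R -> cdiff H (x, y)) ->
  rect_int H a b c d = 0.
Proof.
  intros Hab Hcd Hd.
  assert (Hc : cont_rect H a b c d) by (intros x y Hx Hy; apply cdiff_ccont, Hd; auto).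
  apply NNPP. intros Hne.
  assert (Hpos : (0 < Cmod (rect_int H a b c d))%R) by (apply Cmod_gt_0, Hne).
  pose (s0 := ((b - a) + (d - c))%R).
  (* A degenerate rectangle has s = 0 and must be excluded before dividing by s^2. *)
  assert (Hs0 : (0 < s0)%R).
  { unfold s0. apply Rnot_le_lt. intros Hs.
    assert (a = b) by lra. assert (c = d) by lra. subst.
    assert (HM : (Cmod (rect_int H b b d d) <= 2 * Cmod (H (b, d)) * ((b - b) + (d - d)))%R).
    { apply rect_int_bound; auto. intros x y Hx Hy.
      assert (x = b) by lra. assert (y = d) by lra. subst. lra. }
    replace (2 * Cmod (H (b, d)) * (b - b + (d - d)))%R with 0 in HM by ring. lra. }
  pose (k := (Cmod (rect_int H a b c d) / s0 ^ 2)%R).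
  assert (Hs2 : (0 < s0 ^ 2)%R) by (apply pow_lt; auto).
  assert (Hk : (0 < k)%R) by (apply Rdiv_lt_0_compat; auto).
  destruct (rect_bisection
    (fun p q r t => (0 < (q - p) + (t - r))%R /\
       (k * ((q - p) + (t - r)) ^ 2 <= Cmod (rect_int H p q r t))%R) a b c d)
    as [x [y [Hx [Hy Hsmall]]]]; auto.
  { split; [exact Hs0|]. fold s0. unfold k. right. field. lra. }
  { intros p q r t H1 H2 H3 H4 H5 H6 [H7 H8] m n.
    assert (Hm : (p <= m <= q)%R) by (unfold m; lra).
    assert (Hn : (r <= n <= t)%R) by (unfold n; lra).
    assert (Hg : forall x x' y y', (x' - x = (q - p) / 2)%R -> (y' - y = (t - r) / 2)%R ->
       ((0 < (x' - x) + (y' - y))%R /\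
        (k * ((x' - x) + (y' - y)) ^ 2 <= Cmod (rect_int H x x' y y'))%R) \/
       (Cmod (rect_int H x x' y y') < k * ((q - p) + (t - r)) ^ 2 / 4)%R).
    { intros x x' y y' -> ->.
      destruct (Rlt_le_dec (Cmod (rect_int H x x' y y')) (k * ((q - p) + (t - r)) ^ 2 / 4)) as [Hl|Hl];
        [right; exact Hl|left]. split; [lra|].
      eapply Rle_trans; [|exact Hl]. right. simpl. field. }
    destruct (Hg p m r n) as [?|L1]; auto; try (unfold m, n; lra).
    destruct (Hg m q r n) as [?|L2]; auto; try (unfold m, n; lra).
    destruct (Hg p m n t) as [?|L3]; auto; try (unfold m, n; lra).
    destruct (Hg m q n t) as [?|L4]; auto; try (unfold m, n; lra).
    exfalso.
    assert (E : rect_int H p q r t = (rect_int H p m r n + rect_int H m q r n) +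
       (rect_int H p m n t + rect_int H m q n t)).
    { rewrite (rect_int_split_y H p q r t) with (m := n); auto; try lra.
      2:{ apply (cont_rect_sub H a b c d); auto. }
      rewrite (rect_int_split_x H p q r n) with (m := m); auto; try lra.
      2:{ apply (cont_rect_sub H a b c d); auto; lra. }
      rewrite (rect_int_split_x H p q n t) with (m := m); auto; try lra.
      apply (cont_rect_sub H a b c d); auto; lra. }
    rewrite E in H8.
    assert (T1 := Cmod_triangle (rect_int H p m r n + rect_int H m q r n) (rect_int H p m n t + rect_int H m q n t)).
    assert (T2 := Cmod_triangle (rect_int H p m r n) (rect_int H m q r n)).
    assert (T3 := Cmod_triangle (rect_int H p m n t) (rect_int H m q n t)).
    simpl in *. lra. }
  destruct (rect_int_local H (x, y) (Hd x y Hx Hy) (k / 2)) as [dl [Hdl Hloc]]; [lra|].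
  destruct (Hsmall dl Hdl) as [p [q [r [t [H1 [H2 [H3 [H4 [H5 [H6 H7]]]]]]]]]].
  assert (Hb : (Cmod (rect_int H p q r t) <= k / 2 * ((q - p) + (t - r)) ^ 2)%R).
  { apply Hloc; simpl; auto; try lra. apply (cont_rect_sub H a b c d); auto; lra. }
  assert (0 < k * ((q - p) + (t - r)) ^ 2)%R by (apply Rmult_lt_0_compat; [auto|apply pow_lt; auto]).
  lra.
Qed.

(** Bolzano-Weierstrass, by bisection on the property of containing infinitely many terms. The later
    compactness arguments speak of cluster points in this sense and extract no subsequences. *)
Lemma bounded_cluster (u : nat -> C) (M : R) : (forall n, (Cmod (u n) <= M)%R) ->
  exists p, forall eps N, (0 < eps)%R -> exists n, (N <= n)%nat /\ (Cmod (u n - p) < eps)%R.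
Proof.
  intros HM.
  pose (inside := fun p q r t n => (p <= fst (u n) <= q)%R /\ (r <= snd (u n) <= t)%R).
  assert (Hb : forall n, inside (- M)%R M (- M)%R M n).
  { intros n. generalize (HM n), (Rmax_Cmod (u n)), (Rmax_l (Rabs (fst (u n))) (Rabs (snd (u n)))),
      (Rmax_r (Rabs (fst (u n))) (Rabs (snd (u n)))). intros.
    split; apply Rabs_le_between; lra. }
  assert (HM0 : (- M <= M)%R) by (destruct (Hb O); lra).
  destruct (rect_bisection
    (fun p q r t => forall N, exists n, (N <= n)%nat /\ inside p q r t n) (-M)%R M (-M)%R M)
    as [x [y [_ [_ Hsmall]]]]; auto.
  { intros N. exists N. auto. }
  { intros p q r t _ _ _ _ _ _ Hinf m n.
    apply NNPP. intros Hno.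
    apply not_or_and in Hno. destruct Hno as [N1 Hno].
    apply not_or_and in Hno. destruct Hno as [N2 Hno].
    apply not_or_and in Hno. destruct Hno as [N3 N4].
    apply not_all_ex_not in N1. destruct N1 as [k1 N1].
    apply not_all_ex_not in N2. destruct N2 as [k2 N2].
    apply not_all_ex_not in N3. destruct N3 as [k3 N3].
    apply not_all_ex_not in N4. destruct N4 as [k4 N4].
    destruct (Hinf (k1 + k2 + k3 + k4)%nat) as [j [Hj [[J1 J2] [J3 J4]]]].
    destruct (Rle_dec (fst (u j)) m) as [Hl|Hl]; destruct (Rle_dec (snd (u j)) n) as [Hl'|Hl'].
    - apply N1. exists j. unfold inside. repeat split; try lia; lra.
    - apply N3. exists j. unfold inside. repeat split; try lia; lra.
    - apply N2. exists j. unfold inside. repeat split; try lia; lra.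
    - apply N4. exists j. unfold inside. repeat split; try lia; lra. }
  exists (x, y). intros e N He.
  destruct (Hsmall e He) as [p [q [r [t [H1 [H2 [H3 [H4 [H5 H6]]]]]]]]].
  destruct (H6 N) as [n [Hn [Hn1 Hn2]]]. exists n. split; auto.
  replace (u n - (x, y)) with (fst (u n) - x, snd (u n) - y)%R by (apply injective_projections; simpl; ring).
  eapply Rle_lt_trans; [apply Cmod_pair_le|].
  assert (Rabs (fst (u n) - x) <= q - p)%R by (apply Rabs_le; lra).
  assert (Rabs (snd (u n) - y) <= t - r)%R by (apply Rabs_le; lra). lra.
Qed.

(** * The exponential and logarithmic coordinates *)

(* [Cexp2pi], retyped in Coquelicot's [C] so that [ring] and [field] apply. *)
Definition cis (t : R) : C := Cexp2pi t.

(** The map e^(2 pi z), which winds the segment from (x, 0) to (x, 1) once around a circle. *)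
Definition cexp2pi (z : C) : C :=
  (exp (2 * PI * fst z) * cos (2 * PI * snd z), exp (2 * PI * fst z) * sin (2 * PI * snd z))%R.

Lemma cexp2pi_polar x y : cexp2pi (x, y) = RtoC (exp (2 * PI * x)) * cis y.
Proof. apply injective_projections; simpl; ring. Qed.

Lemma cexp2pi_add z w : cexp2pi (z + w) = cexp2pi z * cexp2pi w.
Proof.
  destruct z as [a b], w as [c d]. unfold cexp2pi; simpl.
  rewrite !Rmult_plus_distr_l, exp_plus, cos_plus, sin_plus.
  apply injective_projections; simpl; ring.
Qed.

Lemma cis_add s t : cis (s + t) = cis s * cis t.
Proof.
  unfold cis, Cexp2pi. rewrite !Rmult_plus_distr_l, cos_plus, sin_plus.
  apply injective_projections; simpl; ring.
Qed.

Lemma Cmod_cis t : Cmod (cis t) = 1.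
Proof.
  unfold cis, Cexp2pi, Cmod; cbn [fst snd].
  replace (cos (2 * PI * t) ^ 2 + sin (2 * PI * t) ^ 2)%R with 1%R; [apply sqrt_1|].
  rewrite <- (sin2_cos2 (2 * PI * t)). unfold Rsqr. ring.
Qed.

Lemma cis_0 : cis 0 = RtoC 1.
Proof. unfold cis, Cexp2pi. rewrite Rmult_0_r, cos_0, sin_0. reflexivity. Qed.

Lemma cis_1 : cis 1 = RtoC 1.
Proof. unfold cis, Cexp2pi. rewrite Rmult_1_r, cos_2PI, sin_2PI. reflexivity. Qed.

Lemma cis_opp t : cis (- t) = / cis t.
Proof.
  assert (H : cis t <> RtoC 0) by (apply Cmod_gt_0; rewrite Cmod_cis; lra).
  assert (E : cis (- t) * cis t = RtoC 1).
  { rewrite <- cis_add. replace (- t + t)%R with 0 by ring. apply cis_0. }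
  transitivity (cis (- t) * cis t * / cis t); [field; exact H|].
  rewrite E. field. exact H.
Qed.

Lemma cis_pow t n : cis t ^ n = cis (INR n * t).
Proof.
  induction n as [|n IH].
  - simpl. rewrite Rmult_0_l, cis_0. reflexivity.
  - rewrite S_INR, Rmult_plus_distr_r, Rmult_1_l, Rplus_comm, cis_add, <- IH. reflexivity.
Qed.

Lemma unit_circle_param (z : C) : Cmod z = 1 -> exists t, z = cis t.
Proof.
  intros Hz. destruct z as [x y].
  assert (E : (x * x + y * y = 1)%R).
  { assert (H := Cmod2_alt (x, y)). rewrite Hz in H. simpl in H. lra. }
  assert (Hx : (-1 <= x <= 1)%R) by (split; nra).
  assert (HP := PI_RGT_0).
  assert (Hs : (sin (acos x) = sqrt (y * y))%R).
  { rewrite sin_acos by auto. f_equal. unfold Rsqr. lra. }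
  destruct (Rle_dec 0 y) as [Hy|Hy].
  - exists (acos x / (2 * PI))%R. unfold cis, Cexp2pi.
    replace (2 * PI * (acos x / (2 * PI)))%R with (acos x) by (field; lra).
    rewrite cos_acos, Hs, sqrt_square by auto. reflexivity.
  - exists (- acos x / (2 * PI))%R. unfold cis, Cexp2pi.
    replace (2 * PI * (- acos x / (2 * PI)))%R with (- acos x)%R by (field; lra).
    rewrite cos_neg, sin_neg, cos_acos, Hs by auto.
    replace (y * y)%R with ((- y) * (- y))%R by ring. rewrite sqrt_square by lra.
    f_equal. ring.
Qed.

Lemma deriv_estimate f l : derivable_pt_lim f 0 l -> forall e, (0 < e)%R ->
  exists d, (0 < d)%R /\ forall x, (Rabs x < d)%R -> (Rabs (f x - f 0 - l * x) <= e * Rabs x)%R.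
Proof.
  intros H e He. destruct (H e He) as [d Hd]. exists d. split; [apply cond_pos|].
  intros x Hx. destruct (Req_dec x 0) as [->|Hx0].
  - rewrite Rmult_0_r, !Rminus_diag, Rabs_R0. lra.
  - specialize (Hd x Hx0 Hx). rewrite Rplus_0_l in Hd.
    replace (f x - f 0 - l * x)%R with (((f x - f 0) / x - l) * x)%R by (field; auto).
    rewrite Rabs_mult. apply Rmult_le_compat_r; [apply Rabs_pos|]. lra.
Qed.

Lemma has_cderiv_cexp2pi_0 : has_cderiv cexp2pi (RtoC 0) (RtoC (2 * PI)).
Proof.
  intros e He.
  assert (HP := PI_RGT_0).
  (* The error terms below add up to at most 8 e' |2 pi w|, and 8 (2 pi) / (40 pi) = 2/5 is less
     than 1. *)
  pose (e' := (e / (40 * PI))%R).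
  assert (He' : (0 < e')%R) by (apply Rdiv_lt_0_compat; lra).
  destruct (deriv_estimate exp 1 (eq_rect _ (fun l => derivable_pt_lim exp 0 l) (derivable_pt_lim_exp 0) _ exp_0) e' He') as [d1 [H1 E1]].
  destruct (deriv_estimate cos (- sin 0) (derivable_pt_lim_cos 0) e' He') as [d2 [H2 E2]].
  destruct (deriv_estimate sin (cos 0) (derivable_pt_lim_sin 0) e' He') as [d3 [H3 E3]].
  rewrite sin_0, cos_0, ?exp_0 in *.
  (* The radius [e' / (1 + e')] gives |exp u - 1| <= (1 + e') |u| <= e'. *)
  set (dd := Rmin (Rmin d1 d2) (Rmin d3 (Rmin 1 (e' / (1 + e'))))).
  assert (Hdd : (0 < dd)%R).
  { unfold dd. repeat apply Rmin_pos; auto; try lra. apply Rdiv_lt_0_compat; lra. }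
  assert (Hdd1 : (dd <= d1)%R) by (unfold dd; eapply Rle_trans; [apply Rmin_l|apply Rmin_l]).
  assert (Hdd2 : (dd <= d2)%R) by (unfold dd; eapply Rle_trans; [apply Rmin_l|apply Rmin_r]).
  assert (Hdd3 : (dd <= d3)%R) by (unfold dd; eapply Rle_trans; [apply Rmin_r|apply Rmin_l]).
  assert (Hdd4 : (dd <= 1)%R).
  { unfold dd; eapply Rle_trans; [apply Rmin_r|eapply Rle_trans; [apply Rmin_r|apply Rmin_l]]. }
  assert (Hdd5 : (dd * (1 + e') <= e')%R).
  { apply Rle_trans with ((e' / (1 + e')) * (1 + e'))%R; [|right; field; lra].
    apply Rmult_le_compat_r; [lra|].
    unfold dd; eapply Rle_trans; [apply Rmin_r|eapply Rle_trans; [apply Rmin_r|apply Rmin_r]]. }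
  exists (dd / (2 * PI))%R. split; [apply Rdiv_lt_0_compat; lra|].
  intros [a b] [_ Hw].
  change (Cmod ((a, b) - 0) < dd / (2 * PI))%R in Hw.
  change (Cmod (cexp2pi (a, b) - cexp2pi 0 - RtoC (2 * PI) * ((a, b) - 0)) <= e * Cmod ((a, b) - 0))%R.
  replace ((a, b) - 0) with (a, b) in * by (apply injective_projections; simpl; ring).
  assert (Hm := Rmax_Cmod (a, b)). simpl in Hm.
  assert (Ha := Rle_trans _ _ _ (Rmax_l _ _) Hm). assert (Hb := Rle_trans _ _ _ (Rmax_r _ _) Hm).
  set (N := Cmod (a, b)) in *.
  assert (HN : (2 * PI * N < dd)%R).
  { apply Rmult_lt_compat_l with (r := (2 * PI)%R) in Hw; [|lra].
    replace (2 * PI * (dd / (2 * PI)))%R with dd in Hw by (field; lra). exact Hw. }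
  set (u := (2 * PI * a)%R). set (v := (2 * PI * b)%R).
  assert (Hu : (Rabs u <= 2 * PI * N)%R).
  { unfold u. rewrite Rabs_mult, (Rabs_pos_eq (2 * PI)) by lra. nra. }
  assert (Hv : (Rabs v <= 2 * PI * N)%R).
  { unfold v. rewrite Rabs_mult, (Rabs_pos_eq (2 * PI)) by lra. nra. }
  specialize (E1 u ltac:(lra)). specialize (E2 v ltac:(lra)). specialize (E3 v ltac:(lra)).
  assert (HN0 : (0 <= N)%R) by apply Cmod_ge_0.
  set (n := (2 * PI * N)%R) in *.
  assert (Hn0 : (0 <= n)%R) by (unfold n; nra).
  assert (Hx : (Rabs (exp u - 1) <= e')%R).
  { replace (exp u - 1)%R with ((exp u - 1 - 1 * u) + u)%R by ring.
    eapply Rle_trans; [apply Rabs_triang|]. nra. }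
  assert (He2 : (e' * Rabs u <= e' * n)%R) by (apply Rmult_le_compat_l; lra).
  assert (He3 : (e' * Rabs v <= e' * n)%R) by (apply Rmult_le_compat_l; lra).
  assert (Hx2 : (Rabs (exp u) <= 3)%R).
  { rewrite Rabs_pos_eq by (left; apply exp_pos). apply Rle_trans with (exp 1); [|apply exp_le_3].
    destruct (Req_dec u 1) as [->|]; [lra|]. left. apply exp_increasing.
    generalize (Rle_abs u). lra. }
  replace (cexp2pi (a, b) - cexp2pi 0 - RtoC (2 * PI) * (a, b))
    with ((exp u - 1 - 1 * u) + exp u * (cos v - 1 - - 0 * v),
          exp u * (sin v - 0 - 1 * v) + (exp u - 1) * v)%R.
  2:{ unfold cexp2pi; simpl. rewrite !Rmult_0_r, exp_0, cos_0, sin_0. fold u v.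
      apply injective_projections; simpl; unfold u, v; ring. }
  eapply Rle_trans; [apply Cmod_pair_le|].
  eapply Rle_trans; [apply Rplus_le_compat; apply Rabs_triang|].
  rewrite !Rabs_mult.
  assert (B1 : (Rabs (exp u) * Rabs (cos v - 1 - - 0 * v) <= 3 * (e' * n))%R)
    by (apply Rmult_le_compat; try apply Rabs_pos; lra).
  assert (B2 : (Rabs (exp u) * Rabs (sin v - 0 - 1 * v) <= 3 * (e' * n))%R)
    by (apply Rmult_le_compat; try apply Rabs_pos; lra).
  assert (B3 : (Rabs (exp u - 1) * Rabs v <= e' * n)%R)
    by (apply Rmult_le_compat; try apply Rabs_pos; lra).
  apply Rle_trans with (8 * (e' * n))%R; [lra|].
  unfold e', n. replace (8 * (e / (40 * PI) * (2 * PI * N)))%R with (e * N * (2/5))%R by (field; lra).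
  assert (0 <= e * N)%R by (apply Rmult_le_pos; lra). lra.
Qed.

Lemma cdiff_cexp2pi z : cdiff cexp2pi z.
Proof.
  apply (cdiff_ext_loc (fun w => cexp2pi z * cexp2pi (w - z)) _ z 1); [lra| |].
  - intros w _. rewrite <- cexp2pi_add. f_equal. ring.
  - apply cdiff_mult; [apply cdiff_const|].
    apply (cdiff_comp (fun w => w - z) cexp2pi).
    + apply cdiff_minus; [apply cdiff_id|apply cdiff_const].
    + replace (z - z) with (RtoC 0) by ring. exists (RtoC (2 * PI)). apply has_cderiv_cexp2pi_0.
Qed.

(** * Means over circles *)

Definition circ (s t : R) : C := RtoC s * cis t.

Lemma Cmod_circ s t : (0 <= s)%R -> Cmod (circ s t) = s.
Proof. intros Hs. unfold circ. rewrite Cmod_mult, Cmod_R, Cmod_cis, Rabs_pos_eq by auto. lra. Qed.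

Lemma circ_cexp2pi s t : (0 < s)%R -> circ s t = cexp2pi (ln s / (2 * PI), t)%R.
Proof.
  intros Hs. assert (HP := PI_RGT_0). rewrite cexp2pi_polar. unfold circ.
  replace (2 * PI * (ln s / (2 * PI)))%R with (ln s) by (field; lra).
  rewrite exp_ln by auto. reflexivity.
Qed.

Lemma rcont_circ F s t : (0 < s)%R -> ccont F (circ s t) -> rcont (fun t => F (circ s t)) t.
Proof.
  intros Hs Hc.
  assert (H : ccont (fun z => F (cexp2pi z)) (ln s / (2 * PI), t)%R).
  { apply (ccont_comp cexp2pi F); [apply cdiff_ccont, cdiff_cexp2pi|].
    rewrite <- circ_cexp2pi by auto. exact Hc. }
  apply ccont_vert in H. intros e He. destruct (H e He) as [d [Hd H']].
  exists d. split; auto. intros t' Ht'. rewrite !circ_cexp2pi by auto. apply H', Ht'.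
Qed.

(** The mean over a circle, which is the contour integral of F(z) / (2 pi i z) dz. *)
Definition cmean (F : C -> C) (s : R) : C := CI (fun t => F (circ s t)) 0 1.

Lemma is_cmean F s : (0 < s)%R -> (forall z, Cmod z = s -> ccont F z) ->
  is_CI (fun t => F (circ s t)) 0 1 (cmean F s).
Proof.
  intros Hs H. apply is_CI_cont; [lra|]. intros t _. apply rcont_circ; auto.
  apply H, Cmod_circ. lra.
Qed.

(** Through [cexp2pi] the annulus is the image of a rectangle of height 1. Goursat's lemma applies
    there; the horizontal sides cancel by periodicity and the vertical sides are the two means. *)
Lemma cmean_annulus F s1 s2 : (0 < s1)%R -> (s1 <= s2)%R ->
  (forall z, (s1 <= Cmod z <= s2)%R -> cdiff F z) -> cmean F s1 = cmean F s2.
Proof.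
  intros H1 H12 Hd. assert (HP := PI_RGT_0).
  set (x1 := (ln s1 / (2 * PI))%R). set (x2 := (ln s2 / (2 * PI))%R).
  assert (Hx : (x1 <= x2)%R).
  { apply Rmult_le_compat_r; [left; apply Rinv_0_lt_compat; lra|]. apply ln_le; auto. }
  assert (Hexp : forall x, (x1 <= x <= x2)%R -> (s1 <= exp (2 * PI * x) <= s2)%R).
  { intros x Hxx.
    assert (E1 : (exp (2 * PI * x1) = s1)%R).
    { unfold x1. replace (2 * PI * (ln s1 / (2 * PI)))%R with (ln s1) by (field; lra). apply exp_ln; auto. }
    assert (E2 : (exp (2 * PI * x2) = s2)%R).
    { unfold x2. replace (2 * PI * (ln s2 / (2 * PI)))%R with (ln s2) by (field; lra). apply exp_ln; lra. }
    rewrite <- E1, <- E2. split.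
    - destruct (Req_dec x x1) as [->|]; [lra|]. left. apply exp_increasing. nra.
    - destruct (Req_dec x x2) as [->|]; [lra|]. left. apply exp_increasing. nra. }
  assert (HG : rect_int (fun z => F (cexp2pi z)) x1 x2 0 1 = 0).
  { apply goursat; auto; [lra|]. intros x y Hxx _.
    apply (cdiff_comp cexp2pi F); [apply cdiff_cexp2pi|]. apply Hd.
    rewrite cexp2pi_polar. fold (circ (exp (2 * PI * x)) y). rewrite Cmod_circ.
    - apply Hexp; auto.
    - left; apply exp_pos. }
  unfold rect_int in HG.
  assert (E01 : forall x, cexp2pi (x, 0) = cexp2pi (x, 1)).
  { intros x. rewrite !cexp2pi_polar, cis_0, cis_1. reflexivity. }
  assert (E : CI (fun x => F (cexp2pi (x, 0))) x1 x2 = CI (fun x => F (cexp2pi (x, 1))) x1 x2).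
  { apply (@RInt_ext C_R_CompleteNormedModule). intros x _. rewrite E01. reflexivity. }
  rewrite E in HG.
  assert (Hm : forall s x, (0 < s)%R -> x = (ln s / (2 * PI))%R ->
    CI (fun y => F (cexp2pi (x, y))) 0 1 = cmean F s).
  { intros s x Hs ->. apply (@RInt_ext C_R_CompleteNormedModule). intros y _.
    rewrite circ_cexp2pi by auto. reflexivity. }
  rewrite (Hm s1 x1 H1 eq_refl), (Hm s2 x2 ltac:(lra) eq_refl) in HG.
  set (A := CI _ _ _) in HG.
  assert (Ci <> 0) by (intros E'; injection E'; lra).
  transitivity (cmean F s2 - / Ci * (A - A + Ci * (cmean F s2 - cmean F s1))); [field; auto|].
  rewrite HG. ring.
Qed.

Lemma ccont_circle_uniform F s0 : (0 < s0)%R -> (forall z, Cmod z = s0 -> ccont F z) ->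
  forall e, (0 < e)%R -> exists d, (0 < d)%R /\
    forall s t, (Rabs (s - s0) < d)%R -> (Cmod (F (circ s t) - F (circ s0 t)) < e)%R.
Proof.
  intros Hs0 Hc e He. apply NNPP. intros Hno.
  assert (Hseq : forall n : nat, exists st : R * R, (Rabs (fst st - s0) < / (INR n + 1))%R /\
     (e <= Cmod (F (circ (fst st) (snd st)) - F (circ s0 (snd st))))%R).
  { intros n. apply NNPP. intros Hn. apply Hno. exists (/ (INR n + 1))%R. split.
    - apply inv_INR_pos.
    - intros s t Hst. apply Rnot_le_lt. intros Hle. apply Hn. exists (s, t). auto. }
  destruct (choice _ Hseq) as [st Hst].
  destruct (bounded_cluster (fun n => circ s0 (snd (st n))) s0) as [p Hp].
  { intros n. rewrite Cmod_circ; lra. }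
  assert (Hps : Cmod p = s0).
  { apply cond_eq. intros eta Heta. destruct (Hp eta O Heta) as [n [_ Hn]].
    generalize (Cmod_sub_ge (circ s0 (snd (st n))) p), (Cmod_sub_ge p (circ s0 (snd (st n)))).
    rewrite (Cmod_sub_sym p), Cmod_circ by lra. intros. apply Rabs_def1; lra. }
  destruct (Hc p Hps (e / 2)%R) as [d [Hd Hd']]; [lra|].
  destruct (inv_INR_small (d / 2)) as [N HN]; [lra|].
  destruct (Hp (d / 2)%R N) as [n [Hn Hn']]; [lra|].
  destruct (Hst n) as [G1 G2].
  assert (Hsm : (Cmod (circ (fst (st n)) (snd (st n)) - circ s0 (snd (st n))) < d / 2)%R).
  { replace (circ (fst (st n)) (snd (st n)) - circ s0 (snd (st n)))
      with (RtoC (fst (st n) - s0) * cis (snd (st n))).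
    - rewrite Cmod_mult, Cmod_R, Cmod_cis, Rmult_1_r.
      eapply Rlt_trans; [apply G1|apply HN, Hn].
    - unfold circ. rewrite RtoC_minus. ring. }
  assert (T1 : (Cmod (F (circ s0 (snd (st n))) - F p) < e / 2)%R) by (apply Hd'; lra).
  assert (T2 : (Cmod (F (circ (fst (st n)) (snd (st n))) - F p) < e / 2)%R).
  { apply Hd'. eapply Rle_lt_trans; [apply (Cmod_sub_triangle _ (circ s0 (snd (st n))))|]. lra. }
  generalize (Cmod_sub_triangle (F (circ (fst (st n)) (snd (st n)))) (F p) (F (circ s0 (snd (st n))))).
  rewrite (Cmod_sub_sym (F p)). lra.
Qed.

Lemma cmean_close F s L e : (0 < s)%R -> (forall z, Cmod z = s -> ccont F z) ->
  (forall t, (Cmod (F (circ s t) - L) <= e)%R) -> (Cmod (cmean F s - L) <= e)%R.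
Proof.
  intros Hs Hc H.
  replace L with (RtoC (1 - 0) * L) by (rewrite Rminus_0_r; ring).
  replace e with ((1 - 0) * e)%R by ring.
  apply (is_CI_bound_const (fun t => F (circ s t) - L)); [lra|intros t _; apply H|].
  apply is_CI_minus; [apply is_cmean; auto|apply is_CI_const].
Qed.

Lemma cmean_continuous F s0 : (0 < s0)%R ->
  (exists r, (0 < r)%R /\ forall z, (Rabs (Cmod z - s0) < r)%R -> ccont F z) ->
  forall e, (0 < e)%R -> exists d, (0 < d)%R /\
    forall s, (Rabs (s - s0) < d)%R -> (Cmod (cmean F s - cmean F s0) < e)%R.
Proof.
  intros Hs0 [r [Hr Hc]] e He.
  assert (Hc0 : forall z, Cmod z = s0 -> ccont F z).
  { intros z Hz. apply Hc. rewrite Hz, Rminus_diag, Rabs_R0. auto. }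
  destruct (ccont_circle_uniform F s0 Hs0 Hc0 (e / 2)) as [d [Hd Hu]]; [lra|].
  exists (Rmin d (Rmin r s0)). split; [repeat apply Rmin_pos; auto|]. intros s Hs.
  assert (B1 := Rlt_le_trans _ _ _ Hs (Rmin_l _ _)).
  assert (B2 := Rlt_le_trans _ _ _ Hs (Rle_trans _ _ _ (Rmin_r _ _) (Rmin_l _ _))).
  assert (B3 := Rlt_le_trans _ _ _ Hs (Rle_trans _ _ _ (Rmin_r _ _) (Rmin_r _ _))).
  assert (Hsp : (0 < s)%R) by (apply Rabs_def2 in B3; lra).
  apply Rle_lt_trans with ((1 - 0) * (e / 2))%R; [|lra].
  apply (is_CI_bound_const (fun t => F (circ s t) - F (circ s0 t))); [lra| |].
  - intros t _. left. apply Hu, B1.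
  - apply is_CI_minus; apply is_cmean; auto. intros z Hz. apply Hc. rewrite Hz. exact B2.
Qed.

Definition lim_inf (F : C -> C) (L : C) : Prop :=
  forall e, (0 < e)%R -> exists M, forall z, (M < Cmod z)%R -> (Cmod (F z - L) < e)%R.

(* One exceptional radius [s1] is allowed, where only continuity is asked for: the
   difference quotient in Cauchy's formula is not known to be differentiable at its base point. *)
Lemma cmean_exterior F r s1 s L : (0 < r)%R -> (r < s)%R ->
  (forall z, (r < Cmod z)%R -> ccont F z) ->
  (forall z, (r < Cmod z)%R -> Cmod z <> s1 -> cdiff F z) ->
  lim_inf F L -> cmean F s = L.
Proof.
  intros Hr Hs Hc Hd HL.
  assert (Hcz : forall u z, (r < u)%R -> Cmod z = u -> ccont F z) by (intros u z Hu Hz; apply Hc; lra).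
  (* Beyond [s1] the mean does not depend on the radius, and for large radii it is close to [L]. *)
  assert (Hbig : forall u, (s1 < u)%R -> (r < u)%R -> cmean F u = L).
  { intros u Hu1 Hu2.
    assert (Hz : Cmod (cmean F u - L) = 0).
    { apply cond_eq. intros e He. destruct (HL (e / 2)%R) as [M HM]; [lra|].
      set (v := (Rmax u (M + 1))%R).
      assert (Huv : (u <= v)%R) by apply Rmax_l.
      assert (HMv : (M + 1 <= v)%R) by apply Rmax_r.
      rewrite (cmean_annulus F u v); auto; try lra.
      2:{ intros z Hz. apply Hd; lra. }
      rewrite Rminus_0_r, Rabs_pos_eq by apply Cmod_ge_0.
      apply Rle_lt_trans with (e / 2)%R; [|lra].
      apply cmean_close; try lra.
      - intros z Hz. apply (Hcz v); lra.
      - intros t. left. apply HM. rewrite Cmod_circ; lra. }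
    apply Cmod_eq_0 in Hz. replace L with (L + 0) by ring. rewrite <- Hz. ring. }
  assert (Hcont : forall u, (r < u)%R -> forall e, (0 < e)%R -> exists d, (0 < d)%R /\
    forall s, (Rabs (s - u) < d)%R -> (Cmod (cmean F s - cmean F u) < e)%R).
  { intros u Hu. apply cmean_continuous; [lra|]. exists (u - r)%R. split; [lra|].
    intros z Hz. apply Hc. apply Rabs_def2 in Hz. lra. }
  (* Continuity of the mean in the radius bridges the exceptional radius, from above here and from
     below in the last case. *)
  assert (Hmid : (r < s1)%R -> cmean F s1 = L).
  { intros H1. assert (Hz : Cmod (cmean F s1 - L) = 0).
    { apply cond_eq. intros e He. destruct (Hcont s1 H1 e He) as [d [Hd0 Hd']].
      rewrite Rminus_0_r, Rabs_pos_eq by apply Cmod_ge_0.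
      rewrite <- (Hbig (s1 + d / 2)%R) by lra. rewrite Cmod_sub_sym. apply Hd'.
      replace (s1 + d / 2 - s1)%R with (d / 2)%R by ring. rewrite Rabs_pos_eq; lra. }
    apply Cmod_eq_0 in Hz. replace L with (L + 0) by ring. rewrite <- Hz. ring. }
  destruct (Rtotal_order s s1) as [Hlt|[->|Hgt]]; auto.
  rewrite <- Hmid by lra.
  assert (Hz : Cmod (cmean F s - cmean F s1) = 0).
  { apply cond_eq. intros e He. destruct (Hcont s1 ltac:(lra) e He) as [d [Hd0 Hd']].
    rewrite Rminus_0_r, Rabs_pos_eq by apply Cmod_ge_0.
    set (v := (Rmax s (s1 - d / 2))%R).
    assert (s <= v)%R by apply Rmax_l. assert (s1 - d / 2 <= v)%R by apply Rmax_r.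
    assert (v < s1)%R by (apply Rmax_lub_lt; lra).
    rewrite (cmean_annulus F s v); try lra.
    - apply Hd'. apply Rabs_def1; lra.
    - intros z Hzz. apply Hd; lra. }
  apply Cmod_eq_0 in Hz. replace (cmean F s1) with (cmean F s1 + 0) by ring. rewrite <- Hz. ring.
Qed.

Lemma lim_inf_const c : lim_inf (fun _ => c) c.
Proof. intros e He. exists 0. intros z _. rewrite Cmod_sub_refl. exact He. Qed.

Lemma lim_inf_mult F G K L : lim_inf F K -> lim_inf G L -> lim_inf (fun z => F z * G z) (K * L).
Proof.
  intros HF HG e He. destruct (Cmult_close K L e He) as [m [Hm H]].
  destruct (HF m Hm) as [M1 H1]. destruct (HG m Hm) as [M2 H2].
  exists (Rmax M1 M2). intros z Hz. apply H.
  - apply H1. eapply Rle_lt_trans; [apply Rmax_l|apply Hz].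
  - apply H2. eapply Rle_lt_trans; [apply Rmax_r|apply Hz].
Qed.

Lemma lim_inf_minus F G K L : lim_inf F K -> lim_inf G L -> lim_inf (fun z => F z - G z) (K - L).
Proof.
  intros HF HG e He.
  destruct (HF (e / 2)%R) as [M1 H1]; [lra|]. destruct (HG (e / 2)%R) as [M2 H2]; [lra|].
  exists (Rmax M1 M2). intros z Hz.
  specialize (H1 z (Rle_lt_trans _ _ _ (Rmax_l _ _) Hz)).
  specialize (H2 z (Rle_lt_trans _ _ _ (Rmax_r _ _) Hz)).
  replace (F z - G z - (K - L)) with ((F z - K) + - (G z - L)) by ring.
  generalize (Cmod_triangle (F z - K) (- (G z - L))). rewrite Cmod_opp. lra.
Qed.

Lemma lim_inf_pow F L n : lim_inf F L -> lim_inf (fun z => F z ^ n) (L ^ n).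
Proof.
  intros H. induction n; simpl; [apply lim_inf_const|apply lim_inf_mult; auto].
Qed.

Lemma lim_inf_comp F L (g : C -> C) : lim_inf F L -> ccont g L -> lim_inf (fun z => g (F z)) (g L).
Proof.
  intros HF Hg e He. destruct (Hg e He) as [d [Hd H]]. destruct (HF d Hd) as [M HM].
  exists M. intros z Hz. apply H, HM, Hz.
Qed.

Lemma lim_inf_inv_id : lim_inf Cinv 0.
Proof.
  intros e He. exists (/ e)%R. intros z Hz.
  assert (0 < / e)%R by (apply Rinv_0_lt_compat, He).
  assert (z <> 0) by (apply Cmod_gt_0; lra).
  replace (/ z - 0) with (/ z) by ring. rewrite Cmod_inv by auto.
  rewrite <- (Rinv_inv e). apply Rinv_lt_contravar; auto. nra.
Qed.

Lemma lim_inf_ext F G L M : (forall z, (M < Cmod z)%R -> F z = G z) -> lim_inf F L -> lim_inf G L.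
Proof.
  intros H HF e He. destruct (HF e He) as [N HN]. exists (Rmax M N). intros z Hz.
  rewrite <- H.
  - apply HN. eapply Rle_lt_trans; [apply Rmax_r|apply Hz].
  - eapply Rle_lt_trans; [apply Rmax_l|apply Hz].
Qed.

Lemma is_CI_reflect (f : R -> C) (l : C) : is_CI f 0 1 l -> is_CI (fun t => f (1 - t)%R) 0 1 l.
Proof.
  intros H. apply (@is_RInt_swap C_R_NormedModule) in H.
  assert (H' : is_CI f (-1 * 0 + 1) (-1 * 1 + 1) (- l)).
  { replace (-1 * 0 + 1)%R with 1%R by ring. replace (-1 * 1 + 1)%R with 0%R by ring. exact H. }
  apply (@is_RInt_comp_lin C_R_NormedModule f (-1) 1 0 1) in H'.
  replace l with (- 1 * (- l)) by ring.
  apply (is_CI_mult (- 1)) in H'.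
  eapply is_CI_ext; [lra| |exact H']. intros t _. cbv beta.
  replace (-1 * t + 1)%R with (1 - t)%R by ring.
  apply injective_projections; simpl; unfold scal; simpl; unfold mult; simpl; ring.
Qed.

(** The kernel has its pole at [z0], in the exterior. On the circle, reversing the angle replaces z
    by s^2 / z, which moves the pole to modulus s^2 / |z0| < s. The mean is then that of [K], which
    is holomorphic outside and tends to 1. *)
Lemma cmean_cauchy_kernel z0 s : (0 < s)%R -> (s < Cmod z0)%R ->
  cmean (fun z => z0 / (z0 - z)) s = 1.
Proof.
  intros Hs Hz0.
  assert (Hne : z0 <> 0) by (apply Cmod_gt_0; lra).
  set (K := fun z : C => z0 / (z0 - RtoC (s * s) * / z)).
  set (r := (s * s / Cmod z0)%R).
  assert (Hr : (0 < r)%R) by (apply Rdiv_lt_0_compat; nra).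
  assert (Hrs : (r < s)%R).
  { unfold r. apply Rlt_div_l; [lra|]. nra. }
  assert (Hden : forall z, (r < Cmod z)%R -> z0 - RtoC (s * s) * / z <> 0).
  { intros z Hz. assert (z <> 0) by (apply Cmod_gt_0; lra).
    apply Csub_neq0. intros E.
    assert (Em : (Cmod z0 * Cmod z = s * s)%R).
    { rewrite <- Cmod_mult, E. rewrite <- Cmult_assoc, Cinv_l by auto.
      rewrite Cmult_1_r, Cmod_R, Rabs_pos_eq; nra. }
    assert (r * Cmod z0 = s * s)%R by (unfold r; field; lra). nra. }
  assert (HKd : forall z, (r < Cmod z)%R -> cdiff K z).
  { intros z Hz. assert (z <> 0) by (apply Cmod_gt_0; lra).
    apply cdiff_div; [apply cdiff_const| |apply Hden; auto].
    apply cdiff_minus; [apply cdiff_const|]. apply cdiff_mult; [apply cdiff_const|].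
    apply cdiff_inv_at; auto. }
  assert (HK1 : cmean K s = 1).
  { apply (cmean_exterior K r (-1) s 1); auto.
    - intros z Hz. apply cdiff_ccont; auto.
    - replace (RtoC 1) with (z0 / (z0 - RtoC (s * s) * 0)) by (field; auto).
      apply (lim_inf_comp Cinv 0 (fun w => z0 / (z0 - RtoC (s * s) * w))); [apply lim_inf_inv_id|].
      apply ccont_div; [apply ccont_const| |].
      + apply ccont_minus; [apply ccont_const|]. apply ccont_mult; [apply ccont_const|apply ccont_id].
      + replace (z0 - RtoC (s * s) * 0) with z0 by ring. auto. }
  rewrite <- HK1. unfold cmean. apply is_CI_unique.
  assert (HI : is_CI (fun t => K (circ s t)) 0 1 (cmean K s)).
  { apply is_cmean; auto. intros z Hz. apply cdiff_ccont, HKd. lra. }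
  apply is_CI_reflect in HI. eapply is_CI_ext; [lra| |exact HI].
  intros t _. cbv beta. unfold K. f_equal. f_equal. f_equal.
  unfold circ. unfold Rminus. rewrite cis_add, cis_1, cis_opp.
  assert (cis t <> 0) by (apply Cmod_gt_0; rewrite Cmod_cis; lra).
  rewrite RtoC_mult. field. repeat split; auto.
  intros E. apply RtoC_inj in E. lra.
Qed.

(** * Cauchy's formula and the maximum principle outside a disc *)

Section Exterior.
Context (F : C -> C) (r : R) (L : C) (Hr : (0 < r)%R)
  (Hd : forall z, (r < Cmod z)%R -> cdiff F z) (HL : lim_inf F L).

(** The function (F z - F z0) z0 / (z0 - z), continued at [z0] by Caratheodory's slope, has mean 0
    because it tends to 0 at infinity, while the kernel has mean 1. At [z0] only continuity is
    known, whence the exceptional radius |z0|. *)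
Lemma cauchy_exterior s z0 : (r < s)%R -> (s < Cmod z0)%R ->
  cmean (fun z => F z * (z0 / (z0 - z))) s = F z0.
Proof.
  intros Hs Hz0.
  assert (Hne : z0 <> 0) by (apply Cmod_gt_0; lra).
  destruct (proj1 (cdiff_factor F z0) (Hd z0 ltac:(lra))) as [q [Hq HF]].
  set (H := fun z => - z0 * q z).
  assert (Hk : forall z, z <> z0 -> H z = (F z - F z0) * (z0 / (z0 - z))).
  { intros z Hz. rewrite HF. unfold H. field. apply Csub_neq0. auto. }
  assert (Hkd : forall z, z <> z0 -> cdiff (fun z => z0 / (z0 - z)) z).
  { intros z Hz. apply cdiff_div; [apply cdiff_const| |apply Csub_neq0; auto].
    apply cdiff_minus; [apply cdiff_const|apply cdiff_id]. }
  assert (HHd : forall z, (r < Cmod z)%R -> z <> z0 -> cdiff H z).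
  { intros z Hz Hz'.
    apply (cdiff_ext_loc (fun z => (F z - F z0) * (z0 / (z0 - z))) H z (Cmod (z - z0))).
    - apply Cmod_sub_pos; auto.
    - intros w Hw. symmetry. apply Hk. intros E. rewrite E, Cmod_sub_sym in Hw. lra.
    - apply (cdiff_mult (fun z => F z - F z0)).
      + apply cdiff_minus; [apply Hd; auto|apply cdiff_const].
      + apply Hkd; auto. }
  assert (HH0 : cmean H s = 0).
  { apply (cmean_exterior H r (Cmod z0) s 0); auto.
    - intros z Hz. destruct (Ceq_dec z z0) as [->|E].
      + apply ccont_mult; [apply ccont_const|exact Hq].
      + apply cdiff_ccont, HHd; auto.
    - intros z Hz Hz'. apply HHd; auto. intros E; apply Hz'; rewrite E; auto.
    - apply (lim_inf_ext (fun z => (F z - F z0) * (z0 * / z * / (z0 * / z - 1))) H 0 (Cmod z0)).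
      + intros z Hz. assert (z <> 0) by (apply Cmod_gt_0; lra).
        assert (z <> z0) by (intros E; rewrite E in Hz; lra).
        rewrite Hk by auto. f_equal. field. repeat split; auto; apply Csub_neq0; auto.
      + replace (RtoC 0) with ((L - F z0) * (z0 * 0 * / (z0 * 0 - 1))) at 1.
        2:{ replace (z0 * 0) with (RtoC 0) by ring. ring. }
        apply lim_inf_mult; [apply lim_inf_minus; auto; apply lim_inf_const|].
        apply (lim_inf_comp Cinv 0 (fun w => z0 * w * / (z0 * w - 1))); [apply lim_inf_inv_id|].
        assert (Hc : ccont (fun w => z0 * w) 0) by (apply ccont_mult; [apply ccont_const|apply ccont_id]).
        apply ccont_mult; auto. apply ccont_inv.
        * apply ccont_minus; [auto|apply ccont_const].
        * replace (z0 * 0 - 1) with (- (1)) by ring. intros E. injection E. lra. }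
  assert (Hkm : is_CI (fun t => z0 / (z0 - circ s t)) 0 1 (RtoC 1)).
  { rewrite <- (cmean_cauchy_kernel z0 s) by lra.
    apply (is_cmean (fun z => z0 / (z0 - z))); [lra|].
    intros z Hz. apply cdiff_ccont, Hkd. intros E. rewrite E in Hz. lra. }
  assert (HHm : is_CI (fun t => H (circ s t)) 0 1 (RtoC 0)).
  { rewrite <- HH0. apply is_cmean; [lra|]. intros z Hz. apply cdiff_ccont, HHd; [lra|].
    intros E. rewrite E in Hz. lra. }
  apply is_CI_unique.
  apply (is_CI_mult (F z0)) in Hkm.
  assert (Hsum := is_CI_plus _ _ _ _ _ _ HHm Hkm).
  replace (0 + F z0 * 1) with (F z0) in Hsum by ring.
  eapply is_CI_ext; [lra| |exact Hsum]. intros t _. cbv beta.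
  rewrite Hk; [ring|]. intros E. assert (Em := Cmod_circ s t ltac:(lra)). rewrite E in Em. lra.
Qed.

Lemma cauchy_kernel_bound s z0 t : (0 < s)%R -> (s < Cmod z0)%R ->
  (Cmod (z0 / (z0 - circ s t)) <= Cmod z0 / (Cmod z0 - s))%R.
Proof.
  intros Hs Hz0.
  assert (Hg := Cmod_sub_ge z0 (circ s t)). rewrite Cmod_circ in Hg by lra.
  rewrite Cmod_div by (apply Cmod_gt_0; lra).
  apply Rmult_le_compat_l; [apply Cmod_ge_0|]. apply Rinv_le_contravar; lra.
Qed.

Lemma is_cauchy_integral s z0 : (r < s)%R -> (s < Cmod z0)%R ->
  is_CI (fun t => F (circ s t) * (z0 / (z0 - circ s t))) 0 1 (F z0).
Proof.
  intros Hs Hz0. rewrite <- (cauchy_exterior s z0) by auto.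
  apply (is_cmean (fun z => F z * (z0 / (z0 - z)))); [lra|].
  intros z Hz. apply ccont_mult; [apply cdiff_ccont, Hd; lra|].
  apply ccont_div; [apply ccont_const| |].
  - apply ccont_minus; [apply ccont_const|apply ccont_id].
  - apply Csub_neq0. intros E. rewrite <- E in Hz. lra.
Qed.

Lemma cauchy_bound s z0 M : (r < s)%R -> (s < Cmod z0)%R ->
  (forall z, Cmod z = s -> (Cmod (F z) <= M)%R) ->
  (Cmod (F z0) <= M * (Cmod z0 / (Cmod z0 - s)))%R.
Proof.
  intros Hs Hz0 HM.
  apply Rle_trans with ((1 - 0) * (M * (Cmod z0 / (Cmod z0 - s))))%R; [|lra].
  eapply is_CI_bound_const; [lra| |apply (is_cauchy_integral s z0); auto].
  intros t _. cbv beta. rewrite Cmod_mult. apply Rmult_le_compat; try apply Cmod_ge_0.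
  - apply HM, Cmod_circ. lra.
  - apply cauchy_kernel_bound; lra.
Qed.
End Exterior.

(* Cauchy's bound loses a constant factor; applied to all powers of [F] the loss disappears. *)
Lemma max_principle_exterior F r L s z0 M : (0 < r)%R ->
  (forall z, (r < Cmod z)%R -> cdiff F z) -> lim_inf F L ->
  (r < s)%R -> (s < Cmod z0)%R ->
  (forall z, Cmod z = s -> (Cmod (F z) <= M)%R) -> (Cmod (F z0) <= M)%R.
Proof.
  intros Hr Hd HL Hs Hz0 HM.
  set (k := (Cmod z0 / (Cmod z0 - s))%R).
  assert (HM0 : (0 <= M)%R).
  { eapply Rle_trans; [|apply (HM (circ s 0)), Cmod_circ; lra]. apply Cmod_ge_0. }
  assert (Hn : forall n, (Cmod (F z0) ^ n <= M ^ n * k)%R).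
  { intros n. rewrite <- Cmod_pow.
    apply (cauchy_bound (fun z => F z ^ n) r (L ^ n) Hr); auto.
    - intros z Hz. apply cdiff_pow; auto.
    - apply lim_inf_pow; auto.
    - intros z Hz. rewrite Cmod_pow. apply pow_incr. split; [apply Cmod_ge_0|auto]. }
  apply Rnot_lt_le. intros Hlt.
  destruct (Req_dec M 0) as [E|E].
  - specialize (Hn 1%nat). rewrite E in Hn. simpl in Hn. lra.
  - set (x := (Cmod (F z0) / M)%R).
    assert (Hx : (1 < x)%R).
    { unfold x. apply Rlt_div_r; lra. }
    destruct (Pow_x_infinity x) with (b := (k + 1)%R) as [N HN].
    { rewrite Rabs_pos_eq; lra. }
    specialize (HN N (le_n _)). rewrite Rabs_pos_eq in HN by (apply pow_le; lra).
    specialize (Hn N).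
    assert (HMN : (0 < M ^ N)%R) by (apply pow_lt; lra).
    unfold x, Rdiv in HN. rewrite Rpow_mult_distr, pow_inv in HN.
    apply Rmult_ge_compat_r with (r := (M ^ N)%R) in HN; [|lra].
    rewrite Rmult_assoc, Rinv_l in HN by lra. nra.
Qed.

(* A function of modulus at most [1 + eta] whose mean is [1] is close to [1] in L^2;
   [th] comes from the inequality [|w| <= (|w|^2 / th + th) / 2]. *)
Lemma near_one_exterior F r s z0 eta th : (0 < r)%R ->
  (forall z, (r < Cmod z)%R -> cdiff F z) -> lim_inf F 1 ->
  (r < s)%R -> (s < Cmod z0)%R -> (0 < th)%R -> (0 <= eta)%R ->
  (forall z, Cmod z = s -> (Cmod (F z) <= 1 + eta)%R) ->
  (Cmod (F z0 - 1) <= (((1 + eta) ^ 2 - 1) / th + th) / 2 * (Cmod z0 / (Cmod z0 - s)))%R.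
Proof.
  intros Hr Hd HL Hs Hz0 Hth Heta HM.
  set (k := (Cmod z0 / (Cmod z0 - s))%R).
  assert (Hk : (0 <= k)%R) by (left; apply Rdiv_lt_0_compat; lra).
  assert (HI := is_cauchy_integral (fun z => F z - 1) r 0 Hr).
  specialize (HI ltac:(intros z Hz; apply cdiff_minus; [auto|apply cdiff_const])).
  specialize (HI ltac:(replace (RtoC 0) with (1 - 1) by ring; apply lim_inf_minus; [auto|apply lim_inf_const])).
  specialize (HI s z0 Hs Hz0). cbv beta in HI.
  assert (Hmean : is_CI (fun t => F (circ s t)) 0 1 (RtoC 1)).
  { rewrite <- (cmean_exterior F r (-1) s 1); auto.
    - apply is_cmean; [lra|]. intros z Hz. apply cdiff_ccont, Hd. lra.
    - intros z Hz. apply cdiff_ccont, Hd, Hz. }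
  apply is_CI_fst in Hmean. simpl in Hmean.
  (* On the circle |F - 1|^2 <= A - 2 Re F. After linearisation by [th] the bound is affine in Re F,
     whose mean is 1, so it is integrated exactly. *)
  set (A := ((1 + eta) ^ 2 + 1)%R).
  apply (is_CI_bound (fun t => (F (circ s t) - 1) * (z0 / (z0 - circ s t)))
     (fun t => ((A / th + th) / 2 * k) - (k / th) * fst (F (circ s t)))%R 0 1); auto; [lra| |].
  - intros t _. rewrite Cmod_mult.
    set (w := F (circ s t)).
    assert (Hw : (Cmod w <= 1 + eta)%R) by (apply HM, Cmod_circ; lra).
    apply Rle_trans with (((A - 2 * fst w) / th + th) / 2 * k)%R.
    + apply Rmult_le_compat; try apply Cmod_ge_0; [|apply cauchy_kernel_bound; lra].
      assert (E : (Cmod (w - 1) ^ 2 = Cmod w ^ 2 + 1 - 2 * fst w)%R).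
      { rewrite !Cmod2_alt. unfold Re, Im. destruct w as [x y]; simpl. ring. }
      assert (Hw2 : (Cmod w ^ 2 <= (1 + eta) ^ 2)%R) by (apply pow_incr; split; [apply Cmod_ge_0|auto]).
      set (v := Cmod (w - 1)) in *.
      assert (Hv : (v * th * 2 <= A - 2 * fst w + th * th)%R).
      { assert (0 <= (v - th) ^ 2)%R by apply pow2_ge_0. unfold A. nra. }
      apply Rmult_le_reg_r with (th * 2)%R; [lra|].
      replace (((A - 2 * fst w) / th + th) / 2 * (th * 2))%R with (A - 2 * fst w + th * th)%R by (field; lra).
      lra.
    + right. field. lra.
  - replace ((((1 + eta) ^ 2 - 1) / th + th) / 2 * k)%R
      with (minus (scal (1 - 0)%R ((A / th + th) / 2 * k)%R) (scal (k / th)%R 1%R)).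
    + apply (is_RInt_minus (V := R_NormedModule)).
      * apply (is_RInt_const (V := R_NormedModule)).
      * apply (is_RInt_scal (V := R_NormedModule)). exact Hmean.
    + unfold minus, plus, opp, scal; simpl; unfold mult; simpl. unfold A. field. lra.
Qed.

(** * Boettcher coordinates *)

Lemma iter_succ_r {A : Type} n (g : A -> A) x : iter n g (g x) = g (iter n g x).
Proof. induction n as [|n IH]; simpl; [reflexivity|rewrite IH; reflexivity]. Qed.

Lemma iter_add {A : Type} m n (g : A -> A) x : iter (m + n) g x = iter m g (iter n g x).
Proof. induction m as [|m IH]; simpl; [reflexivity|rewrite IH; reflexivity]. Qed.

(* [peval], retyped in Coquelicot's [C] like [cis]. *)
Definition poly (a : nat -> C) (d : nat) : C -> C := peval a d.

Lemma poly_succ a m z : poly a (S m) z = poly a m z + a (S m) * z ^ S m.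
Proof. reflexivity. Qed.

Lemma cdiff_poly a m z : cdiff (poly a m) z.
Proof.
  induction m as [|m IH]; [apply cdiff_const|].
  apply (cdiff_plus (poly a m) (fun z => a (S m) * z ^ S m)); auto.
  apply cdiff_mult; [apply cdiff_const|]. apply cdiff_pow, cdiff_id.
Qed.

Lemma poly_growth a m : exists B, (0 <= B)%R /\
  forall z, (1 <= Cmod z)%R -> (Cmod (poly a m z) <= B * Cmod z ^ m)%R.
Proof.
  induction m as [|m [B [HB IH]]].
  - exists (Cmod (a O)). split; [apply Cmod_ge_0|]. intros z Hz. simpl.
    rewrite Rmult_1_r. apply Rle_refl.
  - exists (B + Cmod (a (S m)))%R. split; [generalize (Cmod_ge_0 (a (S m))); lra|].
    intros z Hz. rewrite poly_succ.
    eapply Rle_trans; [apply Cmod_triangle|]. rewrite Cmod_mult, Cmod_pow, Rmult_plus_distr_r.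
    apply Rplus_le_compat_r. eapply Rle_trans; [apply IH; auto|].
    apply Rmult_le_compat_l; auto. apply Rle_pow; auto.
Qed.

(** * Escape to infinity under a monic polynomial *)

Section Poly.
Context (a : nat -> C) (d : nat) (Hd2 : (2 <= d)%nat) (Hmonic : monic_deg a d).
Let P := poly a d.
Let K := filled_julia a d.

(** The lower terms are O(|z|^(d-1)); multiplying by |z| avoids the exponent d - 1. *)
Lemma monic_growth : exists B, (0 <= B)%R /\
  forall z, (1 <= Cmod z)%R -> (Cmod (P z - z ^ d) * Cmod z <= B * Cmod z ^ d)%R.
Proof.
  destruct d as [|m] eqn:E; [lia|].
  destruct (poly_growth a m) as [B [HB H]]. exists B. split; auto. intros z Hz.
  unfold P. rewrite poly_succ, Hmonic.
  replace (poly a m z + C1 * z ^ S m - z ^ S m) with (poly a m z) by (change C1 with (RtoC 1); ring).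
  simpl. specialize (H z Hz). assert (0 <= Cmod z)%R by lra. nra.
Qed.

Lemma monic_lim : lim_inf (fun z => P z / z ^ d) 1.
Proof.
  destruct monic_growth as [B [HB H]]. intros e He.
  exists (Rmax 1 (B / e)). intros z Hz.
  assert (H1 := Rle_lt_trans _ _ _ (Rmax_l _ _) Hz).
  assert (H2 := Rle_lt_trans _ _ _ (Rmax_r _ _) Hz).
  assert (Hz0 : z <> 0) by (apply Cmod_gt_0; lra).
  assert (Hzd : z ^ d <> 0) by (apply Cpow_nz; auto).
  replace (P z / z ^ d - 1) with ((P z - z ^ d) / z ^ d) by (field; auto).
  rewrite Cmod_div, Cmod_pow by auto.
  assert (Hp : (0 < Cmod z ^ d)%R) by (apply pow_lt; lra).
  apply Rlt_div_l; auto.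
  specialize (H z ltac:(lra)).
  assert (B < e * Cmod z)%R.
  { apply Rmult_lt_compat_l with (r := e) in H2; auto.
    replace (e * (B / e))%R with B in H2 by (field; lra). lra. }
  apply Rmult_lt_reg_r with (Cmod z); [lra|]. nra.
Qed.

(** Far out |P z| >= |z|^d / 2 >= |z|^2 / 2, and this is at least 2 |z| once |z| >= 4. *)
Lemma escape_radius : exists R0, (4 <= R0)%R /\
  forall z, (R0 <= Cmod z)%R -> (2 * Cmod z <= Cmod (P z))%R.
Proof.
  destruct (monic_lim (/ 2)%R ltac:(lra)) as [M HM].
  exists (Rmax 4 (M + 1)). split; [apply Rmax_l|]. intros z Hz.
  assert (H1 := Rle_trans _ _ _ (Rmax_l _ _) Hz).
  assert (H2 := Rle_trans _ _ _ (Rmax_r _ _) Hz).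
  specialize (HM z ltac:(lra)).
  assert (Hz0 : z <> 0) by (apply Cmod_gt_0; lra).
  assert (Hzd : z ^ d <> 0) by (apply Cpow_nz; auto).
  assert (Hm : (/ 2 <= Cmod (P z / z ^ d))%R).
  { generalize (Cmod_sub_ge 1 (P z / z ^ d)). rewrite Cmod_sub_sym, Cmod_1. lra. }
  rewrite Cmod_div, Cmod_pow in Hm by auto.
  assert (Hp : (0 < Cmod z ^ d)%R) by (apply pow_lt; lra).
  apply Rle_div_r in Hm; [|lra].
  assert (Cmod z ^ 2 <= Cmod z ^ d)%R by (apply Rle_pow; auto; lra).
  simpl in *. nra.
Qed.

Lemma julia_inv z : K z <-> K (P z).
Proof.
  split; intros [M HM].
  - exists M. intros n. change (P z) with (peval a d z). rewrite iter_succ_r. apply (HM (S n)).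
  - exists (Rmax M (Cmod z)). intros [|n].
    + apply Rmax_r.
    + eapply Rle_trans; [|apply Rmax_l]. specialize (HM n).
      change (P z) with (peval a d z) in HM. rewrite iter_succ_r in HM. exact HM.
Qed.

Lemma julia_iter n z : K z <-> K (iter n P z).
Proof. induction n; simpl; [tauto|]. rewrite IHn. apply julia_inv. Qed.

Section Escape.
Context (R0 : R) (HR0 : (4 <= R0)%R) (Hesc : forall z, (R0 <= Cmod z)%R -> (2 * Cmod z <= Cmod (P z))%R).

Lemma escape_growth z n : (R0 <= Cmod z)%R -> (2 ^ n * Cmod z <= Cmod (iter n P z))%R.
Proof.
  intros Hz. induction n as [|n IH]; simpl; [lra|].
  assert (1 <= 2 ^ n)%R by (apply pow_R1_Rle; lra).
  assert (R0 <= Cmod (iter n P z))%R by nra.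
  generalize (Hesc _ H0). lra.
Qed.

Lemma escape_mono z m n : (m <= n)%nat -> (R0 <= Cmod (iter m P z))%R -> (R0 <= Cmod (iter n P z))%R.
Proof.
  intros Hmn Hm. replace n with ((n - m) + m)%nat by lia. rewrite iter_add.
  eapply Rle_trans; [apply Hm|]. eapply Rle_trans; [|apply escape_growth; auto].
  assert (1 <= 2 ^ (n - m))%R by (apply pow_R1_Rle; lra).
  assert (0 <= Cmod (iter m P z))%R by apply Cmod_ge_0. nra.
Qed.

Lemma escape_not_julia z : (R0 <= Cmod z)%R -> ~ K z.
Proof.
  intros Hz [M HM].
  destruct (Pow_x_infinity 2) with (b := (M + 1)%R) as [N HN]; [rewrite Rabs_pos_eq; lra|].
  specialize (HN N (le_n _)). rewrite Rabs_pos_eq in HN by (apply pow_le; lra).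
  assert (H := escape_growth z N Hz). specialize (HM N). change (Cmod (iter N P z) <= M)%R in HM.
  assert (0 < 2 ^ N)%R by (apply pow_lt; lra). nra.
Qed.

Lemma julia_bound z n : K z -> (Cmod (iter n P z) < R0)%R.
Proof.
  intros Hz. apply Rnot_le_lt. intros H. apply (escape_not_julia _ H), julia_iter, Hz.
Qed.

Lemma not_julia_escape z : ~ K z -> exists n, (R0 < Cmod (iter n P z))%R.
Proof.
  intros Hz. apply NNPP. intros Hno. apply Hz. exists R0. intros n.
  apply Rnot_lt_le. intros H. apply Hno. exists n. exact H.
Qed.
End Escape.

Lemma cdiff_iter n z : cdiff (iter n P) z.
Proof.
  induction n as [|n IH]; [apply cdiff_id|].
  apply (cdiff_comp (iter n P) P); auto. apply cdiff_poly.
Qed.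
End Poly.

(** * Growth of powers and roots of unity *)

Lemma cluster_mod (u : nat -> C) (p : C) (l : R) (v : nat -> R) :
  (forall eps N, (0 < eps)%R -> exists n, (N <= n)%nat /\ (Cmod (u n - p) < eps)%R) ->
  (forall eps, (0 < eps)%R -> exists N, forall n, (N <= n)%nat -> (Rabs (v n - l) < eps)%R) ->
  (forall n, Cmod (u n) = v n) -> Cmod p = l.
Proof.
  intros Hp Hv Hu. apply cond_eq. intros e He.
  destruct (Hv (e / 2)%R) as [N HN]; [lra|].
  destruct (Hp (e / 2)%R N) as [n [Hn Hn']]; [lra|].
  specialize (HN n Hn). rewrite <- Hu in HN. apply Rabs_def2 in HN.
  generalize (Cmod_sub_ge (u n) p), (Cmod_sub_ge p (u n)). rewrite (Cmod_sub_sym p).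
  intros. apply Rabs_def1; lra.
Qed.

Lemma lt_pow_exp (d n : nat) : (2 <= d)%nat -> (n < d ^ n)%nat.
Proof.
  intros Hd. induction n as [|n IH]; simpl; [lia|]. nia.
Qed.

Lemma pow_exp_unbounded (d N : nat) (x B : R) : (2 <= d)%nat -> (1 < x)%R ->
  (forall n, (N <= n)%nat -> (x ^ (d ^ n) <= B)%R) -> False.
Proof.
  intros Hd Hx H.
  destruct (Pow_x_infinity x) with (b := (B + 1)%R) as [M HM]; [rewrite Rabs_pos_eq; lra|].
  assert (HL := lt_pow_exp d (N + M) Hd).
  specialize (HM (d ^ (N + M))%nat ltac:(lia)). rewrite Rabs_pos_eq in HM by (apply pow_le; lra).
  specialize (H (N + M)%nat ltac:(lia)). lra.
Qed.

Lemma pow_near_one (d : nat) (q : R) : (1 < q)%R -> exists m, (1 < m)%R /\ (m ^ d < q)%R.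
Proof.
  intros Hq.
  destruct (derivable_continuous_pt _ _ (derivable_pt_pow d 1) (q - 1)%R ltac:(lra)) as [a [Ha H]].
  exists (1 + a / 2)%R. split; [lra|].
  specialize (H (1 + a / 2)%R). unfold dist in H; simpl in H. unfold Rdist in H.
  assert (Hl : (Rabs ((1 + a / 2) ^ d - 1 ^ d) < q - 1)%R).
  { apply H. split.
    - unfold D_x, no_cond. split; auto. lra.
    - replace (1 + a / 2 - 1)%R with (a / 2)%R by ring. rewrite Rabs_pos_eq; lra. }
  rewrite pow1 in Hl. apply Rabs_def2 in Hl. lra.
Qed.

(** The first order expansion of v^k at 1 with an explicit quadratic remainder; it allows angles
    near 0 to be handled without an argument function. *)
Lemma unit_pow_expand (v : C) (k : nat) : Cmod v = 1 ->
  (Cmod (v ^ k - 1 - RtoC (INR k) * (v - 1)) <= INR k ^ 2 * Cmod (v - 1) ^ 2)%R.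
Proof.
  intros Hv. induction k as [|k IH].
  - simpl. replace (1 - 1 - 0 * (v - 1)) with (RtoC 0) by ring. rewrite Cmod_0. lra.
  - replace (v ^ S k - 1 - RtoC (INR (S k)) * (v - 1))
      with (v * (v ^ k - 1 - RtoC (INR k) * (v - 1)) + RtoC (INR k) * ((v - 1) * (v - 1))).
    2:{ rewrite S_INR, RtoC_plus. simpl. ring. }
    eapply Rle_trans; [apply Cmod_triangle|].
    rewrite !Cmod_mult, Hv, Cmod_R, (Rabs_pos_eq (INR k)) by apply pos_INR.
    rewrite S_INR. assert (0 <= INR k)%R by apply pos_INR.
    assert (0 <= Cmod (v - 1) ^ 2)%R by apply pow2_ge_0. simpl in *. nra.
Qed.

(** With x = m |w - 1| the expansion gives x <= x^2, so x = 0 or x >= 1: the m-th roots of unity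
    other than 1 stay at distance at least 1/m from 1. *)
Lemma unit_pow_one (w : C) (m : nat) : (0 < m)%nat -> Cmod w = 1 -> w ^ m = 1 ->
  (INR m * Cmod (w - 1) < 1)%R -> w = 1.
Proof.
  intros Hm Hw Hwm Hsm.
  assert (H := unit_pow_expand w m Hw). rewrite Hwm in H.
  replace (1 - 1 - RtoC (INR m) * (w - 1)) with (- (RtoC (INR m) * (w - 1))) in H by ring.
  rewrite Cmod_opp, Cmod_mult, Cmod_R, Rabs_pos_eq in H by apply pos_INR.
  assert (HM : (0 < INR m)%R) by (apply lt_0_INR; auto).
  assert (Hx := Cmod_ge_0 (w - 1)). set (x := (INR m * Cmod (w - 1))%R) in *.
  assert (x <= x * x)%R by (eapply Rle_trans; [exact H|right; unfold x; ring]).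
  assert (Hx0 : x = 0) by (assert (0 <= x)%R by (unfold x; nra); nra).
  assert (E : Cmod (w - 1) = 0).
  { unfold x in Hx0. apply Rmult_integral in Hx0. destruct Hx0; lra. }
  apply Cmod_eq_0 in E. replace w with (w - 1 + 1) by ring. rewrite E. ring.
Qed.

(* Multiplication of angles by [d] is expanding near [1]. *)
Lemma unit_expanding (v : C) (d : nat) (e : R) : (2 <= d)%nat -> Cmod v = 1 ->
  (INR d ^ 2 * e <= / 2)%R -> (forall j, (Cmod (v ^ (d ^ j) - 1) <= e)%R) -> v = 1.
Proof.
  intros Hd Hv He H.
  assert (Hd' : (2 <= INR d)%R) by (apply (le_INR 2); auto).
  (* The quadratic error is at most half of |w - 1|, so each d-th power multiplies the distance to 1
     by at least d - 1/2 >= 3/2. *)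
  assert (Hg : forall j, ((3 / 2) ^ j * Cmod (v - 1) <= Cmod (v ^ (d ^ j) - 1))%R).
  { induction j as [|j IH]; [rewrite Nat.pow_0_r, Cpow_1_r; simpl; lra|].
    rewrite Nat.pow_succ_r', Nat.mul_comm, Cpow_mult_r.
    set (w := v ^ (d ^ j)) in *.
    assert (Hw : Cmod w = 1) by (unfold w; rewrite Cmod_pow, Hv, pow1; auto).
    assert (Hx := unit_pow_expand w d Hw).
    assert (Hle := H j). fold w in Hle.
    assert (Hge := Cmod_sub_ge (RtoC (INR d) * (w - 1)) (- (w ^ d - 1 - RtoC (INR d) * (w - 1)))).
    rewrite Cmod_opp, Cmod_mult, Cmod_R, (Rabs_pos_eq (INR d)) in Hge by lra.
    replace (RtoC (INR d) * (w - 1) - - (w ^ d - 1 - RtoC (INR d) * (w - 1))) with (w ^ d - 1) in Hge by ring.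
    set (x := Cmod (w - 1)) in *. assert (Hx0 : (0 <= x)%R) by apply Cmod_ge_0.
    assert (INR d ^ 2 * x ^ 2 <= / 2 * x)%R.
    { replace (INR d ^ 2 * x ^ 2)%R with ((INR d ^ 2 * x) * x)%R by ring.
      apply Rmult_le_compat_r; auto. eapply Rle_trans; [|apply He].
      apply Rmult_le_compat_l; auto. apply pow2_ge_0. }
    simpl in *. nra. }
  destruct (Req_dec (Cmod (v - 1)) 0) as [E|E].
  - apply Cmod_eq_0 in E. replace v with (v - 1 + 1) by ring. rewrite E. ring.
  - exfalso. assert (Hx := Cmod_ge_0 (v - 1)).
    destruct (Pow_x_infinity (3 / 2)) with (b := ((e + 1) / Cmod (v - 1))%R) as [N HN]; [rewrite Rabs_pos_eq; lra|].
    specialize (HN N (le_n _)). rewrite Rabs_pos_eq in HN by (apply pow_le; lra).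
    specialize (Hg N). specialize (H N).
    apply Rmult_ge_compat_r with (r := Cmod (v - 1)) in HN; [|lra].
    unfold Rdiv in HN at 2. rewrite Rmult_assoc, Rinv_l in HN by auto. lra.
Qed.

Section Bottcher.
Context (a : nat -> C) (d : nat) (Hd2 : (2 <= d)%nat) (Hmonic : monic_deg a d).
Context (phi : C -> C) (sigma : R -> C) (Hphi : riemann_map_ext (filled_julia a d) phi sigma).
Let P := poly a d.
Let K := filled_julia a d.

Lemma phi_out z : (1 < Cmod z)%R -> ~ K (phi z).
Proof. apply Hphi. Qed.

Lemma phi_surj w : ~ K w -> exists z, (1 < Cmod z)%R /\ phi z = w.
Proof. apply Hphi. Qed.

Lemma phi_inj z w : (1 < Cmod z)%R -> (1 < Cmod w)%R -> phi z = phi w -> z = w.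
Proof. apply Hphi. Qed.

Lemma phi_diff z : (1 < Cmod z)%R -> cdiff phi z.
Proof. apply Hphi. Qed.

Lemma phi_lim : exists c : R, (0 < c)%R /\ lim_inf (fun z => phi z / z) (RtoC c).
Proof. apply Hphi. Qed.

Lemma sigma_bdry t : in_boundary K (sigma t).
Proof. apply Hphi. Qed.

Lemma sigma_ext t e : (0 < e)%R -> exists dl, (0 < dl)%R /\
  forall z, (1 < Cmod z)%R -> (Cmod (z - cis t) < dl)%R -> (Cmod (phi z - sigma t) < e)%R.
Proof. apply Hphi. Qed.

Lemma iter_phi_diff n z : (1 < Cmod z)%R -> cdiff (fun z => iter n P (phi z)) z.
Proof.
  intros Hz. apply (cdiff_comp phi (iter n P)); [apply phi_diff, Hz|apply cdiff_iter].
Qed.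

Lemma phi_cluster (u : nat -> C) (t : R) (n : nat) :
  (forall k, (1 < Cmod (u k))%R) ->
  (forall eps N, (0 < eps)%R -> exists k, (N <= k)%nat /\ (Cmod (u k - cis t) < eps)%R) ->
  forall eps N, (0 < eps)%R -> exists k, (N <= k)%nat /\
     (Cmod (iter n P (phi (u k)) - iter n P (sigma t)) < eps)%R.
Proof.
  intros Hu Hc e N He.
  destruct (cdiff_ccont _ _ (cdiff_iter a d n (sigma t)) e He) as [d1 [Hd1 H1]].
  destruct (sigma_ext t d1 Hd1) as [d2 [Hd2' H2]].
  destruct (Hc d2 N Hd2') as [k [Hk Hk']]. exists k. split; auto.
Qed.

(** * Bounds on iterates near the unit circle and away from it *)

Section Radius.
Context (R0 : R) (HR0 : (4 <= R0)%R) (Hesc : forall z, (R0 <= Cmod z)%R -> (2 * Cmod z <= Cmod (P z))%R).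

(** Violations ever closer to the circle would cluster at some [cis t], where [phi] tends to
    [sigma t] in [K], whose orbit stays below [R0]. The width [rho] depends on [n]. *)
Lemma boundary_bound n : exists rho, (1 < rho)%R /\
  forall z, (1 < Cmod z < rho)%R -> (Cmod (iter n P (phi z)) <= R0)%R.
Proof.
  apply NNPP. intros Hno.
  assert (Hseq : forall k : nat, exists z, (1 < Cmod z < 1 + / (INR k + 1))%R /\
     (R0 < Cmod (iter n P (phi z)))%R).
  { intros k. apply NNPP. intros Hk. apply Hno. exists (1 + / (INR k + 1))%R. split.
    - generalize (inv_INR_pos k). lra.
    - intros z Hz. apply Rnot_lt_le. intros Hl. apply Hk. exists z. auto. }
  destruct (choice _ Hseq) as [u Hu].
  destruct (bounded_cluster u 2) as [p Hp].
  { intros k. destruct (Hu k) as [[_ H] _]. generalize (inv_INR_pos k). lra. }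
  assert (Hp1 : Cmod p = 1).
  { apply (cluster_mod u p 1 (fun k => Cmod (u k))); auto.
    intros e He. destruct (inv_INR_small e He) as [N HN]. exists N. intros k Hk.
    destruct (Hu k) as [[H1 H2] _]. rewrite Rabs_pos_eq by lra. specialize (HN k Hk). lra. }
  destruct (unit_circle_param p Hp1) as [t Ht]. subst p.
  assert (Hb : (Cmod (iter n P (sigma t)) < R0)%R).
  { apply (julia_bound a d R0 HR0 Hesc). apply sigma_bdry. }
  destruct (phi_cluster u t n (fun k => proj1 (proj1 (Hu k))) Hp
    (R0 - Cmod (iter n P (sigma t)))%R O) as [k [_ Hk]]; [lra|].
  generalize (Cmod_sub_ge (iter n P (phi (u k))) (iter n P (sigma t))), (proj2 (Hu k)). lra.
Qed.

Lemma phi_large : exists M, forall z, (M <= Cmod z)%R -> (1 < Cmod z)%R -> (R0 <= Cmod (phi z))%R.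
Proof.
  destruct phi_lim as [c [Hc HL]]. destruct (HL (c / 2)%R) as [M HM]; [lra|].
  exists (Rmax (M + 1) (2 * R0 / c)). intros z Hz Hz1.
  assert (H1 := Rle_trans _ _ _ (Rmax_l _ _) Hz). assert (H2 := Rle_trans _ _ _ (Rmax_r _ _) Hz).
  specialize (HM z ltac:(lra)).
  assert (z <> 0) by (apply Cmod_gt_0; lra).
  generalize (Cmod_sub_ge c (phi z / z)). rewrite Cmod_sub_sym, Cmod_R, Rabs_pos_eq, Cmod_div by (auto; lra).
  intros H3. assert (H4 : (c / 2 <= Cmod (phi z) / Cmod z)%R) by lra.
  apply Rle_div_r in H4; [|lra].
  apply Rmult_le_compat_l with (r := (c / 2)%R) in H2; [|lra].
  replace (c / 2 * (2 * R0 / c))%R with R0 in H2 by (field; lra). lra.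
Qed.

(** [phi_large] confines slow points to a bounded annulus. A cluster point of ever slower ones has
    its image outside [K], hence escapes strictly at some time, and so do its neighbours. *)
Lemma uniform_escape e : (0 < e)%R -> exists N, forall n z, (N <= n)%nat -> (1 + e <= Cmod z)%R ->
  (R0 <= Cmod (iter n P (phi z)))%R.
Proof.
  intros He. destruct phi_large as [M HM].
  apply NNPP. intros Hno.
  assert (Hseq : forall k : nat, exists z, (1 + e <= Cmod z <= M)%R /\
     forall j, (j <= k)%nat -> (Cmod (iter j P (phi z)) <= R0)%R).
  { intros k. apply NNPP. intros Hk. apply Hno. exists k. intros n z Hn Hz.
    apply Rnot_lt_le. intros Hl. apply Hk. exists z.
    assert (Hj : forall j, (j <= n)%nat -> (Cmod (iter j P (phi z)) < R0)%R).
    { intros j Hj. apply Rnot_le_lt. intros Hle.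
      apply (escape_mono a d Hd2 R0 HR0 Hesc _ _ _ Hj) in Hle. exact (Rlt_not_le _ _ Hl Hle). }
    split; [split; auto|].
    - apply Rnot_lt_le. intros HMz. assert (H0 := Hj O ltac:(lia)). simpl in H0.
      generalize (HM z ltac:(lra) ltac:(lra)). lra.
    - intros j Hjk. left. apply Hj. lia. }
  destruct (choice _ Hseq) as [u Hu].
  destruct (bounded_cluster u M) as [p Hp]; [intros n; apply Hu|].
  assert (Hp1 : (1 + e <= Cmod p)%R).
  { apply Rnot_lt_le. intros Hl.
    destruct (Hp (1 + e - Cmod p)%R O) as [n [_ Hn]]; [lra|].
    generalize (Cmod_sub_ge (u n) p), (proj1 (Hu n)). lra. }
  destruct (not_julia_escape a d R0 (phi p)) as [j Hj]; [apply phi_out; lra|].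
  destruct (cdiff_ccont _ _ (iter_phi_diff j p ltac:(lra)) (Cmod (iter j P (phi p)) - R0)%R) as [dl [Hdl H]].
  { unfold P. lra. }
  destruct (Hp dl j Hdl) as [n [Hn Hn']]. specialize (H (u n) Hn').
  destruct (Hu n) as [_ Hun]. specialize (Hun j Hn).
  generalize (Cmod_sub_ge (iter j P (phi p)) (iter j P (phi (u n)))). rewrite Cmod_sub_sym. lra.
Qed.
End Radius.

Lemma goes_inf_comp (G : C -> C) (L c : C) (w : C -> C) (N : nat) : (1 <= N)%nat -> c <> 0 ->
  lim_inf G L -> lim_inf (fun z => w z / z ^ N) c -> lim_inf (fun z => G (w z)) L.
Proof.
  intros HN Hc HG Hw e He. destruct (HG e He) as [M HM].
  assert (Hc' : (0 < Cmod c)%R) by (apply Cmod_gt_0; auto).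
  destruct (Hw (Cmod c / 2)%R) as [M' HM']; [lra|].
  exists (Rmax 1 (Rmax M' (2 * M / Cmod c))). intros z Hz.
  assert (H1 := Rle_lt_trans _ _ _ (Rmax_l _ _) Hz).
  assert (H2 := Rle_lt_trans _ _ _ (Rle_trans _ _ _ (Rmax_l _ _) (Rmax_r _ _)) Hz).
  assert (H3 := Rle_lt_trans _ _ _ (Rle_trans _ _ _ (Rmax_r _ _) (Rmax_r _ _)) Hz).
  apply HM. specialize (HM' z H2).
  assert (z <> 0) by (apply Cmod_gt_0; lra).
  assert (z ^ N <> 0) by (apply Cpow_nz; auto).
  generalize (Cmod_sub_ge c (w z / z ^ N)). rewrite Cmod_sub_sym, Cmod_div, Cmod_pow by auto. intros H4.
  assert (HzN : (Cmod z <= Cmod z ^ N)%R).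
  { rewrite <- (pow_1 (Cmod z)) at 1. apply Rle_pow; auto. lra. }
  assert (H5 : (Cmod c / 2 < Cmod (w z) / Cmod z ^ N)%R) by lra.
  apply Rlt_div_r in H5; [|lra].
  apply Rmult_lt_compat_l with (r := (Cmod c / 2)%R) in H3; [|lra].
  replace (Cmod c / 2 * (2 * M / Cmod c))%R with M in H3 by (field; lra). nra.
Qed.

(** Compares P^n(phi z) with its size if [phi] were the inverse of Boettcher's coordinate. A
    quotient is used so that no root of order d^n has to be taken. *)
Definition quot (n : nat) (z : C) : C := iter n P (phi z) / z ^ (d ^ n).

Lemma dpow_pos n : (1 <= d ^ n)%nat.
Proof. generalize (lt_pow_exp d n Hd2). lia. Qed.

Lemma quot_diff n z : (1 < Cmod z)%R -> cdiff (quot n) z.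
Proof.
  intros Hz. apply cdiff_div; [apply iter_phi_diff; auto|apply cdiff_pow, cdiff_id|].
  apply Cpow_nz, Cmod_gt_0. lra.
Qed.

Lemma quot_lim (c : C) n : c <> 0 -> lim_inf (fun z => phi z / z) c -> lim_inf (quot n) (c ^ (d ^ n)).
Proof.
  intros Hc HL. induction n as [|n IH].
  - simpl. rewrite Cmult_1_r. unfold quot. simpl.
    apply (lim_inf_ext (fun z => phi z / z) _ c 0); auto. intros z _. rewrite Cmult_1_r. reflexivity.
  - assert (H1 : lim_inf (fun z => P (iter n P (phi z)) / iter n P (phi z) ^ d) 1).
    { apply (goes_inf_comp (fun w => P w / w ^ d) 1 (c ^ (d ^ n)) (fun z => iter n P (phi z)) (d ^ n)); auto.
      - apply dpow_pos.
      - apply Cpow_nz; auto.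
      - apply monic_lim; auto. }
    assert (H2 := lim_inf_pow _ _ d IH).
    assert (H3 := lim_inf_mult _ _ _ _ H1 H2).
    rewrite Nat.pow_succ_r', Nat.mul_comm, Cpow_mult_r.
    replace ((c ^ (d ^ n)) ^ d) with (1 * (c ^ (d ^ n)) ^ d) by ring.
    destruct escape_radius with (a := a) (d := d) as [R0 [HR0 Hesc]]; auto.
    destruct (phi_large R0) as [M HM].
    apply (lim_inf_ext _ _ _ (Rmax 1 M)) with (2 := H3). intros z Hz.
    assert (Hz1 := Rle_lt_trans _ _ _ (Rmax_l _ _) Hz). assert (Hz2 := Rle_lt_trans _ _ _ (Rmax_r _ _) Hz).
    assert (z <> 0) by (apply Cmod_gt_0; lra).
    assert (Hw : iter n P (phi z) <> 0).
    { apply Cmod_gt_0. apply Rlt_le_trans with R0; [lra|].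
      apply (escape_mono a d Hd2 R0 HR0 Hesc (phi z) 0 n); [lia|]. apply HM; lra. }
    unfold quot. simpl iter. unfold Cdiv at 2. rewrite Nat.pow_succ_r', Nat.mul_comm, Cpow_mult_r.
    rewrite Cpow_mult_l, Cpow_inv by (apply Cpow_nz; auto).
    field. split; repeat apply Cpow_nz; auto.
Qed.

(** The maximum principle for [quot n], from a circle so near the unit circle that [boundary_bound]
    applies. The resulting constant [R0] is the same for all [n]. *)
Lemma upper_bound R0 : (4 <= R0)%R -> (forall z, (R0 <= Cmod z)%R -> (2 * Cmod z <= Cmod (P z))%R) ->
  forall n z, (1 < Cmod z)%R -> (Cmod (iter n P (phi z)) <= R0 * Cmod z ^ (d ^ n))%R.
Proof.
  intros HR0 Hesc n z Hz.
  destruct (boundary_bound R0 HR0 Hesc n) as [rho [Hrho Hb]].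
  destruct phi_lim as [c [Hc HL]].
  assert (Hc0 : RtoC c <> 0) by (intros E; apply RtoC_inj in E; lra).
  set (s := ((1 + Rmin rho (Cmod z)) / 2)%R).
  assert (Hm1 : (1 < Rmin rho (Cmod z))%R) by (apply Rmin_glb_lt; lra).
  assert (Hm2 := Rmin_l rho (Cmod z)). assert (Hm3 := Rmin_r rho (Cmod z)).
  assert (Hq : (Cmod (quot n z) <= R0)%R).
  { apply (max_principle_exterior (quot n) 1 (RtoC c ^ (d ^ n)) s); try (unfold s; lra).
    - intros w Hw. apply quot_diff; auto.
    - apply quot_lim; auto.
    - intros w Hw. assert (Hw1 : (1 < Cmod w < rho)%R) by (rewrite Hw; unfold s; lra).
      assert (w <> 0) by (apply Cmod_gt_0; lra).
      unfold quot. rewrite Cmod_div, Cmod_pow by (apply Cpow_nz; auto).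
      specialize (Hb w Hw1).
      assert (H1 : (1 <= Cmod w ^ (d ^ n))%R) by (apply pow_R1_Rle; lra).
      apply Rle_div_l; [lra|]. nra. }
  assert (z <> 0) by (apply Cmod_gt_0; lra).
  unfold quot in Hq. rewrite Cmod_div, Cmod_pow in Hq by (apply Cpow_nz; auto).
  assert (H1 : (1 <= Cmod z ^ (d ^ n))%R) by (apply pow_R1_Rle; lra).
  apply Rle_div_l in Hq; [exact Hq|lra].
Qed.

(** The inverse of [quot n] is holomorphic only where the orbit has escaped, so the circle is kept
    at a fixed radius s > 1. The price is the factor s^(d^n), affordable because s may be taken as
    close to 1 as desired. *)
Lemma lower_bound s : (1 < s)%R -> exists N, forall n z, (N <= n)%nat -> (s < Cmod z)%R ->
  (Cmod z ^ (d ^ n) <= s ^ (d ^ n) * Cmod (iter n P (phi z)))%R.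
Proof.
  intros Hs.
  destruct (escape_radius a d Hd2 Hmonic) as [R0 [HR0 Hesc]].
  destruct (uniform_escape R0 HR0 Hesc ((s - 1) / 2)) as [N HN]; [lra|].
  exists N. intros n z Hn Hz.
  destruct phi_lim as [c [Hc HL]].
  assert (Hc0 : RtoC c <> 0) by (intros E; apply RtoC_inj in E; lra).
  assert (Hnz : forall w, (1 + (s - 1) / 2 <= Cmod w)%R -> iter n P (phi w) <> 0).
  { intros w Hw. apply Cmod_gt_0. generalize (HN n w Hn Hw). lra. }
  assert (Hq : (Cmod (z ^ (d ^ n) / iter n P (phi z)) <= s ^ (d ^ n))%R).
  { apply (max_principle_exterior (fun z => z ^ (d ^ n) / iter n P (phi z)) (1 + (s - 1) / 2)
      (/ (RtoC c ^ (d ^ n))) s); try lra.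
    - intros w Hw. apply cdiff_div; [apply cdiff_pow, cdiff_id|apply iter_phi_diff; lra|].
      apply Hnz. lra.
    - apply (lim_inf_ext (fun z => / quot n z) _ _ (1 + (s - 1) / 2)).
      + intros w Hw. unfold quot. field. split; [apply Hnz; lra|].
        apply Cpow_nz, Cmod_gt_0. lra.
      + apply (lim_inf_comp (quot n) _ Cinv); [apply quot_lim; auto|].
        apply ccont_inv_at, Cpow_nz; auto.
    - intros w Hw. rewrite Cmod_div, Cmod_pow, Hw by (apply Hnz; lra).
      assert (H1 := HN n w Hn ltac:(lra)). assert (0 < s ^ (d ^ n))%R by (apply pow_lt; lra).
      apply Rle_div_l; [lra|]. nra. }
  assert (Hz0 := HN n z Hn ltac:(lra)).
  rewrite Cmod_div, Cmod_pow in Hq by (apply Hnz; lra).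
  apply Rle_div_l in Hq; [exact Hq|lra].
Qed.

(** Here P^n(phi y) = P^(n+1)(phi z). If one modulus exceeded the other by a ratio q > 1, the upper
    bound for one point and the lower bound for the other would keep the powers of order d^n of a
    number greater than 1 below [R0]. *)
Lemma conj_modulus z y : (1 < Cmod z)%R -> (1 < Cmod y)%R -> phi y = P (phi z) ->
  Cmod y = (Cmod z ^ d)%R.
Proof.
  intros Hz Hy E.
  destruct (escape_radius a d Hd2 Hmonic) as [R0 [HR0 Hesc]].
  assert (HU := upper_bound R0 HR0 Hesc).
  assert (Hzd : (1 <= Cmod z ^ d)%R) by (apply pow_R1_Rle; lra).
  assert (Eit : forall n, iter n P (phi y) = iter (S n) P (phi z)).
  { intros n. rewrite E, iter_succ_r. reflexivity. }
  apply Rle_antisym; apply Rnot_lt_le; intros Hlt.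
  - set (q := (Cmod y / Cmod z ^ d)%R).
    assert (Eq : (q * Cmod z ^ d = Cmod y)%R) by (unfold q; field; lra).
    assert (Hq : (1 < q)%R) by nra.
    set (s := ((1 + q) / 2)%R).
    destruct (lower_bound s) as [N HN]; [unfold s; lra|].
    apply (pow_exp_unbounded d N (q / s) R0 Hd2).
    { apply Rlt_div_r; unfold s; lra. }
    intros n Hn. specialize (HN n y Hn ltac:(unfold s; nra)).
    rewrite Eit in HN. specialize (HU (S n) z Hz).
    rewrite Nat.pow_succ_r', pow_mult in HU.
    rewrite <- Eq, Rpow_mult_distr in HN.
    set (X := ((Cmod z ^ d) ^ (d ^ n))%R) in *.
    assert (HX : (0 < X)%R) by (apply pow_lt; lra).
    assert (HS : (0 < s ^ (d ^ n))%R) by (apply pow_lt; unfold s; lra).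
    unfold Rdiv. rewrite Rpow_mult_distr, pow_inv.
    apply Rmult_le_reg_r with (s ^ (d ^ n))%R; auto. rewrite Rmult_assoc, Rinv_l, Rmult_1_r by lra.
    apply Rmult_le_reg_r with X; auto. nra.
  - set (q := (Cmod z ^ d / Cmod y)%R).
    assert (Eq : (q * Cmod y = Cmod z ^ d)%R) by (unfold q; field; lra).
    assert (Hq : (1 < q)%R) by nra.
    (* The lower bound is used here at time n + 1, where it costs s^(d^(n+1)), so s^d < q is
       required and not only s < q. *)
    destruct (pow_near_one d q Hq) as [m [Hm Hmq]].
    set (s := Rmin m ((1 + Cmod z) / 2)).
    assert (Hs1 : (1 < s)%R) by (apply Rmin_glb_lt; lra).
    assert (Hsm : (s ^ d < q)%R).
    { eapply Rle_lt_trans; [apply pow_incr; split; [lra|apply Rmin_l]|exact Hmq]. }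
    assert (Hsz : (s < Cmod z)%R) by (eapply Rle_lt_trans; [apply Rmin_r|lra]).
    assert (Hsd : (1 <= s ^ d)%R) by (apply pow_R1_Rle; lra).
    destruct (lower_bound s Hs1) as [N HN].
    apply (pow_exp_unbounded d N (q / s ^ d) R0 Hd2).
    { apply Rlt_div_r; lra. }
    intros n Hn. specialize (HN (S n) z ltac:(lia) Hsz).
    specialize (HU n y Hy). rewrite Eit in HU.
    rewrite Nat.pow_succ_r', !pow_mult, <- Eq, Rpow_mult_distr in HN.
    set (X := (Cmod y ^ (d ^ n))%R) in *.
    assert (HX : (0 < X)%R) by (apply pow_lt; lra).
    unfold Rdiv. rewrite Rpow_mult_distr, pow_inv.
    set (S0 := ((s ^ d) ^ (d ^ n))%R) in *.
    assert (HS : (0 < S0)%R) by (apply pow_lt; lra).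
    apply Rmult_le_reg_r with S0; auto. rewrite Rmult_assoc, Rinv_l, Rmult_1_r by lra.
    apply Rmult_le_reg_r with X; auto. nra.
Qed.

Lemma conj_modulus_iter n z : (1 < Cmod z)%R ->
  exists y, (1 < Cmod y)%R /\ phi y = iter n P (phi z) /\ Cmod y = (Cmod z ^ (d ^ n))%R.
Proof.
  intros Hz. induction n as [|n [y [Hy [Ey Em]]]].
  - exists z. simpl. repeat split; auto. lra.
  - destruct (phi_surj (P (phi y))) as [y' [Hy' Ey']].
    { intros HK. apply (phi_out y Hy). apply (julia_inv a d). exact HK. }
    exists y'. repeat split; auto.
    + rewrite Ey', Ey. reflexivity.
    + rewrite (conj_modulus y y'); auto. rewrite Em, <- pow_mult. f_equal. simpl. lia.
Qed.

(** P^n(phi z) is some phi y with |y| = |z|^(d^n), so |quot n z| = |phi y / y|, which is near c as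
    soon as y is large. *)
Lemma quot_modulus c : (0 < c)%R -> lim_inf (fun z => phi z / z) (RtoC c) ->
  forall rho eta, (1 < rho)%R -> (0 < eta)%R -> exists N, forall n z, (N <= n)%nat ->
    (rho <= Cmod z)%R -> (Rabs (Cmod (quot n z) - c) < eta)%R.
Proof.
  intros Hc HL rho eta Hrho Heta.
  destruct (HL eta Heta) as [M HM].
  destruct (Pow_x_infinity rho) with (b := (M + 1)%R) as [N HN]; [rewrite Rabs_pos_eq; lra|].
  exists N. intros n z Hn Hz.
  destruct (conj_modulus_iter n z) as [y [Hy [Ey Em]]]; [lra|].
  assert (z <> 0) by (apply Cmod_gt_0; lra). assert (y <> 0) by (apply Cmod_gt_0; lra).
  assert (HMy : (M < Cmod y)%R).
  { rewrite Em. assert (Hd := lt_pow_exp d n Hd2).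
    specialize (HN (d ^ n)%nat ltac:(lia)). rewrite Rabs_pos_eq in HN by (apply pow_le; lra).
    assert (rho ^ (d ^ n) <= Cmod z ^ (d ^ n))%R by (apply pow_incr; lra). lra. }
  specialize (HM y HMy).
  unfold quot. rewrite Cmod_div, Cmod_pow, <- Em, <- Ey, <- Cmod_div by (auto; apply Cpow_nz; auto).
  replace c with (Cmod (RtoC c)) by (rewrite Cmod_R, Rabs_pos_eq; lra).
  generalize (Cmod_sub_ge (phi y / y) c), (Cmod_sub_ge c (phi y / y)). rewrite (Cmod_sub_sym c).
  intros. apply Rabs_def1; lra.
Qed.

(** [quot 1] tends to c^d, while its modulus is that of phi y / y and tends to c. Hence c^d = c, and
    c > 0 leaves c = 1; that P is monic enters through [quot_lim]. *)
Lemma phi_tangent : lim_inf (fun z => phi z / z) 1.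
Proof.
  destruct phi_lim as [c [Hc HL]].
  assert (Hc0 : RtoC c <> 0) by (intros E; apply RtoC_inj in E; lra).
  assert (E : (c ^ d = c)%R).
  { apply cond_eq. intros e He.
    assert (H1 := quot_lim (RtoC c) 1 Hc0 HL). rewrite Nat.pow_1_r in H1.
    destruct (H1 (e / 2)%R) as [M1 HM1]; [lra|].
    destruct (HL (e / 2)%R) as [M2 HM2]; [lra|].
    set (x := (2 + Rmax 0 (Rmax M1 M2))%R).
    assert (G0 := Rmax_l 0 (Rmax M1 M2)).
    assert (G1 := Rle_trans _ _ _ (Rmax_l M1 M2) (Rmax_r 0 (Rmax M1 M2))).
    assert (G2 := Rle_trans _ _ _ (Rmax_r M1 M2) (Rmax_r 0 (Rmax M1 M2))).
    assert (Hx : Cmod (RtoC x) = x) by (rewrite Cmod_R, Rabs_pos_eq; unfold x; lra).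
    destruct (conj_modulus_iter 1 (RtoC x)) as [y [Hy [Ey Em]]]; [rewrite Hx; unfold x; lra|].
    rewrite Nat.pow_1_r, Hx in Em.
    assert (Hxy : (x <= Cmod y)%R).
    { rewrite Em. rewrite <- (pow_1 x) at 1. apply Rle_pow; [unfold x; lra|lia]. }
    specialize (HM1 (RtoC x) ltac:(rewrite Hx; unfold x; lra)).
    specialize (HM2 y ltac:(unfold x in *; lra)).
    assert (Hy0 : y <> 0) by (apply Cmod_gt_0; lra).
    assert (Hx0 : RtoC x <> 0) by (apply Cmod_gt_0; rewrite Hx; unfold x; lra).
    assert (Eq : Cmod (quot 1 (RtoC x)) = Cmod (phi y / y)).
    { unfold quot. rewrite !Cmod_div, Cmod_pow, Hx, Nat.pow_1_r, <- Em, Ey by (auto; apply Cpow_nz; auto). reflexivity. }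
    generalize (Cmod_sub_ge (quot 1 (RtoC x)) (RtoC c ^ d)), (Cmod_sub_ge (RtoC c ^ d) (quot 1 (RtoC x))),
      (Cmod_sub_ge (phi y / y) c), (Cmod_sub_ge c (phi y / y)).
    rewrite (Cmod_sub_sym (RtoC c ^ d)), (Cmod_sub_sym c), Eq, Cmod_pow, Cmod_R, Rabs_pos_eq by lra.
    intros. apply Rabs_def1; lra. }
  assert (c = 1)%R.
  { destruct d as [|[|k]]; [lia|lia|]. simpl in E.
    assert (E1 : (c ^ S k = 1)%R) by (simpl; apply Rmult_eq_reg_l with c; lra).
    destruct (Rtotal_order c 1) as [Hl|[->|Hg]]; auto; exfalso.
    - assert (c ^ S k < 1)%R by (apply pow_lt_1_compat; lra || lia). lra.
    - assert (1 < c ^ S k)%R by (apply Rlt_pow_R1; lra || lia). lra. }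
  subst c. exact HL.
Qed.

Lemma quot_near_one rho e : (1 < rho)%R -> (0 < e)%R -> exists N, forall n z, (N <= n)%nat ->
  (rho <= Cmod z)%R -> (Cmod (quot n z - 1) <= e)%R.
Proof.
  intros Hrho He.
  set (s := ((1 + rho) / 2)%R).
  set (k := (rho / (rho - s))%R).
  assert (Hk : (0 < k)%R) by (apply Rdiv_lt_0_compat; unfold s; lra).
  (* Makes the final bound th k equal to e; [eta] is then chosen with (1 + eta)^2 - 1 <= 3 eta <=
     th^2. *)
  set (th := (e / k)%R).
  assert (Hth : (0 < th)%R) by (apply Rdiv_lt_0_compat; lra).
  set (eta := Rmin 1 (th * th / 3)).
  assert (Heta : (0 < eta)%R) by (apply Rmin_pos; [lra|]; nra).
  assert (Heta1 : (eta <= 1)%R) by apply Rmin_l. assert (Heta2 : (eta <= th * th / 3)%R) by apply Rmin_r.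
  destruct (quot_modulus 1 ltac:(lra) phi_tangent s eta) as [N HN]; [unfold s; lra|auto|].
  exists N. intros n z Hn Hz.
  assert (H := near_one_exterior (quot n) 1 s z eta th).
  specialize (H ltac:(lra) ltac:(intros w Hw; apply quot_diff; auto)).
  assert (HL : lim_inf (quot n) 1).
  { rewrite <- (Cpow_1_l (d ^ n)). apply quot_lim; [|apply phi_tangent].
    intros E. apply RtoC_inj in E. lra. }
  specialize (H HL ltac:(unfold s; lra) ltac:(unfold s; lra) Hth ltac:(lra)).
  eapply Rle_trans; [apply H|].
  - intros w Hw. specialize (HN n w Hn ltac:(lra)). apply Rabs_def2 in HN. lra.
  - assert (Hkz : (Cmod z / (Cmod z - s) <= k)%R).
    { assert (Hrs : (0 < rho - s)%R) by (unfold s; lra).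
      unfold k. apply Rmult_le_reg_r with (Cmod z - s)%R; [lra|].
      apply Rmult_le_reg_r with (rho - s)%R; [lra|].
      replace (Cmod z / (Cmod z - s) * (Cmod z - s) * (rho - s))%R with (Cmod z * (rho - s))%R by (field; lra).
      replace (rho / (rho - s) * (Cmod z - s) * (rho - s))%R with (rho * (Cmod z - s))%R by (field; lra).
      assert (0 < s)%R by (unfold s; lra). nra. }
    assert (Hz0 : (0 <= Cmod z / (Cmod z - s))%R) by (left; apply Rdiv_lt_0_compat; unfold s; lra).
    assert (Hb : ((((1 + eta) ^ 2 - 1) / th + th) / 2 <= th)%R).
    { assert (((1 + eta) ^ 2 - 1) / th <= th)%R; [|lra].
      apply Rle_div_l; auto. nra. }
    assert (Hb0 : (0 <= (((1 + eta) ^ 2 - 1) / th + th) / 2)%R).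
    { assert (0 <= ((1 + eta) ^ 2 - 1) / th)%R; [|lra].
      apply Rmult_le_pos; [nra|left; apply Rinv_0_lt_compat; auto]. }
    apply Rle_trans with (th * k)%R; [apply Rmult_le_compat; auto|].
    unfold th. right. field. lra.
Qed.

(** With w = y / z^d one has quot (n+1) z = quot n y * w^(d^n). Both quotients are near 1 for n >=
    N, so the powers w^(d^n) are too, and expansion forces w^(d^N) = 1. The order d^N depends on
    [rho] only. *)
Lemma conj_root_of_unity rho : (1 < rho)%R -> exists m, (0 < m)%nat /\
  forall z y, (rho <= Cmod z)%R -> (1 < Cmod y)%R -> phi y = P (phi z) ->
    (y / z ^ d) ^ m = 1.
Proof.
  intros Hrho.
  assert (Hd' : (2 <= INR d)%R) by (apply (le_INR 2); auto).
  (* Two quotients within e of 1 have a ratio within 2 e / (1/2) = 4 e of 1, and 4 e d^2 = 1/2 is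
     the threshold of [unit_expanding]. *)
  set (e := (/ (8 * INR d ^ 2))%R).
  assert (Hdd : (4 <= INR d ^ 2)%R) by nra.
  assert (He : (0 < e)%R) by (apply Rinv_0_lt_compat; lra).
  assert (Hed : (e * (8 * INR d ^ 2) = 1)%R) by (unfold e; field; nra).
  assert (He1 : (e <= / 2)%R) by nra.
  destruct (quot_near_one rho e Hrho He) as [N HN].
  exists (d ^ N)%nat. split; [apply dpow_pos|]. intros z y Hz Hy E.
  assert (Em := conj_modulus z y ltac:(lra) Hy E).
  assert (Hz0 : z <> 0) by (apply Cmod_gt_0; lra). assert (Hy0 : y <> 0) by (apply Cmod_gt_0; lra).
  assert (Hzd : z ^ d <> 0) by (apply Cpow_nz; auto).
  assert (Hyr : (rho <= Cmod y)%R).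
  { rewrite Em. apply Rle_trans with (Cmod z); auto.
    rewrite <- (pow_1 (Cmod z)) at 1. apply Rle_pow; [lra|lia]. }
  assert (Hw1 : Cmod (y / z ^ d) = 1).
  { rewrite Cmod_div, Cmod_pow, Em by auto. field. apply pow_nonzero. lra. }
  apply (unit_expanding _ d (4 * e)); auto.
  - rewrite Cmod_pow, Hw1, pow1. reflexivity.
  - lra.
  - intros j. rewrite <- Cpow_mult_r, <- Nat.pow_add_r.
    set (n := (N + j)%nat).
    assert (H1 := HN (S n) z ltac:(unfold n; lia) Hz). assert (H2 := HN n y ltac:(unfold n; lia) Hyr).
    assert (Hq : (/ 2 <= Cmod (quot n y))%R).
    { generalize (Cmod_sub_ge 1 (quot n y)). rewrite Cmod_sub_sym, Cmod_1. lra. }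
    assert (Hq0 : quot n y <> 0) by (apply Cmod_gt_0; lra).
    assert (Ew : (y / z ^ d) ^ (d ^ n) - 1 = (quot (S n) z - quot n y) / quot n y).
    { assert (Eq : quot (S n) z = quot n y * (y / z ^ d) ^ (d ^ n)).
      { unfold quot. rewrite E, iter_succ_r. simpl iter.
        unfold Cdiv at 3. rewrite Cpow_mult_l, Cpow_inv by auto. rewrite <- Cpow_mult_r, <- Nat.pow_succ_r'.
        field. split; apply Cpow_nz; auto. }
      rewrite Eq. field. auto. }
    rewrite Ew, Cmod_div by auto.
    assert (Hs : (Cmod (quot (S n) z - quot n y) <= 2 * e)%R).
    { eapply Rle_trans; [apply (Cmod_sub_triangle _ 1)|]. rewrite (Cmod_sub_sym 1). lra. }
    apply Rle_div_l; [lra|]. nra.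
Qed.

(** * The lift of P through the Riemann map is a power *)

Section Lift.
Context (Y : C -> C) (HY : forall z, (1 < Cmod z)%R -> (1 < Cmod (Y z))%R /\ phi (Y z) = P (phi z)).

(** Takes the place of an open mapping argument for [phi]: values of [Y] along a sequence tending to
    z cluster at a point p, of modulus |z|^d > 1 by [conj_modulus]. So [phi] is continuous at p, phi
    p = phi (Y z), and injectivity gives p = Y z. *)
Lemma lift_cont z : (1 < Cmod z)%R -> ccont Y z.
Proof.
  intros Hz. apply NNPP. intros Hno.
  apply not_all_ex_not in Hno. destruct Hno as [e Hno].
  apply imply_to_and in Hno. destruct Hno as [He Hno].
  assert (Hseq : forall k : nat, exists w, (Cmod (w - z) < Rmin (/ (INR k + 1)) ((Cmod z - 1) / 2))%R /\
     (e <= Cmod (Y w - Y z))%R).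
  { intros k. apply NNPP. intros Hk. apply Hno.
    exists (Rmin (/ (INR k + 1)) ((Cmod z - 1) / 2)). split.
    - apply Rmin_pos; [apply inv_INR_pos|lra].
    - intros w Hw. apply Rnot_le_lt. intros Hl. apply Hk. exists w. auto. }
  destruct (choice _ Hseq) as [u Hu].
  assert (Hu1 : forall k, (1 < Cmod (u k) < 2 * Cmod z)%R).
  { intros k. destruct (Hu k) as [H1 _]. assert (H2 := Rlt_le_trans _ _ _ H1 (Rmin_r _ _)).
    generalize (Cmod_sub_ge z (u k)), (Cmod_sub_ge (u k) z). rewrite (Cmod_sub_sym z). lra. }
  assert (Hulim : forall dl, (0 < dl)%R -> exists N, forall k, (N <= k)%nat -> (Cmod (u k - z) < dl)%R).
  { intros dl Hdl. destruct (inv_INR_small dl Hdl) as [N HN]. exists N. intros k Hk.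
    destruct (Hu k) as [H1 _]. assert (H2 := Rlt_le_trans _ _ _ H1 (Rmin_l _ _)).
    specialize (HN k Hk). lra. }
  assert (HYm : forall w, (1 < Cmod w)%R -> Cmod (Y w) = (Cmod w ^ d)%R).
  { intros w Hw. apply conj_modulus; auto; apply HY; auto. }
  destruct (bounded_cluster (fun k => Y (u k)) ((2 * Cmod z) ^ d)%R) as [p Hp].
  { intros k. rewrite HYm by apply Hu1. apply pow_incr. generalize (Hu1 k). lra. }
  assert (Hpm : Cmod p = (Cmod z ^ d)%R).
  { apply (cluster_mod (fun k => Y (u k)) p _ (fun k => (Cmod (u k) ^ d)%R)); auto.
    - intros eps Heps.
      destruct (derivable_continuous_pt _ _ (derivable_pt_pow d (Cmod z)) eps Heps) as [al [Hal Hc]].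
      destruct (Hulim al Hal) as [N HN]. exists N. intros k Hk.
      destruct (Req_dec (Cmod (u k)) (Cmod z)) as [->|Hne].
      { rewrite Rminus_diag, Rabs_R0. auto. }
      apply (Hc (Cmod (u k))). split.
      + unfold D_x, no_cond. split; auto.
      + unfold dist; simpl. unfold Rdist. specialize (HN k Hk).
        generalize (Cmod_sub_ge z (u k)), (Cmod_sub_ge (u k) z). rewrite (Cmod_sub_sym z).
        intros. apply Rabs_def1; lra.
    - intros k. apply HYm, Hu1. }
  assert (Hp1 : (1 < Cmod p)%R) by (rewrite Hpm; apply Rlt_pow_R1; [auto|lia]).
  assert (Ep : phi p = phi (Y z)).
  { apply NNPP. intros Hne. apply Cmod_sub_pos in Hne.
    set (eps := (Cmod (phi p - phi (Y z)) / 2)%R) in *.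
    destruct (cdiff_ccont _ _ (phi_diff p Hp1) eps) as [d1 [Hd1 H1]]; [unfold eps; lra|].
    destruct (cdiff_ccont _ _ (iter_phi_diff 1 z Hz) eps) as [d3 [Hd3 H3]]; [unfold eps; lra|].
    destruct (Hulim d3 Hd3) as [N HN].
    destruct (Hp d1 N Hd1) as [k [Hk Hk']].
    specialize (H1 _ Hk'). specialize (H3 _ (HN k Hk)). simpl in H3.
    rewrite <- (proj2 (HY z Hz)), <- (proj2 (HY (u k) (proj1 (Hu1 k)))) in H3.
    generalize (Cmod_sub_triangle (phi p) (phi (Y (u k))) (phi (Y z))).
    rewrite (Cmod_sub_sym (phi p) (phi (Y (u k)))). unfold eps in *. lra. }
  assert (Epz : p = Y z) by (apply phi_inj; auto; apply HY; auto).
  destruct (Hp e O He) as [k [_ Hk]]. rewrite Epz in Hk. generalize (proj2 (Hu k)). lra.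
Qed.

(** Y z / z^d is the product of Y z / phi (Y z) and [quot 1], and Y z tends to infinity with z. *)
Lemma lift_tangent : lim_inf (fun z => Y z / z ^ d) 1.
Proof.
  assert (H1 : lim_inf (fun z => Y z / phi (Y z)) 1).
  { intros e He.
    assert (Hi : lim_inf (fun z => / (phi z / z)) (/ 1)).
    { apply (lim_inf_comp _ _ Cinv phi_tangent). apply ccont_inv_at. intros E; apply RtoC_inj in E; lra. }
    destruct (Hi e He) as [M HM].
    destruct (escape_radius a d Hd2 Hmonic) as [R0 [HR0 Hesc]].
    destruct (phi_large R0) as [M' HM'].
    exists (Rmax 1 (Rmax M M')). intros z Hz.
    assert (G0 := Rle_lt_trans _ _ _ (Rmax_l _ _) Hz).
    assert (G1 := Rle_lt_trans _ _ _ (Rle_trans _ _ _ (Rmax_l M M') (Rmax_r _ _)) Hz).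
    assert (G2 := Rle_lt_trans _ _ _ (Rle_trans _ _ _ (Rmax_r M M') (Rmax_r _ _)) Hz).
    destruct (HY z G0) as [Hy1 Hy2].
    assert (Hyz : (Cmod z <= Cmod (Y z))%R).
    { rewrite (conj_modulus z (Y z)) by auto. rewrite <- (pow_1 (Cmod z)) at 1. apply Rle_pow; [lra|lia]. }
    specialize (HM (Y z) ltac:(lra)). specialize (HM' (Y z) ltac:(lra) Hy1).
    replace (Y z / phi (Y z) - 1) with (/ (phi (Y z) / Y z) - / 1); auto.
    field. split; apply Cmod_gt_0; lra. }
  assert (H2 : lim_inf (quot 1) 1).
  { rewrite <- (Cpow_1_l (d ^ 1)). apply quot_lim; [|apply phi_tangent].
    intros E. apply RtoC_inj in E. lra. }
  assert (H3 := lim_inf_mult _ _ _ _ H1 H2). rewrite Cmult_1_l in H3.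
  destruct (escape_radius a d Hd2 Hmonic) as [R0 [HR0 Hesc]].
  destruct (phi_large R0) as [M HM].
  apply (lim_inf_ext _ _ _ (Rmax 1 M)) with (2 := H3). intros z Hz.
  assert (G0 := Rle_lt_trans _ _ _ (Rmax_l _ _) Hz).
  assert (G1 := Rle_lt_trans _ _ _ (Rmax_r _ _) Hz).
  destruct (HY z G0) as [Hy1 Hy2].
  unfold quot. rewrite Nat.pow_1_r. simpl iter. rewrite Hy2.
  field. split.
  - apply Cpow_nz, Cmod_gt_0. lra.
  - apply Cmod_gt_0. apply Rlt_le_trans with R0; [lra|].
    apply (escape_mono a d Hd2 R0 HR0 Hesc (phi z) 0 1); [lia|]. simpl. apply HM; lra.
Qed.

(** Along the ray s z with s >= 1 the quotient [om s] is an m-th root of unity, so |om s - 1| is 0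
    or at least 1/m. Far out it is below 1/(4m); were it nonzero at s = 1, it would take the value
    1/(2m) in between. *)
Lemma lift_is_power z : (1 < Cmod z)%R -> Y z = z ^ d.
Proof.
  intros Hz.
  destruct (conj_root_of_unity ((1 + Cmod z) / 2)%R) as [m [Hm Hroot]]; [lra|].
  assert (HM : (0 < INR m)%R) by (apply lt_0_INR; auto).
  assert (Hz0 : z <> 0) by (apply Cmod_gt_0; lra).
  assert (Hmod : forall s, (1 <= s)%R -> Cmod (RtoC s * z) = (s * Cmod z)%R).
  { intros s Hs. rewrite Cmod_mult, Cmod_R, Rabs_pos_eq; lra. }
  set (om := fun s : R => Y (RtoC s * z) / (RtoC s * z) ^ d).
  assert (Hdisc : forall s, (1 <= s)%R -> (INR m * Cmod (om s - 1) < 1)%R -> om s = 1).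
  { intros s Hs Hsm.
    assert (Hs1 : (1 < Cmod (RtoC s * z))%R) by (rewrite Hmod; nra).
    destruct (HY _ Hs1) as [H1 H2].
    apply (unit_pow_one _ m); auto.
    - assert ((RtoC s * z) <> 0) by (apply Cmod_gt_0; lra).
      unfold om. rewrite Cmod_div, Cmod_pow, (conj_modulus _ _ Hs1 H1 H2) by (apply Cpow_nz; auto).
      field. apply pow_nonzero. lra.
    - apply Hroot; auto. rewrite Hmod by auto. nra. }
  assert (E1 : om 1 = 1).
  { apply NNPP. intros Hne.
    assert (Hbig : (1 <= INR m * Cmod (om 1%R - 1))%R).
    { apply Rnot_lt_le. intros Hl. apply Hne, Hdisc; auto. lra. }
    destruct (lift_tangent (/ (4 * INR m))%R) as [M HMl]; [apply Rinv_0_lt_compat; lra|].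
    set (S0 := (2 + Rmax 0 M)%R).
    assert (G0 := Rmax_l 0 M). assert (G1 := Rmax_r 0 M).
    assert (HS : (Cmod (om S0 - 1) < / (4 * INR m))%R).
    { apply HMl. rewrite Hmod by (unfold S0; lra). unfold S0. nra. }
    assert (Hq : (/ (4 * INR m) * (4 * INR m) = 1)%R) by (field; lra).
    destruct (IVT_interv (fun s => / (2 * INR m) - Cmod (om s - 1))%R 1 S0) as [s [Hs Es]].
    - intros s Hs. apply continuity_pt_filterlim.
      assert (Hs1 : (1 < Cmod (RtoC s * z))%R) by (rewrite Hmod; nra).
      assert (Hc : ccont (fun w => Y (w * z) / (w * z) ^ d - 1) (RtoC s)).
      { apply (ccont_comp (fun w => w * z) (fun v => Y v / v ^ d - 1)).
        - apply ccont_mult; [apply ccont_id|apply ccont_const].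
        - apply ccont_minus; [|apply ccont_const]. apply ccont_div.
          + apply lift_cont; auto.
          + apply ccont_pow, ccont_id.
          + apply Cpow_nz, Cmod_gt_0. lra. }
      intros Q [eps HQ]. destruct (Hc eps (cond_pos eps)) as [dl [Hdl Hcl]].
      exists (mkposreal dl Hdl). intros s' Hs'. apply HQ.
      assert (Hcl' : (Cmod (om s' - 1 - (om s - 1)) < eps)%R).
      { apply Hcl. rewrite <- RtoC_minus, Cmod_R. exact Hs'. }
      change (Rabs ((/ (2 * INR m) - Cmod (om s' - 1)) - (/ (2 * INR m) - Cmod (om s - 1))) < eps)%R.
      generalize (Cmod_sub_ge (om s' - 1) (om s - 1)), (Cmod_sub_ge (om s - 1) (om s' - 1)).
      rewrite (Cmod_sub_sym (om s - 1)). intros. apply Rabs_def1; lra.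
    - unfold S0; lra.
    - assert (/ (2 * INR m) * (2 * INR m) = 1)%R by (field; lra).
      apply Rmult_lt_reg_r with (2 * INR m)%R; nra.
    - assert (/ (2 * INR m) * (2 * INR m) = 1)%R by (field; lra). nra.
    - assert (Hval : Cmod (om s - 1) = (/ (2 * INR m))%R) by lra.
      assert (Hone : om s = 1).
      { apply Hdisc; [lra|]. rewrite Hval. replace (INR m * / (2 * INR m))%R with (/ 2)%R by (field; lra). lra. }
      rewrite Hone, Cmod_sub_refl in Hval.
      assert (0 < / (2 * INR m))%R by (apply Rinv_0_lt_compat; lra). lra. }
  unfold om in E1. rewrite Cmult_1_l in E1.
  assert (Hzd : z ^ d <> 0) by (apply Cpow_nz; auto).
  transitivity (Y z / z ^ d * z ^ d); [field; auto|]. rewrite E1. ring.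
Qed.
End Lift.

Theorem bottcher z : (1 < Cmod z)%R -> P (phi z) = phi (z ^ d).
Proof.
  intros Hz.
  assert (Hex : forall z, exists y, (1 < Cmod z)%R -> (1 < Cmod y)%R /\ phi y = P (phi z)).
  { intros w. destruct (classic (1 < Cmod w)%R) as [Hw|Hw].
    - destruct (phi_surj (P (phi w))) as [y Hy].
      { intros HK. apply (phi_out w Hw). apply (julia_inv a d). exact HK. }
      exists y. intros _. exact Hy.
    - exists 0. intros H. contradiction. }
  destruct (choice _ Hex) as [Y HY].
  rewrite <- (lift_is_power Y HY z Hz). symmetry. apply HY, Hz.
Qed.

(** * Boundary values of the Riemann map *)

Lemma radial_point t e : (0 < e)%R -> exists s, (1 < s < 1 + e)%R /\ (Cmod (circ s t - cis t) < e)%R.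
Proof.
  intros He. exists (1 + e / 2)%R. split; [lra|].
  replace (circ (1 + e / 2) t - cis t) with (RtoC (e / 2) * cis t).
  - rewrite Cmod_mult, Cmod_R, Cmod_cis, Rabs_pos_eq; lra.
  - unfold circ. rewrite RtoC_plus. ring.
Qed.

(** Boettcher's equation at a point of the ray through [cis t] near the circle; the d-th power of
    that point is near the point of angle d t. *)
Theorem sigma_semiconj t : P (sigma t) = sigma (INR d * t)%R.
Proof.
  apply NNPP. intros Hne. apply Cmod_sub_pos in Hne.
  set (e := (Cmod (P (sigma t) - sigma (INR d * t)%R) / 2)%R) in *.
  assert (He : (0 < e)%R) by (unfold e; lra).
  destruct (cdiff_ccont _ _ (cdiff_poly a d (sigma t)) e He) as [d1 [Hd1 H1]].
  destruct (sigma_ext t d1 Hd1) as [d2 [Hd2' H2]].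
  destruct (sigma_ext (INR d * t) e He) as [d3 [Hd3 H3]].
  destruct (cdiff_ccont _ _ (cdiff_pow (fun z => z) d (cis t) (cdiff_id _)) d3 Hd3) as [d4 [Hd4 H4]].
  destruct (radial_point t (Rmin d2 d4)) as [s [[Hs1 _] Hs2]]; [apply Rmin_pos; auto|].
  set (z := circ s t).
  assert (Hz : (1 < Cmod z)%R) by (unfold z; rewrite Cmod_circ; lra).
  assert (B1 : (Cmod (phi z - sigma t) < d1)%R).
  { apply H2; auto. eapply Rlt_le_trans; [apply Hs2|apply Rmin_l]. }
  assert (B2 : (Cmod (phi (z ^ d) - sigma (INR d * t)%R) < e)%R).
  { apply H3.
    - rewrite Cmod_pow. apply Rlt_pow_R1; [auto|lia].
    - rewrite <- cis_pow. apply H4. eapply Rlt_le_trans; [apply Hs2|apply Rmin_r]. }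
  specialize (H1 _ B1). fold P in H1. rewrite (bottcher z Hz) in H1.
  generalize (Cmod_sub_triangle (P (sigma t)) (phi (z ^ d)) (sigma (INR d * t)%R)).
  rewrite (Cmod_sub_sym (P (sigma t)) (phi (z ^ d))). unfold e in *. lra.
Qed.

(** [sigma] is given pointwise, as a limit of [phi] at each angle. Replacing [sigma s] by a nearby
    value of [phi] reduces its continuity to that limit at t. *)
Lemma sigma_cont t : rcont sigma t.
Proof.
  intros e He. destruct (sigma_ext t (e / 2)%R) as [d1 [Hd1 H1]]; [lra|].
  destruct (rcont_circ (fun z => z) 1 t ltac:(lra) (ccont_id _) (d1 / 2)%R) as [d3 [Hd3 H3]]; [lra|].
  exists d3. split; auto. intros s Hs.
  destruct (sigma_ext s (e / 2)%R) as [d2 [Hd2' H2]]; [lra|].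
  destruct (radial_point s (Rmin d2 (d1 / 2))) as [r [[Hr _] Hr2]]; [apply Rmin_pos; lra|].
  assert (Hz : (1 < Cmod (circ r s))%R) by (rewrite Cmod_circ; lra).
  assert (B1 := H2 _ Hz (Rlt_le_trans _ _ _ Hr2 (Rmin_l _ _))).
  specialize (H3 s Hs). unfold circ in H3 at 1 2. rewrite !Cmult_1_l in H3.
  assert (B2 : (Cmod (phi (circ r s) - sigma t) < e / 2)%R).
  { apply H1; auto. eapply Rle_lt_trans; [apply (Cmod_sub_triangle _ (cis s))|].
    assert (B := Rlt_le_trans _ _ _ Hr2 (Rmin_r _ _)). lra. }
  generalize (Cmod_sub_triangle (sigma s) (phi (circ r s)) (sigma t)).
  rewrite (Cmod_sub_sym (sigma s) (phi (circ r s))). lra.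
Qed.

(** A boundary point is a limit of values phi (u k). The u k cluster at some p with |p| >= 1; were
    |p| > 1, the boundary point would be phi p, outside [K]. *)
Theorem sigma_surj x : in_boundary K x -> exists t, x = sigma t.
Proof.
  intros [HKx Hx].
  assert (Hseq : forall k : nat, exists z, (1 < Cmod z)%R /\ (Cmod (phi z - x) < / (INR k + 1))%R).
  { intros k. destruct (Hx (/ (INR k + 1))%R) as [w [Hw Hw']].
    - apply inv_INR_pos.
    - destruct (phi_surj w Hw) as [z [Hz <-]]. exists z. auto. }
  destruct (choice _ Hseq) as [u Hu].
  assert (Hulim : forall e, (0 < e)%R -> exists N, forall k, (N <= k)%nat -> (Cmod (phi (u k) - x) < e)%R).
  { intros dl Hdl. destruct (inv_INR_small dl Hdl) as [N HN]. exists N. intros k Hk.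
    eapply Rlt_trans; [apply Hu|apply HN, Hk]. }
  destruct (phi_large (Cmod x + 2)) as [M HM].
  destruct (bounded_cluster u (Rmax 1 M)) as [p Hp].
  { intros k. apply Rnot_lt_le. intros Hl.
    assert (G := Rle_lt_trans _ _ _ (Rmax_r _ _) Hl).
    destruct (Hu k) as [H1 H2]. specialize (HM (u k) ltac:(lra) H1).
    generalize (inv_INR_pos k), (Cmod_sub_ge (phi (u k)) x). lra. }
  assert (Huniq : forall l, (forall e N, (0 < e)%R -> exists k, (N <= k)%nat /\ (Cmod (phi (u k) - l) < e)%R) -> x = l).
  { intros l Hl. apply NNPP. intros Hne. apply Cmod_sub_pos in Hne.
    destruct (Hulim (Cmod (x - l) / 2)%R) as [N HN]; [lra|].
    destruct (Hl (Cmod (x - l) / 2)%R N) as [k [Hk Hk']]; [lra|].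
    specialize (HN k Hk). generalize (Cmod_sub_triangle x (phi (u k)) l). rewrite (Cmod_sub_sym x (phi (u k))). lra. }
  assert (Hp1 : (1 <= Cmod p)%R).
  { apply Rnot_lt_le. intros Hl. destruct (Hp (1 - Cmod p)%R O) as [k [_ Hk]]; [lra|].
    generalize (Cmod_sub_ge (u k) p), (proj1 (Hu k)). lra. }
  destruct (Req_dec (Cmod p) 1) as [E|E].
  - destruct (unit_circle_param p E) as [t Ht]. exists t. apply Huniq.
    intros e N He. destruct (sigma_ext t e He) as [dl [Hdl H]].
    destruct (Hp dl N Hdl) as [k [Hk Hk']]. exists k. split; auto.
    apply H; [apply Hu|]. rewrite <- Ht. exact Hk'.
  - exfalso. apply (phi_out p); [lra|]. rewrite <- (Huniq (phi p)); [exact HKx|].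
    intros e N He. destruct (cdiff_ccont _ _ (phi_diff p ltac:(lra)) e He) as [dl [Hdl H]].
    destruct (Hp dl N Hdl) as [k [Hk Hk']]. exists k. split; auto.
Qed.
End Bottcher.

(** * The chordal metric *)

(* Stereographic projection to the unit sphere of [C * R]: the chordal distance is Euclidean. *)
Definition stereo (x : Csph) : C * R :=
  match x with
  | Some z => (RtoC (2 / (1 + Cmod z ^ 2)) * z, ((Cmod z ^ 2 - 1) / (1 + Cmod z ^ 2))%R)
  | None => (RtoC 0, 1%R)
  end.

Definition dist3 (p q : C * R) : R := Cmod (Cmod (fst p - fst q), snd p - snd q)%R.

Lemma Cmod_pair_mono x y x' y' : (0 <= x <= x')%R -> (Rabs y <= Rabs y')%R -> (Cmod (x, y) <= Cmod (x', y'))%R.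
Proof.
  intros Hx Hy. unfold Cmod. apply sqrt_le_1_alt. simpl fst. simpl snd.
  apply Rplus_le_compat; [apply pow_incr; lra|].
  rewrite <- (pow2_abs y), <- (pow2_abs y'). apply pow_incr. split; [apply Rabs_pos|auto].
Qed.

Lemma dist3_triangle p q r : (dist3 p r <= dist3 p q + dist3 q r)%R.
Proof.
  unfold dist3.
  eapply Rle_trans.
  - apply (Cmod_pair_mono _ _ (Cmod (fst p - fst q) + Cmod (fst q - fst r))
      (Rabs (snd p - snd q) + Rabs (snd q - snd r))).
    + split; [apply Cmod_ge_0|apply Cmod_sub_triangle].
    + rewrite (Rabs_pos_eq (Rabs _ + Rabs _)) by (apply Rplus_le_le_0_compat; apply Rabs_pos).
      replace (snd p - snd r)%R with ((snd p - snd q) + (snd q - snd r))%R by ring. apply Rabs_triang.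
  - replace (Cmod (fst p - fst q) + Cmod (fst q - fst r), Rabs (snd p - snd q) + Rabs (snd q - snd r))%R
      with ((Cmod (fst p - fst q), Rabs (snd p - snd q)) + (Cmod (fst q - fst r), Rabs (snd q - snd r))).
    2:{ apply injective_projections; reflexivity. }
    eapply Rle_trans; [apply Cmod_triangle|].
    apply Rplus_le_compat; apply Cmod_pair_mono; try rewrite Rabs_Rabsolu; split || idtac; try apply Cmod_ge_0; apply Rle_refl.
Qed.

Lemma Cmod_sq z : (Cmod z ^ 2 = fst z * fst z + snd z * snd z)%R.
Proof. rewrite Cmod2_alt. unfold Re, Im. ring. Qed.

Lemma sq_eq_nonneg x y : (0 <= x)%R -> (0 <= y)%R -> (x ^ 2 = y ^ 2)%R -> x = y.
Proof. intros Hx Hy H. apply Rsqr_inj; auto. unfold Rsqr. simpl in H. lra. Qed.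

Lemma sqrt_sq_pos x : (0 < x)%R -> (0 < sqrt x)%R /\ (sqrt x ^ 2 = x)%R.
Proof. intros Hx. split; [apply sqrt_lt_R0, Hx|]. simpl. rewrite Rmult_1_r. apply sqrt_sqrt. lra. Qed.

Lemma one_plus_pos (z : C) : (0 < 1 + Cmod z ^ 2)%R.
Proof. generalize (pow2_ge_0 (Cmod z)). lra. Qed.

Lemma chord_sym x y : chord x y = chord y x.
Proof.
  destruct x as [z|], y as [w|]; simpl; auto.
  change (2 * Cmod (z - w) / (sqrt (1 + Cmod z ^ 2) * sqrt (1 + Cmod w ^ 2)) =
          2 * Cmod (w - z) / (sqrt (1 + Cmod w ^ 2) * sqrt (1 + Cmod z ^ 2)))%R.
  rewrite Cmod_sub_sym, (Rmult_comm (sqrt (1 + Cmod z ^ 2))). reflexivity.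
Qed.

Lemma chord_stereo_None z : chord (Some z) None = dist3 (stereo (Some z)) (stereo None).
Proof.
  change (chord (Some z) None) with (2 / sqrt (1 + Cmod z ^ 2))%R.
  assert (HA := one_plus_pos z). destruct (sqrt_sq_pos _ HA) as [S1 S2].
  apply sq_eq_nonneg.
  - left. apply Rdiv_lt_0_compat; lra.
  - apply Cmod_ge_0.
  - unfold dist3. rewrite (Cmod_sq (_, _)). cbn [stereo fst snd].
    replace (RtoC (2 / (1 + Cmod z ^ 2)) * z - 0) with (RtoC (2 / (1 + Cmod z ^ 2)) * z) by ring.
    rewrite Cmod_mult, Cmod_R, Rabs_pos_eq by (left; apply Rdiv_lt_0_compat; lra).
    unfold Rdiv. rewrite Rpow_mult_distr, pow_inv, S2.
    set (m := Cmod z) in *. field. simpl in HA |- *. lra.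
Qed.

Lemma chord_stereo x y : chord x y = dist3 (stereo x) (stereo y).
Proof.
  destruct x as [z|], y as [w|].
  - change (chord (Some z) (Some w))
      with (2 * Cmod (z - w) / (sqrt (1 + Cmod z ^ 2) * sqrt (1 + Cmod w ^ 2)))%R.
    assert (HA := one_plus_pos z). destruct (sqrt_sq_pos _ HA) as [S1 S2].
    assert (HB := one_plus_pos w). destruct (sqrt_sq_pos _ HB) as [T1 T2].
    apply sq_eq_nonneg.
    + apply Rmult_le_pos; [generalize (Cmod_ge_0 (z - w)); lra|].
      left. apply Rinv_0_lt_compat. apply Rmult_lt_0_compat; auto.
    + apply Cmod_ge_0.
    + unfold dist3. rewrite (Cmod_sq (_, _)). cbn [stereo fst snd].
      replace (Cmod (RtoC (2 / (1 + Cmod z ^ 2)) * z - RtoC (2 / (1 + Cmod w ^ 2)) * w) *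
               Cmod (RtoC (2 / (1 + Cmod z ^ 2)) * z - RtoC (2 / (1 + Cmod w ^ 2)) * w))%R
        with (Cmod (RtoC (2 / (1 + Cmod z ^ 2)) * z - RtoC (2 / (1 + Cmod w ^ 2)) * w) ^ 2)%R by ring.
      unfold Rdiv at 1. rewrite !Rpow_mult_distr, pow_inv, Rpow_mult_distr, S2, T2.
      rewrite !Cmod_sq in *. destruct z as [x y], w as [u v]. simpl in *. field. split; lra.
  - apply chord_stereo_None.
  - rewrite chord_sym, chord_stereo_None. unfold dist3.
    rewrite Cmod_sub_sym. apply Rle_antisym; apply Cmod_pair_mono;
      try (split; [apply Cmod_ge_0|apply Rle_refl]); rewrite Rabs_minus_sym; apply Rle_refl.
  - simpl. unfold dist3. simpl. rewrite Cmod_sub_refl, Rminus_diag. change (0 = Cmod 0). rewrite Cmod_0. reflexivity.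
Qed.

Lemma chord_triangle x y z : (chord x z <= chord x y + chord y z)%R.
Proof. rewrite !chord_stereo. apply dist3_triangle. Qed.

Lemma chord_eq0 x y : chord x y = 0 -> x = y.
Proof.
  assert (HN : forall z : C, (0 < 2 / sqrt (1 + Cmod z ^ 2))%R).
  { intros z. apply Rdiv_lt_0_compat; [lra|]. apply sqrt_sq_pos, one_plus_pos. }
  destruct x as [z|], y as [w|]; intros H; auto.
  - change (2 * Cmod (z - w) / (sqrt (1 + Cmod z ^ 2) * sqrt (1 + Cmod w ^ 2)) = 0)%R in H.
    destruct (sqrt_sq_pos _ (one_plus_pos z)) as [S1 _]. destruct (sqrt_sq_pos _ (one_plus_pos w)) as [T1 _].
    destruct (Ceq_dec z w) as [->|n]; auto. exfalso. apply Cmod_sub_pos in n.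
    assert (0 < 2 * Cmod (z - w) / (sqrt (1 + Cmod z ^ 2) * sqrt (1 + Cmod w ^ 2)))%R; [|lra].
    apply Rdiv_lt_0_compat; [lra|]. apply Rmult_lt_0_compat; auto.
  - generalize (HN z). change (chord (Some z) None) with (2 / sqrt (1 + Cmod z ^ 2))%R in H. lra.
  - generalize (HN w). change (chord None (Some w)) with (2 / sqrt (1 + Cmod w ^ 2))%R in H. lra.
Qed.

Lemma chord_small_eq x y : (forall e, (0 < e)%R -> (chord x y < e)%R) -> x = y.
Proof.
  intros H. apply chord_eq0. assert (H0 : (0 <= chord x y)%R) by (rewrite chord_stereo; apply Cmod_ge_0).
  apply Rle_antisym; auto. apply Rnot_lt_le. intros Hl. specialize (H _ Hl). lra.
Qed.

(** * Monic polynomials through their roots *)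

Lemma list_min_pow (z : C) (rs : list C) : rs <> nil ->
  exists r, In r rs /\
    (Cmod (z - r) ^ length rs <= Cmod (fold_right (fun r acc => ((z - r) * acc)%C) 1 rs))%R.
Proof.
  intros Hne.
  assert (Hmin : exists r, In r rs /\ forall s, In s rs -> (Cmod (z - r) <= Cmod (z - s))%R).
  { induction rs as [|x rs IH]; [contradiction|].
    destruct rs as [|y rs]; [exists x; split; [left; auto|]; intros s [->|[]]; lra|].
    destruct IH as [r [Hr Hm]]; [discriminate|].
    destruct (Rle_dec (Cmod (z - x)) (Cmod (z - r))) as [Hl|Hl].
    - exists x. split; [left; auto|]. intros s [->|Hs]; [lra|]. eapply Rle_trans; [apply Hl|auto].
    - exists r. split; [right; auto|]. intros s [->|Hs]; [lra|auto]. }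
  destruct Hmin as [r [Hr Hm]]. exists r. split; auto. clear Hne Hr.
  induction rs as [|x rs IH]; simpl; [rewrite Cmod_1; lra|].
  rewrite Cmod_mult. apply Rmult_le_compat; try apply Cmod_ge_0.
  - apply pow_le, Cmod_ge_0.
  - apply Hm. left; auto.
  - apply IH. intros s Hs. apply Hm. right; auto.
Qed.

Lemma fold_root (z : C) (rs : list C) :
  fold_right (fun r acc => ((z - r) * acc)%C) 1 rs = 0 <-> In z rs.
Proof.
  induction rs as [|x rs IH]; simpl.
  - split; [|tauto]. intros E. apply RtoC_inj in E. lra.
  - rewrite <- IH. split.
    + intros E. destruct (Ceq_dec z x) as [->|n]; [left; auto|right].
      apply NNPP. intros Hn. revert E. apply Cmult_neq_0; auto. apply Csub_neq0, n.
    + intros [->|E]; [ring|]. rewrite E. ring.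
Qed.

(** The last clause is a quantitative open mapping property: |P z - x| is the product of the d
    distances from z to the roots, hence at least the d-th power of the least one. *)
Lemma poly_roots_list (a : nat -> C) d x : (0 < d)%nat -> monic_deg a d ->
  exists rs : list C, length rs = d /\ (forall z, poly a d z = x <-> In z rs) /\
    forall z, exists r, In r rs /\ (Cmod (z - r) ^ d <= Cmod (poly a d z - x))%R.
Proof.
  intros Hd Ha. destruct (@poly_factor a d x Hd Ha) as [rs [Hl Hf]].
  change (forall z : C, poly a d z - x = fold_right (fun r acc => ((z - r) * acc)%C) 1 rs) in Hf.
  exists rs. split; auto. split.
  - intros z. rewrite <- fold_root, <- Hf. split.
    + intros ->. ring.
    + intros E. replace (poly a d z) with (poly a d z - x + x) by ring. rewrite E. ring.
  - intros z. rewrite Hf. rewrite <- Hl. apply list_min_pow. intros E. rewrite E in Hl. simpl in Hl. lia.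
Qed.

(** * Counting postcritical points *)

(** The interior, encoded through [in_boundary] because the image of [sigma] is exactly the
    boundary. *)
Definition julia_int (a : nat -> C) (d : nat) (z : C) : Prop :=
  filled_julia a d z /\ ~ in_boundary (filled_julia a d) z.

Lemma julia_int_ball a d z : julia_int a d z ->
  exists r, (0 < r)%R /\ forall w : C, (Cmod (w - z) < r)%R -> filled_julia a d w.
Proof.
  intros [Hz Hb]. apply NNPP. intros Hno. apply Hb. split; auto.
  intros r Hr. apply NNPP. intros Hw. apply Hno. exists r. split; auto.
  intros w Hwz. apply NNPP. intros HK. apply Hw. exists w. auto.
Qed.

Lemma julia_int_open a d z : julia_int a d z ->
  exists r, (0 < r)%R /\ forall w : C, (Cmod (w - z) < r)%R -> julia_int a d w.
Proof.
  intros H. destruct (julia_int_ball a d z H) as [r [Hr Hb]].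
  exists (r / 2)%R. split; [lra|]. intros w Hw. split; [apply Hb; lra|].
  intros [_ Hbd]. destruct (Hbd (r / 2)%R) as [v [Hv Hvw]]; [lra|].
  apply Hv, Hb. change (Cmod (v - w) < r / 2)%R in Hvw.
  generalize (Cmod_sub_triangle v w z). lra.
Qed.

(** P is open: by the closest root estimate each w within r^d of P z has a preimage within r of
    z. *)
Lemma julia_int_forward a d z : (0 < d)%nat -> monic_deg a d ->
  julia_int a d z -> julia_int a d (poly a d z).
Proof.
  intros Hd Ha H. split; [apply (proj1 (julia_inv a d z)), H|]. intros [_ Hbd].
  destruct (julia_int_ball a d z H) as [r [Hr Hb]].
  destruct (Hbd (r ^ d)%R) as [w [Hw Hwz]]; [apply pow_lt, Hr|].
  change (Cmod (w - poly a d z) < r ^ d)%R in Hwz.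
  destruct (poly_roots_list a d w Hd Ha) as [rs [_ [Hrs Hclose]]].
  destruct (Hclose z) as [s [Hs Hsz]].
  apply Hw. apply Hrs in Hs. rewrite <- Hs. apply (proj1 (julia_inv a d s)), Hb.
  rewrite Cmod_sub_sym. apply Rnot_le_lt. intros Hle.
  assert (r ^ d <= Cmod (z - s) ^ d)%R by (apply pow_incr; lra).
  rewrite Cmod_sub_sym in Hwz. lra.
Qed.

(* How the interior of one filled Julia set sits in the sphere: [H] embeds it equivariantly
   as a completely invariant set. *)
Record side (f : Csph -> Csph) (P : C -> C) (I : C -> Prop) (H : C -> Csph) : Prop := {
  side_inj : forall x y, I x -> I y -> H x = H y -> x = y;
  side_fwd : forall x, I x -> I (P x);
  side_conj : forall x, I x -> f (H x) = H (P x);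
  side_back : forall x, I (P x) -> I x;
  side_pre : forall x z, I x -> f z = H x -> exists y, I y /\ P y = x /\ z = H y;
  side_open : forall x, I x -> exists r, (0 < r)%R /\ forall w, (Cmod (w - x) < r)%R -> I w
}.

(** A nonempty open set is infinite: [pt] yields more points than [L] can hold. This provides a
    noncritical value for the comparison of degrees. *)
Lemma side_avoid f P I H x (L : list Csph) : side f P I H -> I x -> exists y, I y /\ ~ In (H y) L.
Proof.
  intros S Hx. destruct (side_open _ _ _ _ S x Hx) as [r [Hr Hb]].
  pose (pt := fun n : nat => x + RtoC (r / (2 + INR n))).
  assert (Hpos : forall n, (0 < / (2 + INR n) < 1)%R).
  { intros n. generalize (pos_INR n); intros. split; [apply Rinv_0_lt_compat; lra|].
    rewrite <- Rinv_1. apply Rinv_lt_contravar; lra. }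
  assert (Hpt : forall n, I (pt n)).
  { intros n. apply Hb. unfold pt. replace (x + RtoC (r / (2 + INR n)) - x) with (RtoC (r / (2 + INR n))) by ring.
    rewrite Cmod_R, Rabs_pos_eq; unfold Rdiv; generalize (Hpos n); nra. }
  assert (Hinj : forall m n, pt m = pt n -> m = n).
  { intros m n E. unfold pt in E.
    assert (E' : RtoC (r / (2 + INR m)) = RtoC (r / (2 + INR n))).
    { replace (RtoC (r / (2 + INR m))) with (x + RtoC (r / (2 + INR m)) - x) by ring. rewrite E. ring. }
    apply RtoC_inj in E'. apply INR_eq.
    generalize (pos_INR m), (pos_INR n). intros.
    apply Rmult_eq_reg_l in E'; [|lra]. apply Rinv_eq_reg in E'. lra. }
  apply NNPP. intros Hno.
  pose (M := map (fun n => H (pt n)) (seq 0 (length L + 1))).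
  assert (HM : NoDup M).
  { apply FinFun.Injective_map_NoDup; [|apply seq_NoDup].
    intros m n E. apply Hinj. apply (side_inj _ _ _ _ S); auto. }
  assert (Hincl : incl M L).
  { intros v Hv. apply in_map_iff in Hv. destruct Hv as [n [<- _]].
    apply NNPP. intros Hn. apply Hno. exists (pt n). auto. }
  apply NoDup_incl_length in Hincl; auto. unfold M in Hincl. rewrite length_map, length_seq in Hincl. lia.
Qed.

(** * Preimages of the three postcritical points *)

Section Count.
Context (f : Csph -> Csph) (D d : nat) (Hf : is_rational_map f D) (HD : (2 <= D)%nat) (Hd : (2 <= d)%nat).

(** Over a noncritical value in the interior [f] has at least D points, and each of them comes from
    one of the d roots of the polynomial. *)
Lemma degree_le a I H x (L : list Csph) : monic_deg a d -> side f (poly a d) I H -> I x ->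
  (forall c, is_critical f c -> In (f c) L) -> (D <= d)%nat.
Proof.
  intros Ha S Hx Hc. destruct (side_avoid _ _ _ _ x L S Hx) as [y [Hy Hy']].
  destruct (rational_regular_fiber Hf ltac:(lia) (v := H y)) as [M [HM [HM1 HM2]]].
  { intros c Hcc E. apply Hy'. rewrite <- E. apply Hc, Hcc. }
  destruct (poly_roots_list a d y ltac:(lia) Ha) as [rs [Hl [Hrs _]]].
  assert (Hincl : incl M (map H rs)).
  { intros z Hz. apply HM1 in Hz. destruct (side_pre _ _ _ _ S y z Hy Hz) as [w [_ [Hw ->]]].
    apply in_map, Hrs, Hw. }
  apply NoDup_incl_length in Hincl; auto. rewrite length_map in Hincl. lia.
Qed.

Lemma side_preimages a I H (A : list C) : monic_deg a d -> side f (poly a d) I H ->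
  NoDup A -> (forall x, In x A -> I x) ->
  exists M : list Csph, NoDup M /\ (forall z, In z M -> In (f z) (map H A)) /\
    (length A * d + 1 <= length M + d)%nat.
Proof.
  intros Ha S HA HI.
  destruct (poly_preimages_ge (a := a) (d := d) ltac:(lia) Ha HA) as [L [HL [HL1 HL2]]].
  change (forall z : C, In z L -> In (poly a d z) A) in HL1.
  assert (HLI : forall z, In z L -> I z).
  { intros z Hz. apply (side_back _ _ _ _ S), HI, HL1, Hz. }
  exists (map H L). split; [|split].
  - clear HL1 HL2. induction L as [|z L IH]; simpl; [constructor|].
    inversion HL; subst. constructor.
    + intros Hin. apply in_map_iff in Hin. destruct Hin as [w [E Hw]].
      assert (w = z) by (apply (side_inj _ _ _ _ S); auto; apply HLI; simpl; auto). subst. auto.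
    + apply IH; auto. intros w Hw. apply HLI. right; auto.
  - intros v Hv. apply in_map_iff in Hv. destruct Hv as [z [<- Hz]].
    rewrite (side_conj _ _ _ _ S) by auto. apply in_map, HL1, Hz.
  - rewrite length_map. exact HL2.
Qed.

Context (p1 p2 p3 : Csph) (Hdist : NoDup (p1 :: p2 :: p3 :: nil))
  (Hpost : forall w, postcritical f w <-> In w (p1 :: p2 :: p3 :: nil)).

Lemma critical_value_post c : is_critical f c -> In (f c) (p1 :: p2 :: p3 :: nil).
Proof. intros Hc. apply Hpost. exists c, O. auto. Qed.

(** Riemann-Hurwitz with three values: 3 D - (2 D - 2) = D + 2. *)
Lemma post_preimages : exists L : list Csph, NoDup L /\
  (forall z, In z L <-> In (f z) (p1 :: p2 :: p3 :: nil)) /\ (length L <= D + 2)%nat.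
Proof.
  destruct (rational_preimages_le Hf ltac:(lia) Hdist critical_value_post) as [L [H1 [H2 H3]]].
  exists L. split; [|split]; auto. simpl in H3. lia.
Qed.

(** The interior would hold at least 2 d + 1 points over the three values, more than D + 2 because D
    <= d and d >= 2. *)
Lemma no_three a I H x1 x2 x3 : monic_deg a d -> side f (poly a d) I H ->
  I x1 -> I x2 -> I x3 -> p1 = H x1 -> p2 = H x2 -> p3 = H x3 -> False.
Proof.
  intros Ha S H1 H2 H3 E1 E2 E3.
  assert (HDd : (D <= d)%nat) by (apply (degree_le a I H x1 _ Ha S H1 critical_value_post)).
  destruct post_preimages as [L [HL [HL1 HL2]]].
  destruct (side_preimages a I H (x1 :: x2 :: x3 :: nil) Ha S) as [M [HM [HM1 HM2]]].
  { apply (NoDup_map_inv H). simpl. rewrite <- E1, <- E2, <- E3. exact Hdist. }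
  { simpl. intros x [<-|[<-|[<-|[]]]]; auto. }
  assert (Hincl : incl M L).
  { intros z Hz. apply HL1. apply HM1 in Hz. simpl in Hz |- *. rewrite E1, E2, E3. exact Hz. }
  apply NoDup_incl_length in Hincl; auto. simpl in HM2. lia.
Qed.

(** At least d + 1 points lie over [p2] and [p3], and at most D + 2 <= d + 2 over all three, which
    leaves at most one over [p1]. The image of [p1] is postcritical and lies on the side of [x], so
    it is [p1]. *)
Lemma two_one a I H a' I' H' x y1 y2 : monic_deg a d -> side f (poly a d) I H ->
  monic_deg a' d -> side f (poly a' d) I' H' ->
  (forall u v, I u -> I' v -> H u <> H' v) ->
  I x -> I' y1 -> I' y2 -> p1 = H x -> p2 = H' y1 -> p3 = H' y2 -> is_polynomial_like f.
Proof.
  intros Ha S Ha' S' Hdisj Hx Hy1 Hy2 E1 E2 E3.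
  assert (HDd : (D <= d)%nat) by (apply (degree_le a I H x _ Ha S Hx critical_value_post)).
  destruct post_preimages as [L [HL [HL1 HL2]]].
  destruct (side_preimages a' I' H' (y1 :: y2 :: nil) Ha' S') as [M [HM [HM1 HM2]]].
  { apply (NoDup_map_inv H'). simpl. rewrite <- E2, <- E3. inversion Hdist; auto. }
  { simpl. intros y [<-|[<-|[]]]; auto. }
  assert (Hp1 : f p1 = p1).
  { assert (Hin : In (f p1) (p1 :: p2 :: p3 :: nil)).
    { apply Hpost. destruct (proj2 (Hpost p1)) as [c [n [Hc E]]]; [left; auto|].
      exists c, (Datatypes.S n). split; auto. rewrite E at 1. reflexivity. }
    assert (HPx := side_fwd _ _ _ _ S x Hx).
    rewrite E1 in Hin at 1. rewrite (side_conj _ _ _ _ S x Hx) in Hin.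
    rewrite E1 at 1. rewrite (side_conj _ _ _ _ S x Hx).
    destruct Hin as [E|[E|[E|[]]]]; auto; exfalso; symmetry in E.
    - rewrite E2 in E. exact (Hdisj _ _ HPx Hy1 E).
    - rewrite E3 in E. exact (Hdisj _ _ HPx Hy2 E). }
  assert (Huniq : forall z z', f z = p1 -> f z' = p1 -> z = z').
  { intros z z' Hz Hz'. apply NNPP. intros Hne.
    assert (HnM : forall u, f u = p1 -> ~ In u M).
    { intros u Hu HuM. apply HM1 in HuM. simpl in HuM. rewrite <- E2, <- E3, Hu in HuM.
      inversion Hdist as [|? ? Hn _]. apply Hn. simpl. destruct HuM as [->|[->|[]]]; auto. }
    assert (HN : NoDup (z :: z' :: M)).
    { constructor; [|constructor; auto]. intros [E|E]; [apply Hne; auto|exact (HnM z Hz E)]. }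
    assert (Hincl : incl (z :: z' :: M) L).
    { intros u [<-|[<-|Hu]]; apply HL1.
      - left; auto.
      - left; auto.
      - right. apply HM1 in Hu. simpl in Hu |- *. rewrite E2, E3. exact Hu. }
    apply NoDup_incl_length in Hincl; auto. simpl in Hincl, HM2. lia. }
  exists p1. intros z. split; intros Hz; [apply Huniq; auto|subst z; auto].
Qed.
End Count.

Lemma two_sides_polynomial f D d p1 p2 p3 a I H a' I' H' :
  is_rational_map f D -> (2 <= D)%nat -> (2 <= d)%nat ->
  p1 <> p2 -> p1 <> p3 -> p2 <> p3 ->
  (forall w, postcritical f w <-> w = p1 \/ w = p2 \/ w = p3) ->
  monic_deg a d -> side f (poly a d) I H -> monic_deg a' d -> side f (poly a' d) I' H' ->
  (forall u v, I u -> I' v -> H u <> H' v) ->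
  (forall w, postcritical f w -> (exists x, I x /\ w = H x) \/ (exists x, I' x /\ w = H' x)) ->
  is_polynomial_like f.
Proof.
  intros Hf HD Hd N12 N13 N23 Hpost Ha S Ha' S' Hdisj Hcov.
  assert (Hdisj' : forall u v, I' u -> I v -> H' u <> H v) by (intros u v Hu Hv E; symmetry in E; revert E; apply Hdisj; auto).
  assert (ND : forall q1 q2 q3 : Csph, q1 <> q2 -> q1 <> q3 -> q2 <> q3 -> NoDup (q1 :: q2 :: q3 :: nil)).
  { intros q1 q2 q3 ? ? ?. repeat constructor; simpl; intuition congruence. }
  assert (Hperm : forall q1 q2 q3 : Csph, (q1 = p1 \/ q2 = p1 \/ q3 = p1) ->
    (q1 = p2 \/ q2 = p2 \/ q3 = p2) -> (q1 = p3 \/ q2 = p3 \/ q3 = p3) ->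
    (q1 = p1 \/ q1 = p2 \/ q1 = p3) -> (q2 = p1 \/ q2 = p2 \/ q2 = p3) ->
    (q3 = p1 \/ q3 = p2 \/ q3 = p3) ->
    forall w, postcritical f w <-> In w (q1 :: q2 :: q3 :: nil)).
  { intros q1 q2 q3 ? ? ? ? ? ? w. rewrite Hpost. simpl. intuition congruence. }
  (* Eight distributions of the three points over the two sides; [Hperm] reorders them so that the
     isolated point comes first. *)
  destruct (Hcov p1) as [[x1 [G1 E1]]|[x1 [G1 E1]]]; [apply Hpost; auto| |];
  (destruct (Hcov p2) as [[x2 [G2 E2]]|[x2 [G2 E2]]]; [apply Hpost; auto| |]);
  (destruct (Hcov p3) as [[x3 [G3 E3]]|[x3 [G3 E3]]]; [apply Hpost; auto| |]).
  - exfalso. apply (no_three f D d Hf HD Hd p1 p2 p3) with a I H x1 x2 x3; auto.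
  - apply (two_one f D d Hf HD Hd p3 p1 p2) with a' I' H' a I H x3 x1 x2; auto.
  - apply (two_one f D d Hf HD Hd p2 p1 p3) with a' I' H' a I H x2 x1 x3; auto.
  - apply (two_one f D d Hf HD Hd p1 p2 p3) with a I H a' I' H' x1 x2 x3; auto.
  - apply (two_one f D d Hf HD Hd p1 p2 p3) with a' I' H' a I H x1 x2 x3; auto.
  - apply (two_one f D d Hf HD Hd p2 p1 p3) with a I H a' I' H' x2 x1 x3; auto.
  - apply (two_one f D d Hf HD Hd p3 p1 p2) with a I H a' I' H' x3 x1 x2; auto.
  - exfalso. apply (no_three f D d Hf HD Hd p1 p2 p3) with a' I' H' x1 x2 x3; auto.
Qed.

(** * Matings *)

(** Exchanges the two polynomials. Gluing angle t to angle -t is a symmetric prescription, so what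
    is shown for one side holds for the other. *)
Definition sum_swap (x : C + C) : C + C := match x with inl z => inr z | inr z => inl z end.

Lemma clos_rst_swap sw sb x y :
  clos_refl_sym_trans (C + C) (mate_base_rel sb sw) x y ->
  clos_refl_sym_trans (C + C) (mate_base_rel sw sb) (sum_swap x) (sum_swap y).
Proof.
  induction 1 as [x y [t [-> ->]]|x|x y _ IH|x y z _ IH1 _ IH2].
  - apply rst_sym, rst_step. exists (- t)%R. simpl. split; auto. rewrite Ropp_involutive. auto.
  - apply rst_refl.
  - apply rst_sym, IH.
  - apply rst_trans with (sum_swap y); auto.
Qed.

(** The body of [conj_to_mating] with [h] as a parameter, so that [h] can be composed with the
    swap. *)
Definition mating_conj (f : Csph -> Csph) (Kw Kb : C -> Prop) (Pw Pb : C -> C) (sw sb : R -> C)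
    (h : C + C -> Csph) : Prop :=
  (forall x eps, mate_dom Kw Kb x -> (0 < eps)%R -> exists delta, (0 < delta)%R /\
     forall y, mate_dom Kw Kb y -> (sum_dist y x < delta)%R -> (chord (h y) (h x) < eps)%R) /\
  (forall w, exists x, mate_dom Kw Kb x /\ h x = w) /\
  (forall x y, mate_dom Kw Kb x -> mate_dom Kw Kb y ->
     (h x = h y <-> clos_refl_sym_trans (C + C) (mate_base_rel sw sb) x y)) /\
  (forall x, mate_dom Kw Kb x -> h (mate_map Pw Pb x) = f (h x)).

Lemma mating_conj_swap f Kw Kb Pw Pb sw sb h :
  mating_conj f Kw Kb Pw Pb sw sb h ->
  mating_conj f Kb Kw Pb Pw sb sw (fun x => h (sum_swap x)).
Proof.
  intros [H1 [H2 [H3 H4]]].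
  assert (Hss : forall x : C + C, sum_swap (sum_swap x) = x) by (intros [z|z]; auto).
  assert (Hd : forall x, mate_dom Kb Kw x <-> mate_dom Kw Kb (sum_swap x)) by (intros [z|z]; simpl; tauto).
  split; [|split; [|split]].
  - intros x e Hx He. destruct (H1 (sum_swap x) e) as [dl [Hdl H]]; auto; [apply Hd, Hx|].
    exists dl. split; auto. intros y Hy Hyx. apply H; [apply Hd, Hy|].
    destruct x, y; exact Hyx.
  - intros w. destruct (H2 w) as [x [Hx E]]. exists (sum_swap x). rewrite Hd, !Hss. auto.
  - intros x y Hx Hy. rewrite H3 by (apply Hd; auto). split; intros H.
    + apply (clos_rst_swap sb sw) in H. rewrite !Hss in H. exact H.
    + apply clos_rst_swap, H.
  - intros x Hx. rewrite <- H4 by (apply Hd, Hx). f_equal. destruct x; reflexivity.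
Qed.

Lemma periodic_Z (g : R -> C) : (forall t, g (t + 1)%R = g t) -> forall (k : Z) t, g (t + IZR k)%R = g t.
Proof.
  intros H.
  assert (HN : forall (n : nat) t, g (t + INR n)%R = g t).
  { induction n as [|n IH]; intros t; [simpl; rewrite Rplus_0_r; auto|].
    rewrite S_INR, <- Rplus_assoc, H. apply IH. }
  intros k t. destruct (Z_le_gt_dec 0 k) as [Hk|Hk].
  - rewrite <- (Z2Nat.id k Hk), <- INR_IZR_INZ. apply HN.
  - rewrite <- (HN (Z.to_nat (- k)) (t + IZR k)%R). f_equal.
    rewrite INR_IZR_INZ, Z2Nat.id, opp_IZR by lia. ring.
Qed.

Section Mating.
Context (f : Csph -> Csph) (d : nat) (Hd : (2 <= d)%nat) (aw ab : nat -> C)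
  (Haw : monic_deg aw d) (Hab : monic_deg ab d)
  (phiw phib : C -> C) (sw sb : R -> C)
  (HRw : riemann_map_ext (filled_julia aw d) phiw sw)
  (HRb : riemann_map_ext (filled_julia ab d) phib sb)
  (h : C + C -> Csph)
  (Hmate : mating_conj f (filled_julia aw d) (filled_julia ab d) (peval aw d) (peval ab d) sw sb h).
Let Kw := filled_julia aw d.
Let Kb := filled_julia ab d.
Let dom := mate_dom Kw Kb.

Let Hcont x eps : dom x -> (0 < eps)%R -> exists delta, (0 < delta)%R /\
  forall y, dom y -> (sum_dist y x < delta)%R -> (chord (h y) (h x) < eps)%R.
Proof. apply Hmate. Qed.

Let Hsurj w : exists x, dom x /\ h x = w.
Proof. apply Hmate. Qed.

Let Hfib x y : dom x -> dom y ->
  (h x = h y <-> clos_refl_sym_trans (C + C) (mate_base_rel sw sb) x y).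
Proof. apply Hmate. Qed.

Let Hconj x : dom x -> h (mate_map (peval aw d) (peval ab d) x) = f (h x).
Proof. apply Hmate. Qed.

Let seam (x : C + C) : Prop :=
  match x with inl z => exists t, z = sw t | inr z => exists t, z = sb t end.

(** The generating pairs consist of boundary points, so the class of an interior point is a
    singleton. *)
Lemma equiv_seam x y : clos_refl_sym_trans (C + C) (mate_base_rel sw sb) x y ->
  x = y \/ (seam x /\ seam y).
Proof.
  induction 1 as [x y [t [-> ->]]|x|x y _ IH|x y z _ IH1 _ IH2].
  - right. split; [exists t|exists (- t)%R]; auto.
  - left; auto.
  - intuition.
  - destruct IH1 as [->|[]], IH2 as [->|[]]; auto.
Qed.

Lemma dom_forward x : dom x -> dom (mate_map (peval aw d) (peval ab d) x).
Proof. destruct x as [z|z]; intros Hz; apply (julia_inv _ d z) in Hz; exact Hz. Qed.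

(** The glued boundary in the sphere, parametrised by the angle of the first polynomial. *)
Let hs (t : R) : Csph := h (inl (sw t)).

Lemma sw_julia t : Kw (sw t).
Proof. apply (sigma_bdry aw d phiw sw HRw). Qed.

Lemma sb_julia t : Kb (sb t).
Proof. apply (sigma_bdry ab d phib sb HRb). Qed.

Lemma seam_b t : h (inr (sb t)) = hs (- t).
Proof.
  symmetry. apply Hfib; [apply sw_julia|apply sb_julia|].
  apply rst_step. exists (- t)%R. rewrite Ropp_involutive. auto.
Qed.

Lemma hs_conj t : f (hs t) = hs (INR d * t)%R.
Proof.
  unfold hs. rewrite <- Hconj by apply sw_julia. simpl. f_equal. f_equal.
  apply (sigma_semiconj aw d Hd Haw phiw sw HRw).
Qed.

Lemma hs_iter n t : iter n f (hs t) = hs (INR d ^ n * t)%R.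
Proof.
  induction n as [|n IH]; simpl; [rewrite Rmult_1_l; auto|].
  rewrite IH, hs_conj. f_equal. ring.
Qed.

Lemma hs_cont t e : (0 < e)%R -> exists dl, (0 < dl)%R /\
  forall s, (Rabs (s - t) < dl)%R -> (chord (hs s) (hs t) < e)%R.
Proof.
  intros He. destruct (Hcont (inl (sw t)) e (sw_julia t) He) as [d1 [Hd1 H1]].
  destruct (sigma_cont aw d phiw sw HRw t d1 Hd1) as [d2 [Hd2 H2]].
  exists d2. split; auto. intros s Hs. apply H1; [apply sw_julia|]. apply H2, Hs.
Qed.

(* Multiplication by [d] spreads any arc over the whole circle, so equicontinuity at
   one point of the seam forces the seam to be a single point. *)
Lemma fatou_seam_const t0 : in_Fatou f (hs t0) -> forall s s', hs s = hs s'.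
Proof.
  intros [r [Hr HF]].
  assert (Hz : (chord (hs t0) (hs t0) < r)%R).
  { assert (E : chord (hs t0) (hs t0) = 0).
    { rewrite chord_stereo. unfold dist3. rewrite Cmod_sub_refl, Rminus_diag.
      change (Cmod 0 = 0). apply Cmod_0. }
    rewrite E. exact Hr. }
  assert (Hsmall : forall e, (0 < e)%R -> exists q, forall s, (chord (hs s) q < e)%R).
  { intros e He. destruct (HF (hs t0) Hz e He) as [dl [Hdl H]].
    destruct (hs_cont t0 (Rmin r dl)) as [et [Het Hs]]; [apply Rmin_pos; auto|].
    assert (HD : (2 <= INR d)%R) by (apply (le_INR 2); auto).
    destruct (Pow_x_infinity (INR d)) with (b := (/ et + 1)%R) as [n Hn]; [rewrite Rabs_pos_eq; lra|].
    specialize (Hn n (le_n _)). rewrite Rabs_pos_eq in Hn by (apply pow_le; lra).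
    assert (Hie : (0 < / et)%R) by (apply Rinv_0_lt_compat; auto).
    exists (iter n f (hs t0)). intros s.
    set (N := (INR d ^ n)%R) in *.
    (* The angle [t] is the one just after [t0] that n steps carry to [s] modulo 1: [up] puts N (t -
       t0) in (0, 1]. As N > 1 / et, it lies within [et] of [t0]. *)
    set (k := up (N * t0 - s)).
    destruct (archimed (N * t0 - s)) as [K1 K2]. fold k in K1, K2.
    set (t := ((s + IZR k) / N)%R).
    assert (ENt : (N * t = s + IZR k)%R) by (unfold t; field; lra).
    assert (Ht : (Rabs (t - t0) < et)%R).
    { assert (Hb : (0 < N * (t - t0) <= 1)%R) by (rewrite Rmult_minus_distr_l, ENt; lra).
      assert (HeN : (1 < et * N)%R).
      { apply Rlt_le_trans with (et * (/ et + 1))%R; [|apply Rmult_le_compat_l; lra].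
        rewrite Rmult_plus_distr_l, Rinv_r by lra. lra. }
      apply Rabs_def1; nra. }
    specialize (Hs t Ht).
    assert (G := H n (hs t) (Rlt_le_trans _ _ _ Hs (Rmin_l _ _)) (Rlt_le_trans _ _ _ Hs (Rmin_r _ _))).
    rewrite hs_iter in G. fold N in G. rewrite ENt in G.
    replace (hs s) with (hs (s + IZR k)%R); auto.
    unfold hs. rewrite (periodic_Z sw) by apply HRw. reflexivity. }
  intros s s'. apply chord_small_eq. intros e He.
  destruct (Hsmall (e / 2)%R) as [q Hq]; [lra|].
  generalize (chord_triangle (hs s) q (hs s')), (Hq s), (Hq s'). rewrite (chord_sym q). lra.
Qed.

Lemma int_not_seam_w z : julia_int aw d z -> ~ seam (inl z).
Proof. intros [_ Hb] [t ->]. apply Hb, (sigma_bdry aw d phiw sw HRw). Qed.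

Lemma bdry_seam_w z : Kw z -> ~ julia_int aw d z -> seam (inl z).
Proof.
  intros Hz Hn. apply (sigma_surj aw d phiw sw HRw). apply NNPP. intros Hb. apply Hn. split; auto.
Qed.

Lemma bdry_seam_b z : Kb z -> ~ julia_int ab d z -> seam (inr z).
Proof.
  intros Hz Hn. apply (sigma_surj ab d phib sb HRb). apply NNPP. intros Hb. apply Hn. split; auto.
Qed.

Lemma seam_value x : seam x -> exists t, h x = hs t.
Proof.
  destruct x as [z|z]; intros [t ->]; [exists t; auto|exists (- t)%R; apply seam_b].
Qed.

(** A boundary point is some [sw t] and maps to [sw (d t)], again on the boundary, so only interior
    points can enter the interior. *)
Lemma int_back_w z : julia_int aw d (poly aw d z) -> julia_int aw d z.
Proof.
  intros H. assert (Kz : Kw z) by (apply (julia_inv aw d), H).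
  apply NNPP. intros Hn. apply (bdry_seam_w z Kz) in Hn. destruct Hn as [t ->].
  apply (int_not_seam_w _ H). exists (INR d * t)%R.
  apply (sigma_semiconj aw d Hd Haw phiw sw HRw).
Qed.

(** Singleton classes make [h] injective on the interior. They also show that a point over
    [h (inl x)], for x in the interior, is represented in the first filled Julia set by a preimage
    of x under the polynomial. *)
Lemma side_w : side f (poly aw d) (julia_int aw d) (fun z => h (inl z)).
Proof.
  split.
  - intros x y Hx Hy E. apply Hfib in E; [|apply Hx|apply Hy].
    apply equiv_seam in E. destruct E as [E|[E _]]; [injection E; auto|].
    contradiction (int_not_seam_w x Hx E).
  - intros x Hx. apply julia_int_forward; auto. lia.
  - intros x Hx. rewrite <- Hconj by apply Hx. reflexivity.
  - apply int_back_w.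
  - intros x z Hx E. destruct (Hsurj z) as [y [Hy <-]].
    rewrite <- Hconj in E by auto.
    assert (Hdy := dom_forward y Hy).
    apply Hfib in E; [|exact Hdy|apply Hx].
    apply equiv_seam in E. destruct E as [E|[_ E]]; [|contradiction (int_not_seam_w x Hx E)].
    destruct y as [y|y]; simpl in E; [|discriminate]. injection E as E.
    exists y. split; [|split; auto]. apply int_back_w. unfold poly. rewrite E. exact Hx.
  - apply julia_int_open.
Qed.

(** The totally invariant point is [hs 0]: a point mapped to it is represented on a boundary, since
    interiors map into interiors, and all boundary points have the same image. *)
Lemma seam_const_polynomial : (forall s s', hs s = hs s') -> is_polynomial_like f.
Proof.
  intros Hc. exists (hs 0).
  assert (Hseam : forall x, seam x -> h x = hs 0).
  { intros x Hx. destruct (seam_value x Hx) as [t ->]. apply Hc. }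
  intros z. split.
  - intros E. destruct (Hsurj z) as [y [Hy <-]]. rewrite <- Hconj in E by auto.
    assert (Hdy := dom_forward y Hy).
    apply Hfib in E; [|exact Hdy|apply sw_julia].
    assert (Hs : seam (mate_map (peval aw d) (peval ab d) y)).
    { apply equiv_seam in E. destruct E as [->|[E _]]; auto. exists 0. auto. }
    apply Hseam. destruct y as [y|y]; simpl in Hy, Hs.
    + apply bdry_seam_w; auto. intros Hi. apply (int_not_seam_w (poly aw d y)); auto.
      apply julia_int_forward; auto. lia.
    + apply bdry_seam_b; auto. intros Hi.
      assert (Hi' : julia_int ab d (poly ab d y)) by (apply julia_int_forward; auto; lia).
      destruct Hs as [t Ht]. apply Hi'. unfold poly. rewrite Ht. apply (sigma_bdry ab d phib sb HRb).
  - intros ->. rewrite hs_conj. apply Hc.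
Qed.

Lemma fatou_cover : (exists s s', hs s <> hs s') -> forall w, in_Fatou f w ->
  (exists z, julia_int aw d z /\ w = h (inl z)) \/ (exists z, julia_int ab d z /\ w = h (inr z)).
Proof.
  intros [s [s' Hne]] w Hw. destruct (Hsurj w) as [x [Hx <-]].
  assert (Hns : ~ seam x).
  { intros Hs. destruct (seam_value x Hs) as [t E]. rewrite E in Hw.
    apply Hne. apply (fatou_seam_const t Hw). }
  destruct x as [z|z]; [left|right]; exists z; split; auto; apply NNPP; intros Hn; apply Hns.
  - apply bdry_seam_w; auto.
  - apply bdry_seam_b; auto.
Qed.

Lemma sides_disjoint u v : julia_int aw d u -> julia_int ab d v -> h (inl u) <> h (inr v).
Proof.
  intros Hu Hv E. apply Hfib in E; [|apply Hu|apply Hv].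
  apply equiv_seam in E. destruct E as [E|[E _]]; [discriminate|contradiction (int_not_seam_w u Hu E)].
Qed.
End Mating.

Lemma side_iter f P I H x n : side f P I H -> I x -> I (iter n P x) /\ iter n f (H x) = H (iter n P x).
Proof.
  intros S Hx. induction n as [|n [IH1 IH2]]; simpl; auto. split.
  - apply (side_fwd _ _ _ _ S), IH1.
  - rewrite IH2. apply (side_conj _ _ _ _ S), IH1.
Qed.

Theorem theorem4p7 (f : Csph -> Csph) (d : nat) :
  is_rational_map f d -> (2 <= d)%nat ->
  hyperbolic f -> postcritically_finite f -> post_card3 f ->
  ~ is_polynomial_like f ->
  ~ arises_as_mating f.
Proof.
  intros Hf HD Hyp _ [p1 [p2 [p3 [N12 [N13 [N23 Hpost]]]]]] Hnp
    [k [aw [ab [Hk [Haw [Hab [_ [_ [_ [_ [_ [_ [phiw [phib [sw [sb [HRw [HRb Hmate]]]]]]]]]]]]]]]]]].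
  destruct Hmate as [h Hm].
  change (mating_conj f (filled_julia aw k) (filled_julia ab k) (peval aw k) (peval ab k) sw sb h) in Hm.
  assert (Sw := side_w f k Hk aw ab Haw phiw sw sb HRw h Hm).
  assert (Sb := side_w f k Hk ab aw Hab phib sb sw HRb _ (mating_conj_swap _ _ _ _ _ _ _ _ Hm)).
  simpl in Sb.
  destruct (classic (exists s s', h (inl (sw s)) <> h (inl (sw s')))) as [Hne|Hc].
  - apply Hnp.
    apply (two_sides_polynomial f d k p1 p2 p3 aw _ _ ab _ _ Hf HD Hk N12 N13 N23 Hpost Haw Sw Hab Sb).
    + apply (sides_disjoint f k aw ab phiw sw sb HRw h Hm).
    (* Interiors are forward invariant, so a postcritical point lies on the side of the critical
       point it comes from. *)
    + intros w [c [n [Hc ->]]].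
      destruct (fatou_cover f k Hk aw ab Haw phiw phib sw sb HRw HRb h Hm Hne c (Hyp c Hc))
        as [[z [Hz ->]]|[z [Hz ->]]]; [left|right].
      * destruct (side_iter _ _ _ _ z (S n) Sw Hz) as [H1 H2]. eauto.
      * destruct (side_iter _ _ _ _ z (S n) Sb Hz) as [H1 H2]. eauto.
  - apply Hnp. apply (seam_const_polynomial f k Hk aw ab Haw Hab phiw phib sw sb HRw HRb h Hm).
    intros s s'. apply NNPP. intros Hn. apply Hc. eauto.
Qed.
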